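(* Let $\lambda>1$, $\Delta_1=[-\lambda,-1]$, $\Delta_2=[1,\lambda]$, and let $\mathcal R$, $\pi$, $\psi^{(1)}$, $\psi^{(2)}$ be as in the context. Then the equation $a^8+(16\lambda^2-8)a^6+18a^4-27=0$ has a unique solution $a\in(0,1)$. With this $a$, put $$H(z)=z-\frac{(1-a^2)^2z}{(1+a^2)(1-z^2)},\qquad G(z)=\frac{H(z)}{H(a)}.$$ Then $G$ lifts to a conformal homeomorphism $g:\overline{\mathbb C}\to\mathcal R$ with $\pi\circ g=G$, and, writing $G^{-1}:=g^{-1}:\mathcal R\to\overline{\mathbb C}$, $$\psi^{(1)}=\frac{1+a^2}{2a^3}\,(G^{-1}+1),\qquad \psi^{(2)}=\frac{(1-a^2)^2}{8a^3}\,\frac{G^{-1}+1}{G^{-1}-1}.$$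
   Context: $\overline{\mathbb C}$ is the extended complex plane. Given $\Delta_1$ and $\Delta_2$, $\mathcal R$ is the compact three-sheeted Riemann surface formed by the sheets $\mathcal R_0=\overline{\mathbb C}\setminus\Delta_1$, $\mathcal R_1=\overline{\mathbb C}\setminus(\Delta_1\cup\Delta_2)$, $\mathcal R_2=\overline{\mathbb C}\setminus\Delta_2$, where $\mathcal R_0$ and $\mathcal R_1$ are glued crosswise along $\Delta_1$ (upper bank of one identified with lower bank of the other) and $\mathcal R_1$ and $\mathcal R_2$ are glued crosswise along $\Delta_2$. It is a branched cover of $\overline{\mathbb C}$ with projection $\pi$, of genus $0$. For $w\in\overline{\mathbb C}$, $w^{(k)}$ denotes the point of sheet $\mathcal R_k$ over $w$. For $l\in\{1,2\}$, $\psi^{(l)}$ denotes the conformal map of $\mathcal R$ onto $\overline{\mathbb C}$ with $\psi^{(l)}(w)=w+O(1)$ as $w\to\infty^{(l)}$ and $\psi^{(l)}(w)=C_1/w+O(1/w^2)$ as $w\to\infty^{(0)}$ for some constant $C_1$. *)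

(* Defs.v *)
From Stdlib Require Import Reals Lra ClassicalDescription.
From Coquelicot Require Import Coquelicot.
Open Scope R_scope.

(* [Some z] is the finite point z, [None] is the point at infinity. *)
Definition CS := option C.

Definition cs_lim (u : nat -> CS) (w : CS) : Prop :=
  match w with
  | Some z => forall eps, 0 < eps -> exists N, forall n, (N <= n)%nat ->
                exists v, u n = Some v /\ Cmod (Cminus v z) < eps
  | None => forall M, exists N, forall n, (N <= n)%nat ->
                u n = None \/ exists v, u n = Some v /\ M < Cmod v
  end.

Definition crecip (w : CS) : CS :=
  match w with
  | None => Some (RtoC 0)
  | Some v => if excluded_middle_informative (v = RtoC 0) then None
              else Some (Cinv v)
  end.

Definition holo_near (F : CS -> CS) (z : C) : Prop :=
  exists d, 0 < d /\ exists F0 : C -> C, forall u, Cmod (Cminus u z) < d ->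
     F (Some u) = Some (F0 u) /\ @ex_derive C_AbsRing C_NormedModule F0 u.

(* F : Chat -> Chat is holomorphic (= meromorphic, as a map into Chat) at
   the finite point z : chart w on the source, chart w or 1/w on the target *)
Definition mero_at (F : CS -> CS) (z : C) : Prop :=
  holo_near F z \/ holo_near (fun w => crecip (F w)) z.

Definition mero_at_CS (F : CS -> CS) (w : CS) : Prop :=
  match w with
  | Some z => mero_at F z
  | None => mero_at (fun x => F (crecip x)) (RtoC 0)
  end.

Inductive sheet := S0 | S1 | S2.

Section Surface.
Variable lam : R.

Definition inD1 (z : C) := snd z = 0 /\ - lam <= fst z <= -1.
Definition inD2 (z : C) := snd z = 0 /\ 1 <= fst z <= lam.
Definition intD1 (z : C) := snd z = 0 /\ - lam < fst z < -1.
Definition intD2 (z : C) := snd z = 0 /\ 1 < fst z < lam.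
Definition branch1 (z : C) := z = RtoC (- lam) \/ z = RtoC (-1).
Definition branch2 (z : C) := z = RtoC 1 \/ z = RtoC lam.

(* Points of R are represented by pairs (k, w) : sheet * Chat.
   Over an interior point x of a cut between sheets k and k', the pair (k,x)
   denotes the point "upper bank of sheet k = lower bank of sheet k'".
   The branch points (endpoints of the cuts) are shared by two sheets; their
   canonical representative is on sheet 0 (over Delta_1) resp. sheet 2
   (over Delta_2).  [canon] computes the canonical sheet. *)
Definition canon (k : sheet) (w : CS) : sheet :=
  match k, w with
  | S1, Some z =>
      if excluded_middle_informative (branch1 z) then S0
      else if excluded_middle_informative (branch2 z) then S2 else S1
  | _, _ => k
  end.

Lemma canon_idem k w : canon (canon k w) w = canon k w.
Proof.
  destruct k, w as [z|]; simpl; auto.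
  destruct (excluded_middle_informative (branch1 z)); simpl; auto.
  destruct (excluded_middle_informative (branch2 z)); simpl; auto.
  destruct (excluded_middle_informative (branch1 z)); try contradiction.
  destruct (excluded_middle_informative (branch2 z)); try contradiction; auto.
Qed.

Definition RS := { p : sheet * CS | canon (fst p) (snd p) = fst p }.

Definition rs_sheet (p : RS) : sheet := fst (proj1_sig p).
Definition proj (p : RS) : CS := snd (proj1_sig p).

Definition mkpt (k : sheet) (w : CS) : RS :=
  exist _ (canon k w, w) (canon_idem k w).

Definition swap01 (k : sheet) := match k with S0 => S1 | S1 => S0 | S2 => S2 end.
Definition swap12 (k : sheet) := match k with S0 => S0 | S1 => S2 | S2 => S1 end.

(* [allowed q p] : the sheet of p is one of those a point over proj p may have
   when p lies in a small neighbourhood of q (cut-and-paste topology; the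
   gluing along the cuts is crosswise). *)
Definition allowed (q p : sheet * CS) : Prop :=
  let (k, w) := q in let (k', w') := p in
  match w, w' with
  | Some z, Some y =>
      if excluded_middle_informative (intD1 z /\ k <> S2) then
        k' = (if Rle_dec 0 (snd y) then k else swap01 k)
      else if excluded_middle_informative (intD2 z /\ k <> S0) then
        k' = (if Rle_dec 0 (snd y) then k else swap12 k)
      else if excluded_middle_informative (branch1 z /\ k = S0) then k' <> S2
      else if excluded_middle_informative (branch2 z /\ k = S2) then k' <> S0
      else k' = k
  | _, _ => k' = k
  end.

(* sequential convergence in R (R is metrizable, so this determines
   its topology) *)
Definition rs_lim (u : nat -> RS) (q : RS) : Prop :=
  cs_lim (fun n => proj (u n)) (proj q) /\
  exists N, forall n, (N <= n)%nat -> allowed (proj1_sig q) (proj1_sig (u n)).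

Definition cont_CR (g : CS -> RS) : Prop :=
  forall u z, cs_lim u z -> rs_lim (fun n => g (u n)) (g z).
Definition cont_RC (f : RS -> CS) : Prop :=
  forall u q, rs_lim u q -> cs_lim (fun n => f (u n)) (f q).

Definition on_cut (k : sheet) (w : CS) : Prop :=
  match w with
  | None => False
  | Some z => (k <> S2 /\ inD1 z) \/ (k <> S0 /\ inD2 z)
  end.

(* g : Chat -> R is a conformal homeomorphism: a homeomorphism which is
   holomorphic (continuous, with pi o g holomorphic; near branch points this
   is equivalent to holomorphy in the local uniformizer). *)
Definition conformal_homeo (g : CS -> RS) : Prop :=
  (exists h : RS -> CS, (forall z, h (g z) = z) /\ (forall p, g (h p) = p)
                         /\ cont_CR g /\ cont_RC h) /\
  (forall w, mero_at_CS (fun x => proj (g x)) w).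

(* psi : R -> Chat is a conformal map of R onto Chat: a bijection, continuous,
   and holomorphic in the coordinate pi (resp. 1/pi) on each open sheet away
   from the cuts (by continuity, removability across the cuts and at branch
   points then gives holomorphy on all of R). *)
Definition conformal_onto (psi : RS -> CS) : Prop :=
  (exists h : CS -> RS, (forall p, h (psi p) = p) /\ (forall w, psi (h w) = w)) /\
  cont_RC psi /\
  (forall k w, ~ on_cut k w -> mero_at_CS (fun x => psi (mkpt k x)) w).

Definition is_psi (l : sheet) (psi : RS -> CS) : Prop :=
  conformal_onto psi /\
  (exists M K, forall w, M < Cmod w ->
     exists v, psi (mkpt l (Some w)) = Some v /\ Cmod (Cminus v w) <= K) /\
  (exists C1 M K, forall w, M < Cmod w ->
     exists v, psi (mkpt S0 (Some w)) = Some v /\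
       Cmod (Cminus v (Cdiv C1 w)) <= K / (Cmod w ^ 2)).

End Surface.

Definition Hc (a : R) (z : C) : C :=
  Cminus z (Cdiv (Cmult (RtoC ((1 - a ^ 2) ^ 2)) z)
                 (Cmult (RtoC (1 + a ^ 2)) (Cminus (RtoC 1) (Cmult z z)))).

Definition Gmap (a : R) (w : CS) : CS :=
  match w with
  | None => None
  | Some z => if excluded_middle_informative (z = RtoC 1 \/ z = RtoC (-1)) then None
              else Some (Cdiv (Hc a z) (Hc a (RtoC a)))
  end.

Definition m1 (a : R) (w : CS) : CS :=
  match w with
  | None => None
  | Some z => Some (Cmult (RtoC ((1 + a ^ 2) / (2 * a ^ 3))) (Cplus z (RtoC 1)))
  end.

Definition m2 (a : R) (w : CS) : CS :=
  match w with
  | None => Some (RtoC ((1 - a ^ 2) ^ 2 / (8 * a ^ 3)))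
  | Some z => if excluded_middle_informative (z = RtoC 1) then None
              else Some (Cmult (RtoC ((1 - a ^ 2) ^ 2 / (8 * a ^ 3)))
                               (Cdiv (Cplus z (RtoC 1)) (Cminus z (RtoC 1))))
  end.

(* Main.v *)
(** Put [c = (1-a^2)^2/(1+a^2)], so that [H(z) = z + c z/(z^2-1)] has the critical points [a, -a, b, -b] and
    [Im H(x+iy) = y q/|z^2-1|^2] with [q = |z^2-1|^2 - c (|z|^2+1)]. The curves [q = 0] go to the cuts,
    [{q > 0}] is the part of the sphere over sheet 1, and the two components of [{q < 0}] are the parts over
    sheets 0 and 2. Each part contains at most one root of [H = w] by inequalities between the symmetric
    functions of the three roots, hence exactly one by counting; the inverse of the resulting bijection
    is continuous because the sphere is compact.

    For the uniqueness of psi let [D] be the difference of two candidates. It is bounded, and for every [s]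
    the product of [D(w^(k)) - s] over the three sheets is continuous in [w], since crossing a cut only
    permutes the factors, and holomorphic off the real line. By Liouville's theorem it is constant; so [D]
    takes at most three values, is constant by connectedness, and vanishes at infinity on sheet 0.

    Liouville's theorem is needed for a function [f] that is only continuous on the real line. Goursat's
    theorem in logarithmic polar coordinates gives the mean value property on circles for functions
    holomorphic off both axes. Applied to [f] and to [z (f(z) - f(iy))/(z - iy)] on large circles it gives
    [f(iy) = f(0)], and translations give [f(x+iy) = f(x)], so [f' = 0] off the line. *)
Require Import Defs.
From Stdlib Require Import Reals Lra Lia Psatz Classical ClassicalEpsilon ClassicalDescription Eqdep_dec.
From Coquelicot Require Import Coquelicot.
Open Scope R_scope.

(** * Goursat's theorem for rectangles *)

(** Holomorphy on the surface is known only off the cuts, in the coordinate of a sheet. The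
    uniqueness proof avoids uniformizers at branch points and gluing across cuts: the product over
    the three sheets is single-valued on the base, and there the whole defect is the real line,
    where continuity is enough. The price is a Liouville theorem that tolerates a line of mere
    continuity. The difference quotient used for it has a further such point at [iy]; giving up the
    whole imaginary axis turns the exceptional set into four rays, and in logarithmic polar
    coordinates these are horizontal lines, the sides of strips.

    The constants: with [X = x^2] the critical points of [H] satisfy [(X-1)^2 = c (X+1)], so [a]
    determines [c] and then [b^2 = (3-a^2)/(1+a^2)]. The branch points are the values of [G] at
    [a, -a, b, -b]. Dividing by [H(a)] puts two of them at [1] and [-1]; the remaining condition
    [H(b) = lam H(a)], squared to remove the odd powers of [b], is the equation of degree eight. *)

Lemma half_pow_pos (n : nat) : 0 < (/ 2) ^ n.
Proof. apply pow_lt; lra. Qed.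

Lemma nested_intervals (x w : nat -> R) :
  (forall n, 0 <= w n) ->
  (forall n, x n <= x (S n)) -> (forall n, x (S n) + w (S n) <= x n + w n) ->
  exists X, forall n, x n <= X <= x n + w n.
Proof.
  intros Hw Hx Hy.
  assert (Hmono : forall m n, x n <= x (n + m)%nat).
  { induction m; intro n.
    - rewrite Nat.add_0_r; lra.
    - rewrite Nat.add_succ_r; specialize (IHm n); specialize (Hx (n + m)%nat); lra. }
  assert (Hmono' : forall m n, x (n + m)%nat + w (n + m)%nat <= x n + w n).
  { induction m; intro n.
    - rewrite Nat.add_0_r; lra.
    - rewrite Nat.add_succ_r; specialize (IHm n); specialize (Hy (n + m)%nat); lra. }
  assert (Hcross : forall n m, x n <= x m + w m).
  { intros n m. destruct (Nat.le_ge_cases n m) as [H|H].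
    - replace m with (n + (m - n))%nat at 1 by lia.
      generalize (Hmono (m - n)%nat n) (Hw (n + (m - n))%nat).
      replace (n + (m - n))%nat with m by lia; lra.
    - generalize (Hmono' (n - m)%nat m) (Hw (m + (n - m))%nat).
      replace (m + (n - m))%nat with n by lia; lra. }
  destruct (completeness (fun r => exists n, r = x n)) as [X [HX1 HX2]].
  - exists (x O + w O). intros r [n ->]; apply Hcross.
  - exists (x O), O; reflexivity.
  - exists X. intro n. split.
    + apply HX1; exists n; reflexivity.
    + apply HX2. intros r [m ->]; apply Hcross.
Qed.

(** Goursat's bisection with the integral abstracted away: [J x y t] stands for the boundary
    integral over the rectangle with corner [(x, y)] and sides [t h], [t k]. Some quarter keeps at
    least a quarter of [|J|], so along the nested rectangles [|J|] decreases no faster than [t^2],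
    whereas the last hypothesis makes it smaller than any multiple of [t^2] at the limit point. *)
Lemma bisection_2d (J : R -> R -> R -> R) (h k x0 y0 : R) :
  0 < h -> 0 < k ->
  (forall x y t, 0 < t ->
     Rabs (J x y t) <= Rabs (J x y (t / 2)) + Rabs (J (x + t / 2 * h) y (t / 2)) +
       Rabs (J x (y + t / 2 * k) (t / 2)) +
       Rabs (J (x + t / 2 * h) (y + t / 2 * k) (t / 2))) ->
  (forall x y, x0 <= x <= x0 + h -> y0 <= y <= y0 + k -> forall eps, 0 < eps ->
     exists d, 0 < d /\ forall x' y' t, 0 < t < d ->
       x' <= x <= x' + t * h -> y' <= y <= y' + t * k ->
       Rabs (J x' y' t) <= eps * t ^ 2) ->
  J x0 y0 1 = 0.
Proof.
  intros Hh Hk Hsplit Hloc.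
  assert (Hnext : forall p t, 0 < t -> exists p' : R * R,
      (fst p' = fst p \/ fst p' = fst p + t / 2 * h) /\
      (snd p' = snd p \/ snd p' = snd p + t / 2 * k) /\
      Rabs (J (fst p) (snd p) t) / 4 <= Rabs (J (fst p') (snd p') (t / 2))).
  { intros [x y] t Ht. specialize (Hsplit x y t Ht). simpl.
    destruct (Rle_dec (Rabs (J x y t) / 4) (Rabs (J x y (t / 2)))).
    { exists (x, y); simpl; auto. }
    destruct (Rle_dec (Rabs (J x y t) / 4) (Rabs (J (x + t / 2 * h) y (t / 2)))).
    { exists (x + t / 2 * h, y); simpl; auto. }
    destruct (Rle_dec (Rabs (J x y t) / 4) (Rabs (J x (y + t / 2 * k) (t / 2)))).
    { exists (x, y + t / 2 * k); simpl; auto. }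
    exists (x + t / 2 * h, y + t / 2 * k); simpl; repeat split; auto; lra. }
  assert (Hnext' : forall n p, exists p' : R * R,
      (fst p' = fst p \/ fst p' = fst p + (/ 2) ^ S n * h) /\
      (snd p' = snd p \/ snd p' = snd p + (/ 2) ^ S n * k) /\
      Rabs (J (fst p) (snd p) ((/ 2) ^ n)) / 4 <= Rabs (J (fst p') (snd p') ((/ 2) ^ S n))).
  { intros n p. destruct (Hnext p _ (half_pow_pos n)) as [p' Hp'].
    exists p'. replace ((/ 2) ^ S n) with ((/ 2) ^ n / 2); [exact Hp'|simpl; field]. }
  (* Stage [n] always has scale [2^-n], so the recursion carries only the corner. *)
  set (next := fun n p => proj1_sig (constructive_indefinite_description _ (Hnext' n p))).
  set (s := fix s n := match n with O => (x0, y0) | S n => next n (s n) end).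
  assert (Hs : forall n,
      (fst (s (S n)) = fst (s n) \/ fst (s (S n)) = fst (s n) + (/ 2) ^ S n * h) /\
      (snd (s (S n)) = snd (s n) \/ snd (s (S n)) = snd (s n) + (/ 2) ^ S n * k) /\
      Rabs (J (fst (s n)) (snd (s n)) ((/ 2) ^ n)) / 4 <=
      Rabs (J (fst (s (S n))) (snd (s (S n))) ((/ 2) ^ S n))).
  { intro n. exact (proj2_sig (constructive_indefinite_description _ (Hnext' n (s n)))). }
  assert (Hp2 : forall n, (/ 2) ^ n = 2 * (/ 2) ^ S n) by (intro n; simpl; field).
  destruct (nested_intervals (fun n => fst (s n)) (fun n => (/ 2) ^ n * h)) as [X HX].
  { intro n. generalize (half_pow_pos n); nra. }
  { intro n. generalize (half_pow_pos (S n)) (proj1 (Hs n)); nra. }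
  { intro n. generalize (half_pow_pos (S n)) (proj1 (Hs n)); rewrite (Hp2 n); nra. }
  destruct (nested_intervals (fun n => snd (s n)) (fun n => (/ 2) ^ n * k)) as [Y HY].
  { intro n. generalize (half_pow_pos n); nra. }
  { intro n. generalize (half_pow_pos (S n)) (proj1 (proj2 (Hs n))); nra. }
  { intro n. generalize (half_pow_pos (S n)) (proj1 (proj2 (Hs n))); rewrite (Hp2 n); nra. }
  assert (Hlow : forall n, Rabs (J x0 y0 1) * ((/ 2) ^ n) ^ 2 <=
                 Rabs (J (fst (s n)) (snd (s n)) ((/ 2) ^ n))).
  { induction n as [|n IH].
    - simpl. lra.
    - destruct (Hs n) as [_ [_ H]]. eapply Rle_trans; [|exact H].
      assert (H2 : ((/ 2) ^ n) ^ 2 = 4 * ((/ 2) ^ S n) ^ 2)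
        by (rewrite (Hp2 n); ring).
      rewrite H2 in IH. lra. }
  destruct (Req_dec (J x0 y0 1) 0) as [|Hne]; [assumption|exfalso].
  assert (HJ : 0 < Rabs (J x0 y0 1)) by (apply Rabs_pos_lt; assumption).
  specialize (HX) as HX0. specialize (HX0 O). specialize (HY) as HY0. specialize (HY0 O).
  simpl in HX0, HY0.
  (* Half of [|J x0 y0 1|] as tolerance contradicts [Hlow], which loses exactly the factor [t^2]. *)
  destruct (Hloc X Y ltac:(lra) ltac:(lra) (Rabs (J x0 y0 1) / 2) ltac:(lra)) as [d [Hd H]].
  destruct (pow_lt_1_zero (/ 2) ltac:(rewrite Rabs_pos_eq; lra) d Hd) as [N HN].
  specialize (HN N (Nat.le_refl _)). rewrite Rabs_pos_eq in HN by (left; apply half_pow_pos).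
  generalize (H _ _ _ (conj (half_pow_pos N) HN) (HX N) (HY N)) (Hlow N) (half_pow_pos N).
  intros. assert (0 < ((/ 2) ^ N) ^ 2) by (apply pow_lt; assumption). nra.
Qed.

Definition continuous_2d (f : R -> R -> R) : Prop := forall x y, continuity_2d_pt f x y.

Lemma continuous_2d_l f x : continuous_2d f -> forall y, continuous (f x) y.
Proof.
  intros H y. apply filterlim_locally. intro eps.
  apply (locally_2d_1d_const_x _ _ _ (H x y eps)).
Qed.

Lemma continuous_2d_r f y : continuous_2d f -> forall x, continuous (fun u => f u y) x.
Proof.
  intros H x. apply filterlim_locally. intro eps.
  apply (locally_2d_1d_const_y _ _ _ (H x y eps)).
Qed.

Lemma continuous_ex_RInt (f : R -> R) a b : (forall x, continuous f x) -> ex_RInt f a b.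
Proof. intro H. apply (ex_RInt_continuous (V := R_CompleteNormedModule)). auto. Qed.

Lemma RInt_minus_const_bound (f g : R -> R) a b A M :
  a <= b -> (forall x, continuous f x) -> (forall x, continuous g x) ->
  (forall x, a <= x <= b -> Rabs (f x - g x - A) <= M) ->
  Rabs (RInt f a b - RInt g a b - (b - a) * A) <= (b - a) * M.
Proof.
  intros Hab Hf Hg H.
  apply (norm_RInt_le_const (V := R_NormedModule) (fun x => f x - g x - A) a b);
    [assumption|exact H|].
  apply (is_RInt_minus (V := R_NormedModule) (fun x => f x - g x) (fun _ => A) a b
           (RInt f a b - RInt g a b) ((b - a) * A)).
  - apply (is_RInt_minus (V := R_NormedModule) f g);
      apply (RInt_correct (V := R_CompleteNormedModule)); apply continuous_ex_RInt; assumption.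
  - apply (is_RInt_const (V := R_NormedModule)).
Qed.

Lemma differentiable_pt_lim_bound f x y lx ly : differentiable_pt_lim f x y lx ly ->
  forall eps, 0 < eps -> exists d, 0 < d /\
    forall u v, Rabs (u - x) < d -> Rabs (v - y) < d ->
      Rabs (f u v - f x y - (lx * (u - x) + ly * (v - y))) <= eps * Rmax (Rabs (u - x)) (Rabs (v - y)).
Proof.
  intros H eps He. destruct (H (mkposreal eps He)) as [d Hd].
  exists d. split; [apply cond_pos|exact Hd].
Qed.

(** Comparing both ends of the segment with the linear approximation at [(x, y)], the [ly] term and
    the value [f x y] cancel; each end contributes an error of at most [eps r]. *)
Lemma differentiable_pt_lim_segment_l f x y lx ly eps d :
  (forall u v, Rabs (u - x) < d -> Rabs (v - y) < d ->
    Rabs (f u v - f x y - (lx * (u - x) + ly * (v - y))) <= eps * Rmax (Rabs (u - x)) (Rabs (v - y))) ->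
  0 < eps -> forall p q v r, p <= x <= q -> q - p <= r -> Rabs (v - y) <= r -> r < d ->
  Rabs (f q v - f p v - lx * (q - p)) <= 2 * eps * r.
Proof.
  intros H He p q v r Hx Hqp Hv Hr.
  assert (H1 : Rabs (q - x) <= r) by (apply Rabs_le; lra).
  assert (H2 : Rabs (p - x) <= r) by (apply Rabs_le; lra).
  assert (E1 := H q v ltac:(lra) ltac:(lra)). assert (E2 := H p v ltac:(lra) ltac:(lra)).
  assert (M1 : Rmax (Rabs (q - x)) (Rabs (v - y)) <= r) by (apply Rmax_lub; assumption).
  assert (M2 : Rmax (Rabs (p - x)) (Rabs (v - y)) <= r) by (apply Rmax_lub; assumption).
  apply Rabs_le. apply Rabs_le_between in E1. apply Rabs_le_between in E2. nra.
Qed.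

Lemma differentiable_pt_lim_swap f x y lx ly :
  differentiable_pt_lim f x y lx ly -> differentiable_pt_lim (fun u v => f v u) y x ly lx.
Proof.
  intros H eps. destruct (H eps) as [d Hd]. exists d. intros u v Hu Hv.
  rewrite Rmax_comm, (Rplus_comm (ly * _)). apply Hd; assumption.
Qed.

(** This is the vanishing of the imaginary part of the contour integral of [P + iQ]. It uses the
    single Cauchy-Riemann equation expressed by the shared [A]. The partial derivatives are not
    assumed continuous, hence bisection instead of Green's formula. *)
Lemma goursat_rectangle (P Q : R -> R -> R) (p q r s : R) :
  p < q -> r < s -> continuous_2d P -> continuous_2d Q ->
  (forall x y, p <= x <= q -> r <= y <= s -> exists A B C,
     differentiable_pt_lim P x y A B /\ differentiable_pt_lim Q x y C A) ->
  RInt (P q) r s - RInt (P p) r s =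
  RInt (fun u => Q u s) p q - RInt (fun u => Q u r) p q.
Proof.
  intros Hpq Hrs HP HQ HCR.
  set (h := q - p). set (k := s - r).
  set (J := fun x y t => RInt (P (x + t * h)) y (y + t * k) - RInt (P x) y (y + t * k) -
     (RInt (fun u => Q u (y + t * k)) x (x + t * h) - RInt (fun u => Q u y) x (x + t * h))).
  assert (HJ : J p r 1 = 0).
  { apply (bisection_2d J h k); try (unfold h, k; lra).
    - intros x y t Ht.
      assert (E : J x y t = J x y (t / 2) + J (x + t / 2 * h) y (t / 2) +
        J x (y + t / 2 * k) (t / 2) + J (x + t / 2 * h) (y + t / 2 * k) (t / 2)).
      { unfold J.
        replace (x + t / 2 * h + t / 2 * h) with (x + t * h) by field.
        replace (y + t / 2 * k + t / 2 * k) with (y + t * k) by field.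
        assert (CP : forall a, RInt (P a) y (y + t * k) =
            RInt (P a) y (y + t / 2 * k) + RInt (P a) (y + t / 2 * k) (y + t * k)).
        { intro a. symmetry.
          apply (RInt_Chasles (V := R_CompleteNormedModule));
            apply continuous_ex_RInt, continuous_2d_l, HP. }
        assert (CQ : forall a, RInt (fun u => Q u a) x (x + t * h) =
            RInt (fun u => Q u a) x (x + t / 2 * h) +
            RInt (fun u => Q u a) (x + t / 2 * h) (x + t * h)).
        { intro a. symmetry.
          apply (RInt_Chasles (V := R_CompleteNormedModule));
            apply continuous_ex_RInt; intro; apply (continuous_2d_r Q), HQ. }
        rewrite !CP, !CQ. lra. }
      rewrite E. do 2 (eapply Rle_trans; [apply Rabs_triang|apply Rplus_le_compat_r]).
      apply Rabs_triang.
    - intros x y Hx Hy eps Heps.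
      destruct (HCR x y ltac:(unfold h in *; lra) ltac:(unfold k in *; lra)) as (A & B & C & DP & DQ).
      set (L := h + k). assert (HL : 0 < L) by (unfold L, h, k; lra).
      (* Each of the two differences of side integrals is [A] times the area, up to the length of a
         side times [2 e (t L)]. The main terms cancel because both contain the same [A], and the
         errors add up to [2 e (t L)^2 = eps t^2]. *)
      set (e := eps / (2 * L ^ 2)).
      assert (He : 0 < e) by (unfold e; apply Rdiv_lt_0_compat; nra).
      apply differentiable_pt_lim_swap in DQ.
      destruct (differentiable_pt_lim_bound _ _ _ _ _ DP e He) as [d1 [Hd1 B1]].
      destruct (differentiable_pt_lim_bound _ _ _ _ _ DQ e He) as [d2 [Hd2 B2]].
      exists (Rmin d1 d2 / L). split.
      { apply Rdiv_lt_0_compat; [apply Rmin_glb_lt|]; assumption. }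
      intros x' y' t [Ht Htd] Hx' Hy'.
      assert (HtL : t * L < Rmin d1 d2).
      { apply (Rmult_lt_compat_r L) in Htd; [|assumption].
        replace (Rmin d1 d2 / L * L) with (Rmin d1 d2) in Htd by (field; lra). assumption. }
      assert (T1 := Rmin_l d1 d2). assert (T2 := Rmin_r d1 d2).
      assert (Hth : 0 < t * h) by (unfold h; nra).
      assert (Htk : 0 < t * k) by (unfold k; nra).
      assert (HLe : t * L = t * h + t * k) by (unfold L; ring).
      assert (I1 : Rabs (RInt (P (x' + t * h)) y' (y' + t * k) - RInt (P x') y' (y' + t * k)
                    - (y' + t * k - y') * (A * (t * h))) <= (y' + t * k - y') * (2 * e * (t * L))).
      { apply RInt_minus_const_bound; try lra; try (apply continuous_2d_l, HP).
        intros v Hv.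
        replace (A * (t * h)) with (A * (x' + t * h - x')) by ring.
        apply (differentiable_pt_lim_segment_l _ _ _ _ _ _ _ B1 He); try lra.
        apply Rabs_le; lra. }
      assert (I2 : Rabs (RInt (fun u => Q u (y' + t * k)) x' (x' + t * h)
                      - RInt (fun u => Q u y') x' (x' + t * h)
                    - (x' + t * h - x') * (A * (t * k))) <= (x' + t * h - x') * (2 * e * (t * L))).
      { apply RInt_minus_const_bound; try lra; try (intro; apply (continuous_2d_r Q), HQ).
        intros v Hv.
        replace (A * (t * k)) with (A * (y' + t * k - y')) by ring.
        apply (differentiable_pt_lim_segment_l _ _ _ _ _ _ _ B2 He); try lra.
        apply Rabs_le; lra. }
      unfold J.
      apply Rle_trans with ((t * L) * (2 * e * (t * L))).
      2:{ right. unfold e. field. lra. }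
      apply Rabs_le. apply Rabs_le_between in I1. apply Rabs_le_between in I2.
      assert (T3 : (y' + t * k - y') * (2 * e * (t * L)) + (x' + t * h - x') * (2 * e * (t * L))
                  = t * L * (2 * e * (t * L))) by (unfold L; ring).
      split; nra. }
  unfold J in HJ.
  replace (p + 1 * h) with q in HJ by (unfold h; ring).
  replace (r + 1 * k) with s in HJ by (unfold k; ring). lra.
Qed.

(** * Complex limits, continuity and derivatives *)

Definition clim (u : nat -> C) (l : C) : Prop :=
  forall eps, 0 < eps -> exists N, forall n, (N <= n)%nat -> Cmod (u n - l)%C < eps.

Lemma Cmod_le_sum (z : C) : Cmod z <= Rabs (fst z) + Rabs (snd z).
Proof.
  apply Rsqr_incr_0_var; [|generalize (Rabs_pos (fst z)) (Rabs_pos (snd z)); lra].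
  unfold Cmod. rewrite Rsqr_sqrt by nra. unfold Rsqr.
  rewrite <- (pow2_abs (fst z)), <- (pow2_abs (snd z)).
  generalize (Rabs_pos (fst z)) (Rabs_pos (snd z)); nra.
Qed.

Lemma Rabs_fst_le_Cmod (z : C) : Rabs (fst z) <= Cmod z.
Proof. eapply Rle_trans; [apply Rmax_l|apply Rmax_Cmod]. Qed.

Lemma Rabs_snd_le_Cmod (z : C) : Rabs (snd z) <= Cmod z.
Proof. eapply Rle_trans; [apply Rmax_r|apply Rmax_Cmod]. Qed.

Lemma is_lim_seq_eps (u : nat -> R) (l : R) :
  is_lim_seq u l <->
  forall eps, 0 < eps -> exists N, forall n, (N <= n)%nat -> Rabs (u n - l) < eps.
Proof.
  rewrite <- is_lim_seq_spec. split.
  - intros H eps He. exact (H (mkposreal eps He)).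
  - intros H eps. exact (H eps (cond_pos eps)).
Qed.

Lemma clim_components u l :
  clim u l <-> is_lim_seq (fun n => fst (u n)) (fst l) /\ is_lim_seq (fun n => snd (u n)) (snd l).
Proof.
  rewrite !is_lim_seq_eps. split.
  - intro H; split; intros eps He; destruct (H eps He) as [N HN]; exists N; intros n Hn;
      (eapply Rle_lt_trans; [|exact (HN n Hn)]).
    + exact (Rabs_fst_le_Cmod (u n - l)%C).
    + exact (Rabs_snd_le_Cmod (u n - l)%C).
  - intros [H1 H2] eps He.
    destruct (H1 (eps / 2)) as [N1 HN1]; [lra|]. destruct (H2 (eps / 2)) as [N2 HN2]; [lra|].
    exists (N1 + N2)%nat. intros n Hn.
    eapply Rle_lt_trans; [apply Cmod_le_sum|].
    specialize (HN1 n ltac:(lia)). specialize (HN2 n ltac:(lia)).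
    change (Rabs (fst (u n) - fst l) + Rabs (snd (u n) - snd l) < eps). lra.
Qed.

Lemma clim_const l : clim (fun _ => l) l.
Proof.
  intros eps He; exists O; intros. replace (l - l)%C with (RtoC 0) by ring. rewrite Cmod_0; lra.
Qed.

Lemma clim_plus u v l m : clim u l -> clim v m -> clim (fun n => u n + v n)%C (l + m)%C.
Proof.
  rewrite !clim_components. intros [H1 H2] [H3 H4].
  split; apply is_lim_seq_plus'; assumption.
Qed.

Lemma clim_opp u l : clim u l -> clim (fun n => - u n)%C (- l)%C.
Proof.
  rewrite !clim_components. intros [H1 H2].
  split; [apply (is_lim_seq_opp _ (fst l))|apply (is_lim_seq_opp _ (snd l))]; assumption.
Qed.

Lemma clim_minus u v l m : clim u l -> clim v m -> clim (fun n => u n - v n)%C (l - m)%C.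
Proof. intros; apply clim_plus; [|apply clim_opp]; assumption. Qed.

Lemma clim_mult u v l m : clim u l -> clim v m -> clim (fun n => u n * v n)%C (l * m)%C.
Proof.
  rewrite !clim_components. intros [H1 H2] [H3 H4].
  split; [apply is_lim_seq_minus'|apply is_lim_seq_plus']; apply is_lim_seq_mult'; assumption.
Qed.

Lemma Cnorm2_neq_0 (l : C) : l <> RtoC 0 -> fst l ^ 2 + snd l ^ 2 <> 0.
Proof.
  intros H E. apply H. apply injective_projections; simpl; nra.
Qed.

Lemma clim_inv u l : l <> RtoC 0 -> clim u l -> clim (fun n => / u n)%C (/ l)%C.
Proof.
  intro Hl. rewrite !clim_components. intros [H1 H2].
  apply Cnorm2_neq_0 in Hl.
  assert (D : is_lim_seq (fun n => fst (u n) ^ 2 + snd (u n) ^ 2) (fst l ^ 2 + snd l ^ 2)).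
  { apply is_lim_seq_plus'; simpl; repeat apply is_lim_seq_mult'; try assumption;
      apply is_lim_seq_const. }
  split; apply is_lim_seq_div'; try assumption.
  apply (is_lim_seq_opp _ (snd l)); assumption.
Qed.

Lemma clim_unique u l m : clim u l -> clim u m -> l = m.
Proof.
  rewrite !clim_components. intros [H1 H2] [H3 H4].
  apply is_lim_seq_unique in H1, H2, H3, H4. apply injective_projections; congruence.
Qed.

Lemma clim_ext_loc u v l : (exists N, forall n, (N <= n)%nat -> u n = v n) -> clim u l -> clim v l.
Proof.
  intros [N HN] H eps He. destruct (H eps He) as [M HM]. exists (N + M)%nat.
  intros n Hn. rewrite <- HN by lia. apply HM; lia.
Qed.

Lemma clim_near (u : nat -> C) (z : C) (d : R) : 0 < d -> clim u z ->
  exists N, forall n, (N <= n)%nat -> Cmod (u n - z)%C < d.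
Proof. intros Hd H. exact (H d Hd). Qed.

(** The sequential form matches [cs_lim] and [rs_lim], so limits on the sphere and on the surface
    translate directly. *)
Definition ccont (f : C -> C) (z : C) : Prop :=
  forall u, clim u z -> clim (fun n => f (u n)) (f z).

Lemma is_lim_seq_inv_INR : is_lim_seq (fun n => / (INR n + 1)) 0.
Proof.
  apply (is_lim_seq_ext (fun n => / INR (S n))).
  { intro n. rewrite S_INR. reflexivity. }
  apply (is_lim_seq_incr_1 (fun n => / INR n)).
  replace (Finite 0) with (Rbar_inv p_infty) by reflexivity.
  apply is_lim_seq_inv; [apply is_lim_seq_INR|discriminate].
Qed.

(** If every ball around [z] contained a failure, choosing one in each ball of radius [1/(n+1)]
    would give a sequence contradicting the hypothesis. *)
Lemma seq_characterization (P : R -> C -> Prop) (z : C) :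
  (forall u, clim u z -> forall eps, 0 < eps -> exists n, P eps (u n)) ->
  forall eps, 0 < eps -> exists d, 0 < d /\ forall u, Cmod (u - z)%C < d -> P eps u.
Proof.
  intros H eps He. apply NNPP. intro Hn.
  assert (Hu : forall n : nat, exists u, Cmod (u - z)%C < / (INR n + 1) /\ ~ P eps u).
  { intro n. apply NNPP. intro Hc. apply Hn. exists (/ (INR n + 1)). split.
    - apply Rinv_0_lt_compat. generalize (pos_INR n); lra.
    - intros u Hu. apply NNPP. intro. apply Hc. exists u; tauto. }
  apply choice in Hu. destruct Hu as [u Hu].
  destruct (H u) with (eps := eps) as [n Hn']; [|assumption|exact (proj2 (Hu n) Hn')].
  intros e Hee.
  destruct (proj1 (is_lim_seq_eps _ 0) is_lim_seq_inv_INR e Hee) as [N HN].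
  exists N. intros n Hn'. specialize (HN n Hn').
  apply Rabs_def2 in HN. destruct (Hu n) as [H1 _]. lra.
Qed.

Lemma ccont_eps f z :
  ccont f z <-> forall eps, 0 < eps -> exists d, 0 < d /\
    forall u, Cmod (u - z)%C < d -> Cmod (f u - f z)%C < eps.
Proof.
  split.
  - intro H. apply (seq_characterization (fun eps u => Cmod (f u - f z)%C < eps)).
    intros u Hu eps He. destruct (H u Hu eps He) as [N HN]. exists N. apply HN; lia.
  - intros H u Hu eps He. destruct (H eps He) as [d [Hd H']].
    destruct (Hu d Hd) as [N HN]. exists N. intros n Hn. apply H', HN, Hn.
Qed.

Lemma ccont_ext_loc f g z d : 0 < d -> (forall u, Cmod (u - z)%C < d -> f u = g u) ->
  ccont f z -> ccont g z.
Proof.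
  intros Hd E H u Hu. rewrite <- (E z).
  2:{ replace (z - z)%C with (RtoC 0) by ring. rewrite Cmod_0; lra. }
  apply (clim_ext_loc (fun n => f (u n))); [|apply H, Hu].
  destruct (clim_near u z d Hd Hu) as [N HN]. exists N. intros n Hn. apply E, HN, Hn.
Qed.

Lemma ccont_ext f g z : (forall u, f u = g u) -> ccont f z -> ccont g z.
Proof. intros E. apply (ccont_ext_loc f g z 1 Rlt_0_1). auto. Qed.

Lemma ccont_const k z : ccont (fun _ => k) z.
Proof. intros u _. apply clim_const. Qed.

Lemma ccont_id z : ccont (fun u => u) z.
Proof. intros u H. exact H. Qed.

Lemma ccont_plus f g z : ccont f z -> ccont g z -> ccont (fun u => f u + g u)%C z.
Proof. intros Hf Hg u Hu. apply clim_plus; auto. Qed.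

Lemma ccont_minus f g z : ccont f z -> ccont g z -> ccont (fun u => f u - g u)%C z.
Proof. intros Hf Hg u Hu. apply clim_minus; auto. Qed.

Lemma ccont_mult f g z : ccont f z -> ccont g z -> ccont (fun u => f u * g u)%C z.
Proof. intros Hf Hg u Hu. apply clim_mult; auto. Qed.

Lemma ccont_inv f z : f z <> RtoC 0 -> ccont f z -> ccont (fun u => / f u)%C z.
Proof. intros H Hf u Hu. apply clim_inv; auto. Qed.

Lemma ccont_comp f g z : ccont g z -> ccont f (g z) -> ccont (fun u => f (g u)) z.
Proof. intros Hg Hf u Hu. apply (Hf (fun n => g (u n))). apply Hg, Hu. Qed.

Lemma ccont_neq f z w : ccont f z -> f z <> w ->
  exists d, 0 < d /\ forall u, Cmod (u - z)%C < d -> f u <> w.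
Proof.
  intros Hf Hne.
  assert (Hp : 0 < Cmod (f z - w)%C).
  { apply Cmod_gt_0. intro E. apply Hne.
    replace (f z) with (f z - w + w)%C by ring. rewrite E. ring. }
  destruct (proj1 (ccont_eps f z) Hf _ Hp) as [d [Hd H]].
  exists d. split; [assumption|]. intros u Hu E. specialize (H u Hu). rewrite E in H.
  rewrite <- Cmod_opp in H. replace (- (w - f z))%C with (f z - w)%C in H by ring. lra.
Qed.

(* Caratheodory's form of the complex derivative, for which the rules of calculus reduce to continuity. *)
Definition cder (f : C -> C) (z l : C) : Prop :=
  exists phi, ccont phi z /\ phi z = l /\ forall u, f u = (f z + phi u * (u - z))%C.

Lemma Cinv_neq_0 (z : C) : z <> RtoC 0 -> (/ z)%C <> RtoC 0.
Proof.
  intros H E. apply C1_nz. rewrite <- (Cinv_r z H), E. ring.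
Qed.

Lemma cder_eps f z l :
  cder f z l <-> forall eps, 0 < eps -> exists d, 0 < d /\
    forall u, Cmod (u - z)%C < d -> Cmod (f u - f z - (u - z) * l)%C <= eps * Cmod (u - z)%C.
Proof.
  split.
  - intros [phi [Hc [Hl E]]] eps He.
    destruct (proj1 (ccont_eps phi z) Hc eps He) as [d [Hd H]].
    exists d. split; [assumption|]. intros u Hu. rewrite (E u), <- Hl.
    replace (f z + phi u * (u - z) - f z - (u - z) * phi z)%C with ((phi u - phi z) * (u - z))%C by ring.
    rewrite Cmod_mult. apply Rmult_le_compat_r; [apply Cmod_ge_0|]. left; apply H, Hu.
  - intro H.
    (* The slope function is the difference quotient, completed by [l] at [z]. *)
    exists (fun u => if excluded_middle_informative (u = z) then l else ((f u - f z) / (u - z))%C).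
    split; [|split].
    + apply ccont_eps. intros eps He. destruct (H (eps / 2)) as [d [Hd Hd']]; [lra|].
      exists d. split; [assumption|]. intros u Hu.
      destruct (excluded_middle_informative (z = z)) as [_|]; [|congruence].
      destruct (excluded_middle_informative (u = z)) as [E|E].
      { replace (l - l)%C with (RtoC 0) by ring. rewrite Cmod_0; lra. }
      assert (Hne := Cminus_eq_contra u z E).
      replace ((f u - f z) / (u - z) - l)%C with ((f u - f z - (u - z) * l) / (u - z))%C
        by (field; assumption).
      rewrite Cmod_div by assumption.
      assert (Hp : 0 < Cmod (u - z)%C) by (apply Cmod_gt_0; assumption).
      apply Rle_lt_trans with (eps / 2); [|lra].
      apply (Rmult_le_reg_r (Cmod (u - z)%C)); [assumption|].
      unfold Rdiv at 1. rewrite Rmult_assoc, Rinv_l, Rmult_1_r by lra. apply Hd', Hu.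
    + destruct (excluded_middle_informative (z = z)); congruence.
    + intro u. destruct (excluded_middle_informative (u = z)) as [E|E].
      { rewrite E. ring. }
      field. apply Cminus_eq_contra, E.
Qed.

Lemma ex_derive_cder (f : C -> C) z :
  @ex_derive C_AbsRing C_NormedModule f z <-> exists l, cder f z l.
Proof.
  split.
  - intros [l [_ H]]. exists l. apply cder_eps. intros eps He.
    specialize (H z (fun P HP => HP) (mkposreal eps He)).
    destruct H as [d Hd]. exists d. split; [apply cond_pos|].
    intros u Hu. exact (Hd u Hu).
  - intros [l H]. exists l. split.
    { apply (is_linear_scal_l (K := C_AbsRing) (V := C_NormedModule)). }
    intros x Hx eps.
    assert (E : x = z).
    { symmetry. apply (is_filter_lim_locally_unique (K := C_AbsRing) (V := AbsRing_NormedModule C_AbsRing)).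
      exact Hx. }
    rewrite E. destruct (proj1 (cder_eps f z l) H eps (cond_pos eps)) as [d [Hd Hd']].
    exists (mkposreal d Hd). intros u Hu. exact (Hd' u Hu).
Qed.

Lemma cder_ccont f z l : cder f z l -> ccont f z.
Proof.
  intros [phi [Hc [_ E]]]. apply (ccont_ext (fun u => f z + phi u * (u - z))%C).
  { intro u. symmetry. apply E. }
  apply ccont_plus; [apply ccont_const|]. apply ccont_mult; [exact Hc|].
  apply ccont_minus; [apply ccont_id|apply ccont_const].
Qed.

Lemma cder_ext_loc f g z l d : 0 < d -> (forall u, Cmod (u - z)%C < d -> f u = g u) ->
  cder f z l -> cder g z l.
Proof.
  intros Hd E. rewrite !cder_eps. intros H eps He. destruct (H eps He) as [d' [Hd' H']].
  exists (Rmin d d'). split; [apply Rmin_glb_lt; assumption|]. intros u Hu.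
  rewrite <- !E.
  - apply H'. eapply Rlt_le_trans; [exact Hu|apply Rmin_r].
  - replace (z - z)%C with (RtoC 0) by ring. rewrite Cmod_0; lra.
  - eapply Rlt_le_trans; [exact Hu|apply Rmin_l].
Qed.

Lemma cder_const k z : cder (fun _ => k) z (RtoC 0).
Proof.
  exists (fun _ => RtoC 0). split; [apply ccont_const|split; [reflexivity|]]. intro; ring.
Qed.

Lemma cder_id z : cder (fun u => u) z (RtoC 1).
Proof.
  exists (fun _ => RtoC 1). split; [apply ccont_const|split; [reflexivity|]]. intro; ring.
Qed.

Lemma cder_plus f g z l m : cder f z l -> cder g z m -> cder (fun u => f u + g u)%C z (l + m)%C.
Proof.
  intros [p [H1 [H2 H3]]] [q [H4 [H5 H6]]]. exists (fun u => p u + q u)%C.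
  split; [apply ccont_plus; assumption|split; [congruence|]].
  intro u. rewrite (H3 u), (H6 u). ring.
Qed.

Lemma cder_mult f g z l m : cder f z l -> cder g z m ->
  cder (fun u => f u * g u)%C z (l * g z + f z * m)%C.
Proof.
  intros Hf Hg. assert (Cg := cder_ccont _ _ _ Hg).
  destruct Hf as [p [H1 [H2 H3]]], Hg as [q [H4 [H5 H6]]].
  exists (fun u => p u * g u + f z * q u)%C.
  split; [|split; [congruence|]].
  - apply ccont_plus; apply ccont_mult; try assumption. apply ccont_const.
  - intro u. rewrite (H3 u), (H6 u). ring.
Qed.

Lemma cder_minus f g z l m : cder f z l -> cder g z m -> cder (fun u => f u - g u)%C z (l - m)%C.
Proof.
  intros [p [H1 [H2 H3]]] [q [H4 [H5 H6]]]. exists (fun u => p u - q u)%C.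
  split; [apply ccont_minus; assumption|split; [congruence|]].
  intro u. rewrite (H3 u), (H6 u). ring.
Qed.

Lemma cder_inv f z l : f z <> RtoC 0 -> cder f z l -> cder (fun u => / f u)%C z (- l / (f z * f z))%C.
Proof.
  intros Hz Hf. assert (Cf := cder_ccont _ _ _ Hf).
  destruct (ccont_neq f z _ Cf Hz) as [d [Hd Hne]].
  destruct Hf as [p [H1 [H2 H3]]].
  (* The identity in [cder] is required for all [u], but [f] may vanish away from [z]. There the
     reciprocal is first replaced by an expression for which the identity holds by construction. *)
  apply (cder_ext_loc (fun u => if excluded_middle_informative (f u = RtoC 0)
     then / f z + - p u / (f z * f z) * (u - z) else / f u)%C _ _ _ d Hd).
  { intros u Hu. destruct (excluded_middle_informative (f u = RtoC 0)) as [E|]; [|reflexivity].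
    destruct (Hne u Hu E). }
  exists (fun u => if excluded_middle_informative (f u = RtoC 0) then - p u / (f z * f z)
                   else - p u / (f u * f z))%C.
  split; [|split].
  - apply (ccont_ext_loc (fun u => - p u / (f u * f z))%C _ z d Hd).
    { intros u Hu. destruct (excluded_middle_informative (f u = RtoC 0)) as [E|]; [|reflexivity].
      destruct (Hne u Hu E). }
    apply ccont_mult.
    + apply (ccont_ext (fun u => RtoC 0 - p u)%C); [intro; ring|].
      apply ccont_minus; [apply ccont_const|assumption].
    + apply ccont_inv; [apply Cmult_neq_0; assumption|].
      apply ccont_mult; [assumption|apply ccont_const].
  - destruct (excluded_middle_informative (f z = RtoC 0)); [contradiction|]. rewrite H2. reflexivity.
  - intro u. destruct (excluded_middle_informative (f z = RtoC 0)); [contradiction|].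
    destruct (excluded_middle_informative (f u = RtoC 0)) as [E|E]; [reflexivity|].
    replace (/ f z + - p u / (f u * f z) * (u - z))%C
      with ((f u - p u * (u - z)) / (f u * f z))%C by (field; split; assumption).
    replace (f u - p u * (u - z))%C with (f z) by (rewrite (H3 u); ring).
    field; split; assumption.
Qed.

(** No injectivity is required: for a continuous local right inverse [phi], the slope function of
    [phi] is the reciprocal of the slope function of [G] composed with [phi]. *)
Lemma cder_inverse (G phi : C -> C) x l d : 0 < d ->
  (forall u, Cmod (u - x)%C < d -> G (phi u) = u) -> ccont phi x ->
  cder G (phi x) l -> l <> RtoC 0 -> cder phi x (/ l)%C.
Proof.
  intros Hd HG Hphi [p [H1 [H2 H3]]] Hl.
  assert (Cp : ccont (fun u => p (phi u)) x) by (apply ccont_comp; assumption).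
  destruct (ccont_neq _ x (RtoC 0) Cp ltac:(simpl; congruence)) as [e [He Hne]].
  assert (Ex : G (phi x) = x).
  { apply HG. replace (x - x)%C with (RtoC 0) by ring. rewrite Cmod_0; lra. }
  assert (Cq : ccont (fun u => / p (phi u))%C x) by (apply ccont_inv; [congruence|assumption]).
  apply cder_eps. intros eps Heps.
  destruct (proj1 (ccont_eps _ x) Cq eps Heps) as [e' [He' Hq]].
  exists (Rmin d (Rmin e e')). split; [repeat apply Rmin_glb_lt; assumption|].
  intros u Hu.
  assert (A1 := Rmin_l d (Rmin e e')). assert (A2 := Rmin_r d (Rmin e e')).
  assert (A3 := Rmin_l e e'). assert (A4 := Rmin_r e e').
  assert (E := H3 (phi u)). rewrite HG, Ex in E by lra.
  specialize (Hne u ltac:(lra)). specialize (Hq u ltac:(lra)). simpl in Hq.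
  replace (phi u - phi x - (u - x) * / l)%C with ((/ p (phi u) - / p (phi x)) * (u - x))%C.
  - rewrite Cmod_mult. apply Rmult_le_compat_r; [apply Cmod_ge_0|]. lra.
  - rewrite H2.
    assert (E2 : (phi u - phi x)%C = (/ p (phi u) * (u - x))%C).
    { assert (E3 : (u - x)%C = (p (phi u) * (phi u - phi x))%C).
      { rewrite E at 1. ring. }
      rewrite E3. field. assumption. }
    rewrite E2. ring.
Qed.

(** * The mean value property and Liouville's theorem *)

Lemma cder_CR f x y l : cder f (x, y) l ->
  differentiable_pt_lim (fun u v => fst (f (u, v))) x y (fst l) (- snd l) /\
  differentiable_pt_lim (fun u v => snd (f (u, v))) x y (snd l) (fst l).
Proof.
  intro H.
  assert (K : forall eps : posreal, exists d : posreal, forall u v,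
     Rabs (u - x) < d -> Rabs (v - y) < d ->
     Cmod (f (u, v) - f (x, y) - ((u, v) - (x, y)) * l)%C <=
       eps * Rmax (Rabs (u - x)) (Rabs (v - y))).
  { intro eps. assert (He := cond_pos eps).
    destruct (proj1 (cder_eps f (x, y) l) H (eps / 2)) as [d [Hd H']]; [lra|].
    exists (mkposreal (d / 2) ltac:(lra)). simpl. intros u v Hu Hv.
    assert (B := Cmod_le_sum ((u, v) - (x, y))%C).
    change (Cmod ((u, v) - (x, y))%C <= Rabs (u - x) + Rabs (v - y)) in B.
    assert (M1 := Rmax_l (Rabs (u - x)) (Rabs (v - y))).
    assert (M2 := Rmax_r (Rabs (u - x)) (Rabs (v - y))).
    eapply Rle_trans; [apply H'; lra|]. nra. }
  split; intro eps; destruct (K eps) as [d Hd]; exists d; intros u v Hu Hv;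
    (eapply Rle_trans; [|exact (Hd u v Hu Hv)]).
  - eapply Rle_trans; [|apply Rabs_fst_le_Cmod]. right. f_equal.
    simpl. unfold Rminus. ring.
  - eapply Rle_trans; [|apply Rabs_snd_le_Cmod]. right. f_equal.
    simpl. unfold Rminus. ring.
Qed.

Lemma differentiable_pt_lim_mul x y : differentiable_pt_lim Rmult x y y x.
Proof.
  intro eps. exists eps. intros u v Hu Hv.
  replace (u * v - x * y - (y * (u - x) + x * (v - y))) with ((u - x) * (v - y)) by ring.
  rewrite Rabs_mult. assert (M := Rmax_r (Rabs (u - x)) (Rabs (v - y))).
  generalize (Rabs_pos (u - x)) (Rabs_pos (v - y)). nra.
Qed.

Lemma differentiable_pt_lim_separated (f g : R -> R) x y l m :
  derivable_pt_lim f x l -> derivable_pt_lim g y m ->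
  differentiable_pt_lim (fun u v => f u * g v) x y (l * g y) (f x * m).
Proof.
  intros Hf Hg.
  replace (l * g y) with (g y * l + f x * 0) by ring.
  replace (f x * m) with (g y * 0 + f x * m) by ring.
  apply (differentiable_pt_lim_comp Rmult (fun u _ => f u) (fun _ v => g v)).
  - apply differentiable_pt_lim_mul.
  - apply differentiable_pt_lim_proj1_0, Hf.
  - apply (differentiable_pt_lim_swap (fun v _ => g v)), differentiable_pt_lim_proj1_0, Hg.
Qed.

(** This is [exp(u + iv)]. With the logarithm of the radius as coordinate the change of variables is
    conformal, so the Cauchy-Riemann equations keep their form; circles become vertical segments and
    rays become horizontal lines. *)
Definition polar (u v : R) : C := (exp u * cos v, exp u * sin v).

Lemma Cmod_polar u v : Cmod (polar u v) = exp u.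
Proof.
  unfold Cmod, polar; simpl fst; simpl snd.
  replace ((exp u * cos v) ^ 2 + (exp u * sin v) ^ 2) with (exp u * exp u).
  - apply sqrt_square. left; apply exp_pos.
  - assert (H := sin2_cos2 v). unfold Rsqr in H.
    replace ((exp u * cos v) ^ 2 + (exp u * sin v) ^ 2)
      with (exp u * exp u * (sin v * sin v + cos v * cos v)) by ring.
    rewrite H; ring.
Qed.

Lemma polar_CR f u v l : cder f (polar u v) l -> exists A B C,
  differentiable_pt_lim (fun u v => fst (f (polar u v))) u v A B /\
  differentiable_pt_lim (fun u v => snd (f (polar u v))) u v C A.
Proof.
  intro H. apply cder_CR in H. destruct H as [H1 H2].
  assert (D1 : differentiable_pt_lim (fun u v => exp u * cos v) u v (exp u * cos v) (exp u * - sin v)).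
  { apply differentiable_pt_lim_separated; [apply derivable_pt_lim_exp|apply derivable_pt_lim_cos]. }
  assert (D2 : differentiable_pt_lim (fun u v => exp u * sin v) u v (exp u * sin v) (exp u * cos v)).
  { apply differentiable_pt_lim_separated; [apply derivable_pt_lim_exp|apply derivable_pt_lim_sin]. }
  assert (E1 := differentiable_pt_lim_comp _ _ _ _ _ _ _ _ _ _ _ H1 D1 D2).
  assert (E2 := differentiable_pt_lim_comp _ _ _ _ _ _ _ _ _ _ _ H2 D1 D2).
  exists (fst l * (exp u * cos v) + - snd l * (exp u * sin v)). eexists. eexists. split.
  - exact E1.
  - replace (fst l * (exp u * cos v) + - snd l * (exp u * sin v))
      with (snd l * (exp u * - sin v) + fst l * (exp u * cos v)) by ring. exact E2.
Qed.

Lemma polar_continuous_2d f : (forall z, ccont f z) ->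
  continuous_2d (fun u v => fst (f (polar u v))) /\ continuous_2d (fun u v => snd (f (polar u v))).
Proof.
  intro H.
  assert (K : forall x y (eps : posreal),
     locally_2d (fun u v => Cmod (f (polar u v) - f (polar x y))%C < eps) x y).
  { intros x y eps.
    destruct (proj1 (ccont_eps f (polar x y)) (H _) eps (cond_pos eps)) as [d [Hd H']].
    assert (C1 : continuity_2d_pt (fun u v => exp u * cos v) x y).
    { apply continuity_2d_pt_mult; apply continuity_1d_2d_pt_comp.
      - apply derivable_continuous, derivable_exp.
      - apply continuity_2d_pt_id1.
      - apply continuity_cos.
      - apply continuity_2d_pt_id2. }
    assert (C2 : continuity_2d_pt (fun u v => exp u * sin v) x y).
    { apply continuity_2d_pt_mult; apply continuity_1d_2d_pt_comp.
      - apply derivable_continuous, derivable_exp.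
      - apply continuity_2d_pt_id1.
      - apply continuity_sin.
      - apply continuity_2d_pt_id2. }
    set (d2 := mkposreal (d / 2) ltac:(lra)).
    apply (locally_2d_impl _ _ _ _) with (2 := locally_2d_and _ _ _ _ (C1 d2) (C2 d2)).
    apply locally_2d_forall. intros u v [A1 A2]. apply H'.
    eapply Rle_lt_trans; [apply Cmod_le_sum|]. simpl in A1, A2 |- *. unfold Rminus in *. lra. }
  split; intros x y eps; (apply (locally_2d_impl _ _ _ _) with (2 := K x y eps));
    apply locally_2d_forall; intros u v A; (eapply Rle_lt_trans; [|exact A]).
  - exact (Rabs_fst_le_Cmod (f (polar u v) - f (polar x y))%C).
  - exact (Rabs_snd_le_Cmod (f (polar u v) - f (polar x y))%C).
Qed.

Lemma RInt_const_bound (f : R -> R) a b A M :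
  a <= b -> (forall x, continuous f x) -> (forall x, a <= x <= b -> Rabs (f x - A) <= M) ->
  Rabs (RInt f a b - (b - a) * A) <= (b - a) * M.
Proof.
  intros Hab Hf H.
  apply (norm_RInt_le_const (V := R_NormedModule) (fun x => f x - A) a b); [assumption|exact H|].
  apply (is_RInt_minus (V := R_NormedModule) f (fun _ => A)).
  - apply (RInt_correct (V := R_CompleteNormedModule)), continuous_ex_RInt, Hf.
  - apply (is_RInt_const (V := R_NormedModule)).
Qed.

Lemma RInt_param_continuous (Q : R -> R -> R) p q c : p <= q -> continuous_2d Q ->
  continuous (fun v => RInt (fun u => Q u v) p q) c.
Proof.
  intros Hpq HQ. apply filterlim_locally. intro eps. assert (He := cond_pos eps).
  set (e := eps / (q - p + 1)).
  assert (Hd : 0 < e) by (apply Rdiv_lt_0_compat; lra).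
  destruct (uniform_continuity_2d_1d Q p q c (fun x _ => HQ x c) (mkposreal e Hd)) as [d H].
  exists d. intros v Hv. change (Rabs (v - c) < d) in Hv. apply Rabs_def2 in Hv.
  assert (Hdp := cond_pos d).
  assert (B : Rabs (RInt (fun u => Q u v) p q - RInt (fun u => Q u c) p q - (q - p) * 0) <= (q - p) * e).
  { apply RInt_minus_const_bound; [assumption|intro; apply continuous_2d_r, HQ|intro; apply continuous_2d_r, HQ|].
    intros x Hx. rewrite Rminus_0_r. left. apply H; try lra.
    rewrite Rminus_diag, Rabs_R0. assumption. }
  rewrite Rmult_0_r, Rminus_0_r in B.
  change (Rabs (RInt (fun u => Q u v) p q - RInt (fun u => Q u c) p q) < eps).
  eapply Rle_lt_trans; [exact B|].
  assert (E : eps = (q - p + 1) * e :> R) by (unfold e; field; lra). rewrite E. nra.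
Qed.

Lemma constant_inside_constant (F : R -> R) a b : a < b -> (forall x, continuous F x) ->
  (forall r s, a < r -> r < s -> s < b -> F r = F s) -> F a = F b.
Proof.
  intros Hab Hc H. apply NNPP. intro Hne.
  assert (Hp : 0 < Rabs (F a - F b)) by (apply Rabs_pos_lt; lra).
  assert (He : 0 < Rabs (F a - F b) / 3) by lra.
  destruct (proj1 (filterlim_locally _ _) (Hc a) (mkposreal _ He)) as [d1 H1].
  destruct (proj1 (filterlim_locally _ _) (Hc b) (mkposreal _ He)) as [d2 H2].
  assert (P1 := cond_pos d1). assert (P2 := cond_pos d2).
  set (t := Rmin (Rmin (d1 / 2) (d2 / 2)) ((b - a) / 3)).
  assert (T0 : 0 < t) by (repeat apply Rmin_glb_lt; lra).
  assert (T1 : t <= (b - a) / 3) by apply Rmin_r.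
  assert (T2 : t <= d1 / 2) by (eapply Rle_trans; [apply Rmin_l|apply Rmin_l]).
  assert (T3 : t <= d2 / 2) by (eapply Rle_trans; [apply Rmin_l|apply Rmin_r]).
  specialize (H1 (a + t)). specialize (H2 (b - t)).
  assert (E := H (a + t) (b - t) ltac:(lra) ltac:(lra) ltac:(lra)).
  change (Rabs (a + t - a) < d1 -> Rabs (F (a + t) - F a) < Rabs (F a - F b) / 3) in H1.
  change (Rabs (b - t - b) < d2 -> Rabs (F (b - t) - F b) < Rabs (F a - F b) / 3) in H2.
  specialize (H1 ltac:(apply Rabs_def1; lra)). specialize (H2 ltac:(apply Rabs_def1; lra)).
  rewrite E in H1. apply Rabs_def2 in H1. apply Rabs_def2 in H2.
  destruct (Rcase_abs (F a - F b)); [rewrite Rabs_left in *|rewrite Rabs_right in *]; lra.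
Qed.

(** The sides [y = a] and [y = b] will lie on the axes, where only continuity is known. Goursat's
    theorem makes the defect constant for inner sides, and continuity carries this to the
    boundary. *)
Lemma goursat_strip (P Q : R -> R -> R) (p q a b : R) :
  p < q -> a < b -> continuous_2d P -> continuous_2d Q ->
  (forall x y, a < y < b -> exists A B C,
     differentiable_pt_lim P x y A B /\ differentiable_pt_lim Q x y C A) ->
  RInt (P q) a b - RInt (P p) a b = RInt (fun u => Q u b) p q - RInt (fun u => Q u a) p q.
Proof.
  intros Hpq Hab HP HQ H.
  set (F := fun v => (RInt (P q) a v - RInt (P p) a v) - RInt (fun u => Q u v) p q).
  assert (E : F a = F b).
  { apply constant_inside_constant; [assumption| |].
    - intro x. unfold F.
      assert (K : forall c, continuous (fun v => RInt (P c) a v) x).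
      { intro c. apply (continuous_RInt_1 (V := R_CompleteNormedModule) (P c) a x (fun z => RInt (P c) a z)).
        exists (mkposreal 1 Rlt_0_1). intros z _.
        apply (RInt_correct (V := R_CompleteNormedModule)), continuous_ex_RInt, continuous_2d_l, HP. }
      apply (continuous_minus (V := R_NormedModule)); [apply (continuous_minus (V := R_NormedModule)); apply K|].
      apply RInt_param_continuous; [lra|assumption].
    - intros r s Hr Hrs Hs. unfold F.
      assert (G := goursat_rectangle P Q p q r s Hpq Hrs HP HQ
                 ltac:(intros; apply H; lra)).
      assert (CP : forall c, RInt (P c) a s = RInt (P c) a r + RInt (P c) r s).
      { intro c. symmetry. apply (RInt_Chasles (V := R_CompleteNormedModule));
          apply continuous_ex_RInt, continuous_2d_l, HP. }
      rewrite !CP. lra. }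
  unfold F in E. rewrite !RInt_point in E. change (@zero R_CompleteNormedModule) with 0 in E. lra.
Qed.

(** The real axis is the original defect. The imaginary axis is given up as well because it contains
    the point [iy] at which the slope function of [f] is only known to be continuous. *)
Definition off_axes_holomorphic (f : C -> C) : Prop :=
  (forall z, ccont f z) /\ forall z, fst z <> 0 -> snd z <> 0 -> exists l, cder f z l.

Lemma circle_mean_constant f p q : off_axes_holomorphic f -> p < q ->
  RInt (fun v => fst (f (polar q v))) 0 (2 * PI) = RInt (fun v => fst (f (polar p v))) 0 (2 * PI).
Proof.
  intros [Hc Hd] Hpq. destruct (polar_continuous_2d f Hc) as [HP HQ].
  set (P := fun u v => fst (f (polar u v))) in *. set (Q := fun u v => snd (f (polar u v))) in *.
  assert (S : forall a b, a < b -> (forall v, a < v < b -> cos v <> 0 /\ sin v <> 0) ->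
    RInt (P q) a b - RInt (P p) a b = RInt (fun u => Q u b) p q - RInt (fun u => Q u a) p q).
  { intros a b Hab Hv. apply goursat_strip; try assumption.
    intros x y Hy. destruct (Hv y Hy) as [H1 H2]. assert (He := exp_pos x).
    destruct (Hd (polar x y)) as [l Hl]; [simpl; nra|simpl; nra|].
    apply (polar_CR f x y l Hl). }
  assert (HPI := PI_RGT_0).
  (* One strip for each open quadrant. Summed up, the contributions of the inner rays telescope, and
     the rays at the angles [0] and [2 PI] coincide. *)
  assert (S1 := S 0 (PI / 2) ltac:(lra)). assert (S2 := S (PI / 2) PI ltac:(lra)).
  assert (S3 := S PI (3 * (PI / 2)) ltac:(lra)). assert (S4 := S (3 * (PI / 2)) (2 * PI) ltac:(lra)).
  specialize (S1 ltac:(intros v Hv; split; apply Rgt_not_eq; [apply cos_gt_0|apply sin_gt_0]; lra)).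
  specialize (S2 ltac:(intros v Hv; split; [apply Rlt_not_eq, cos_lt_0|apply Rgt_not_eq, sin_gt_0]; lra)).
  specialize (S3 ltac:(intros v Hv; split; apply Rlt_not_eq; [apply cos_lt_0|apply sin_lt_0]; lra)).
  assert (S4' : forall v, 3 * (PI / 2) < v < 2 * PI -> cos v <> 0 /\ sin v <> 0).
  { intros v Hv; split; [apply Rgt_not_eq|apply Rlt_not_eq, sin_lt_0; lra].
    replace v with (v - 2 * PI + 2 * INR 1 * PI) by (simpl; ring). rewrite cos_period.
    apply cos_gt_0; lra. }
  specialize (S4 S4').
  assert (CP : forall c x y z, RInt (P c) x z = RInt (P c) x y + RInt (P c) y z).
  { intros. symmetry. apply (RInt_Chasles (V := R_CompleteNormedModule));
      apply continuous_ex_RInt, continuous_2d_l, HP. }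
  rewrite (CP q 0 (PI / 2)), (CP q (PI / 2) PI), (CP q PI (3 * (PI / 2))).
  rewrite (CP p 0 (PI / 2)), (CP p (PI / 2) PI), (CP p PI (3 * (PI / 2))).
  assert (E : RInt (fun u => Q u (2 * PI)) p q = RInt (fun u => Q u 0) p q).
  { apply RInt_ext. intros x _. unfold Q, polar. rewrite cos_2PI, sin_2PI, cos_0, sin_0. reflexivity. }
  lra.
Qed.

Lemma mean_value f q : off_axes_holomorphic f ->
  RInt (fun v => fst (f (polar q v))) 0 (2 * PI) = 2 * PI * fst (f (RtoC 0)).
Proof.
  intro Hf. assert (HPI := PI_RGT_0). destruct (polar_continuous_2d f (proj1 Hf)) as [HP _].
  assert (K : forall eps, 0 < eps ->
    Rabs (RInt (fun v => fst (f (polar q v))) 0 (2 * PI) - 2 * PI * fst (f (RtoC 0))) <= 2 * PI * eps).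
  { intros eps He.
    destruct (proj1 (ccont_eps f (RtoC 0)) (proj1 Hf _) eps He) as [d [Hd H]].
    (* The circle of radius [exp p] lies inside the original one and inside the disc of radius [d]
       in which [f] is close to its value at the centre. *)
    set (p := Rmin (q - 1) (ln d - 1)).
    assert (Hp1 : p <= q - 1) by apply Rmin_l. assert (Hp2 : p <= ln d - 1) by apply Rmin_r.
    rewrite (circle_mean_constant f p q Hf ltac:(lra)).
    replace (2 * PI) with (2 * PI - 0) at 2 3 by ring.
    apply (RInt_const_bound (fun v => fst (f (polar p v)))); [lra|apply (continuous_2d_l _ p HP)|].
    intros v _. left. eapply Rle_lt_trans; [|apply (H (polar p v))].
    - exact (Rabs_fst_le_Cmod (f (polar p v) - f (RtoC 0))%C).
    - replace (polar p v - RtoC 0)%C with (polar p v) by ring. rewrite Cmod_polar.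
      rewrite <- (exp_ln d Hd). apply exp_increasing. lra. }
  apply NNPP. intro Hne.
  set (x := Rabs (RInt (fun v => fst (f (polar q v))) 0 (2 * PI) - 2 * PI * fst (f (RtoC 0)))) in *.
  assert (Hx : 0 < x) by (apply Rabs_pos_lt; lra).
  specialize (K (x / (4 * PI)) ltac:(apply Rdiv_lt_0_compat; lra)).
  replace (2 * PI * (x / (4 * PI))) with (x / 2) in K by (field; lra). lra.
Qed.

Definition off_line_holomorphic (f : C -> C) : Prop :=
  (forall z, ccont f z) /\ forall z, snd z <> 0 -> exists l, cder f z l.

(** The factor [u] makes [q] vanish at the centre, so its circle means are zero, whereas
    [g = f - f z1] has mean [f(0) - f z1]. On a circle of radius [rho] the functions [g] and [q]
    differ by [z1] times the slope function of [f], which is [O(1/rho)] because [f] is bounded. *)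
Lemma off_line_axis_fst f M y : off_line_holomorphic f -> (forall z, Cmod (f z) <= M) -> y <> 0 ->
  fst (f (0, y)) = fst (f (RtoC 0)).
Proof.
  intros [Hc Hd] HM Hy. assert (HPI := PI_RGT_0). set (z1 := (0, y) : C).
  destruct (Hd z1 Hy) as [l [phi [P1 [P2 P3]]]].
  assert (Hphi : forall u, u <> z1 -> phi u = ((f u - f z1) / (u - z1))%C).
  { intros u Hu. rewrite (P3 u). field. apply Cminus_eq_contra, Hu. }
  assert (Hloc : forall u, u <> z1 -> exists d, 0 < d /\
     forall w, Cmod (w - u)%C < d -> ((f w - f z1) / (w - z1))%C = phi w).
  { intros u Hu. destruct (ccont_neq (fun w => w) u z1 (ccont_id u) Hu) as [d [Hd1 Hd2]].
    exists d. split; [assumption|]. intros w Hw. symmetry. apply Hphi, Hd2, Hw. }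
  set (q := fun u => (u * phi u)%C).
  assert (Hq : off_axes_holomorphic q).
  { split.
    - intro u. apply ccont_mult; [apply ccont_id|].
      destruct (classic (u = z1)) as [->|Hu]; [assumption|].
      destruct (Hloc u Hu) as [d [Hd1 Hd2]]. apply (ccont_ext_loc _ _ u d Hd1 Hd2).
      apply ccont_mult; [|apply ccont_inv; [apply Cminus_eq_contra, Hu|]];
        apply ccont_minus; auto using ccont_id, ccont_const.
    - intros u Hu1 Hu2.
      assert (Hu : u <> z1) by (intros ->; apply Hu1; reflexivity).
      destruct (Hd u Hu2) as [m Hm].
      destruct (Hloc u Hu) as [d [Hd1 Hd2]].
      eexists. apply cder_mult; [apply cder_id|].
      apply (cder_ext_loc _ _ u _ d Hd1 Hd2).
      apply cder_mult; [apply cder_minus; [exact Hm|apply cder_const]|].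
      apply cder_inv; [apply Cminus_eq_contra, Hu|].
      apply cder_minus; [apply cder_id|apply cder_const]. }
  set (g := fun u => (f u - f z1)%C).
  assert (Hg : off_axes_holomorphic g).
  { split.
    - intro u. apply ccont_minus; auto using ccont_const.
    - intros u _ Hu. destruct (Hd u Hu) as [m Hm]. eexists.
      apply cder_minus; [exact Hm|apply cder_const]. }
  set (X := Rabs (fst (f (RtoC 0)) - fst (f z1))).
  assert (HM0 : 0 <= M) by (eapply Rle_trans; [apply Cmod_ge_0|apply (HM z1)]).
  assert (Hz1 : Cmod z1 = Rabs y).
  { unfold Cmod, z1; simpl fst; simpl snd. rewrite <- sqrt_Rsqr_abs. f_equal. unfold Rsqr; ring. }
  (* The comparison of the two means with denominators cleared; the left side is unbounded in [rho]
     unless [X] is zero. *)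
  assert (K : forall rho, Rabs y < rho -> X * (rho - Rabs y) <= 2 * M * Rabs y).
  { intros rho Hrho. assert (Hr : 0 < rho) by (generalize (Rabs_pos y); lra).
    assert (B : Rabs (RInt (fun v => fst (g (polar (ln rho) v))) 0 (2 * PI) -
                      RInt (fun v => fst (q (polar (ln rho) v))) 0 (2 * PI) - (2 * PI - 0) * 0) <=
               (2 * PI - 0) * (2 * M * Rabs y / (rho - Rabs y))).
    { apply RInt_minus_const_bound; [lra| | |].
      - apply (continuous_2d_l _ (ln rho) (proj1 (polar_continuous_2d g (proj1 Hg)))).
      - apply (continuous_2d_l _ (ln rho) (proj1 (polar_continuous_2d q (proj1 Hq)))).
      - intros v _. rewrite Rminus_0_r. set (w := polar (ln rho) v).
        assert (Hw : Cmod w = rho) by (unfold w; rewrite Cmod_polar, exp_ln; auto).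
        assert (Hwz : rho - Rabs y <= Cmod (w - z1)%C).
        { rewrite <- Hw, <- Hz1.
          assert (T := Cmod_triangle (w - z1)%C z1).
          replace (w - z1 + z1)%C with w in T by ring. lra. }
        eapply Rle_trans; [exact (Rabs_fst_le_Cmod (g w - q w)%C)|].
        unfold g, q. rewrite (P3 w).
        replace (f z1 + phi w * (w - z1) - f z1 - w * phi w)%C with (- (phi w * z1))%C by ring.
        rewrite Cmod_opp, Cmod_mult, Hz1.
        assert (Hne : w <> z1).
        { intro E. rewrite E in Hwz. replace (z1 - z1)%C with (RtoC 0) in Hwz by ring.
          rewrite Cmod_0 in Hwz. lra. }
        rewrite (Hphi w Hne), Cmod_div by (apply Cminus_eq_contra, Hne).
        unfold Rdiv. rewrite Rmult_assoc, (Rmult_comm (/ _)), <- Rmult_assoc.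
        assert (T : Cmod (f w - f z1)%C <= 2 * M).
        { unfold Cminus. eapply Rle_trans; [apply Cmod_triangle|]. rewrite Cmod_opp.
          generalize (HM w) (HM z1); lra. }
        apply Rmult_le_compat.
        + apply Rmult_le_pos; [apply Cmod_ge_0|apply Rabs_pos].
        + left. apply Rinv_0_lt_compat. lra.
        + apply Rmult_le_compat_r; [apply Rabs_pos|exact T].
        + apply Rinv_le_contravar; lra. }
    rewrite (mean_value g _ Hg), (mean_value q _ Hq) in B.
    assert (E1 : fst (q (RtoC 0)) = 0).
    { unfold q. replace (RtoC 0 * phi (RtoC 0))%C with (RtoC 0) by ring. reflexivity. }
    assert (E2 : fst (g (RtoC 0)) = fst (f (RtoC 0)) - fst (f z1)) by reflexivity.
    rewrite E1, E2, !Rmult_0_r, !Rminus_0_r, Rabs_mult, (Rabs_pos_eq (2 * PI)) in B by lra.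
    fold X in B. apply Rmult_le_reg_l in B; [|lra].
    apply (Rmult_le_compat_r (rho - Rabs y)) in B; [|lra].
    replace (2 * M * Rabs y / (rho - Rabs y) * (rho - Rabs y)) with (2 * M * Rabs y) in B by (field; lra).
    exact B. }
  apply NNPP. intro Hne.
  assert (HX : 0 < X) by (apply Rabs_pos_lt; lra).
  assert (Hp : 0 < (2 * M * Rabs y + 1) / X).
  { apply Rdiv_lt_0_compat; [|assumption]. generalize (Rabs_pos y); nra. }
  (* This radius makes the left side of [K] equal to [2 M |y| + 1], just above its bound. *)
  specialize (K (Rabs y + (2 * M * Rabs y + 1) / X) ltac:(lra)).
  replace (X * (Rabs y + (2 * M * Rabs y + 1) / X - Rabs y)) with (2 * M * Rabs y + 1) in K by (field; lra).
  lra.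
Qed.

Lemma off_line_vertical f M x y : off_line_holomorphic f -> (forall z, Cmod (f z) <= M) ->
  f (x, y) = f (x, 0).
Proof.
  intros [Hc Hd] HM. destruct (Req_dec y 0) as [->|Hy]; [reflexivity|].
  (* The mean value argument sees only real parts. The multipliers [1] and [-i] recover both
     coordinates, and a real translation keeps the exceptional line in place. *)
  assert (K : forall k : C, fst (k * f (x, y))%C = fst (k * f (x, 0))%C).
  { intro k. set (g := fun u => (k * f (u + RtoC x))%C).
    assert (Sc : forall z, ccont (fun u => u + RtoC x)%C z).
    { intro z. apply ccont_plus; [apply ccont_id|apply ccont_const]. }
    assert (Hg : off_line_holomorphic g).
    { split.
      - intro z. apply ccont_mult; [apply ccont_const|].
        apply (ccont_comp f (fun u => u + RtoC x)%C); [apply Sc|apply Hc].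
      - intros z Hz. destruct (Hd (z + RtoC x)%C) as [l [p [P1 [P2 P3]]]].
        { simpl. lra. }
        eexists. apply cder_mult; [apply cder_const|].
        exists (fun u => p (u + RtoC x)%C). split; [|split; [reflexivity|]].
        + apply (ccont_comp p (fun u => u + RtoC x)%C); [apply Sc|exact P1].
        + intro u. rewrite (P3 (u + RtoC x)%C) at 1. ring. }
    assert (E := off_line_axis_fst g (Cmod k * M) y Hg).
    unfold g in E.
    replace ((0, y) + RtoC x)%C with ((x, y) : C) in E
      by (apply injective_projections; simpl; ring).
    replace (RtoC 0 + RtoC x)%C with ((x, 0) : C) in E
      by (apply injective_projections; simpl; ring).
    apply E; [|assumption]. intro z. rewrite Cmod_mult.
    apply Rmult_le_compat_l; [apply Cmod_ge_0|apply HM]. }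
  assert (K1 := K (RtoC 1)). assert (K2 := K (0, -1)). simpl in K1, K2.
  apply injective_projections; lra.
Qed.

(** The line [y = 1] lies in the region of holomorphy. There the vertical derivatives vanish since
    [f] is constant on vertical lines, and the Cauchy-Riemann equations make the horizontal ones
    vanish too. *)
Theorem liouville_off_line f M : off_line_holomorphic f -> (forall z, Cmod (f z) <= M) ->
  forall z w, f z = f w.
Proof.
  intros Hf HM.
  assert (Hv : forall x y, f (x, y) = f (x, 0)) by (intros; apply (off_line_vertical f M); assumption).
  assert (H0 : forall x, f (x, 1) = f (x, 0)) by (intro; apply Hv).
  assert (D : forall x, is_derive (fun t => fst (f (t, 1))) x 0 /\ is_derive (fun t => snd (f (t, 1))) x 0).
  { intro x. destruct Hf as [_ Hd]. destruct (Hd (x, 1)) as [l Hl]; [simpl; lra|].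
    apply cder_CR in Hl. destruct Hl as [D1 D2].
    destruct (differentiable_pt_lim_unique _ _ _ _ _ D1) as [_ U1].
    destruct (differentiable_pt_lim_unique _ _ _ _ _ D2) as [_ U2].
    assert (Z1 : snd l = 0).
    { rewrite (Derive_ext _ (fun _ => fst (f (x, 0)))), Derive_const in U1; [lra|].
      intro t. rewrite Hv. reflexivity. }
    assert (Z2 : fst l = 0).
    { rewrite (Derive_ext _ (fun _ => snd (f (x, 0)))), Derive_const in U2; [lra|].
      intro t. rewrite Hv. reflexivity. }
    rewrite Z1, Z2, Ropp_0 in D1. rewrite Z1, Z2 in D2.
    split; apply is_derive_Reals.
    - apply (differentiable_pt_lim_proj1_1 (fun t => fst (f (t, 1))) x 1).
      apply (differentiable_pt_lim_ext _ _ _ _ _ _ (locally_2d_forall _ _ _ (fun u v => f_equal fst (eq_trans (Hv u v) (eq_sym (H0 u))))) D1).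
    - apply (differentiable_pt_lim_proj1_1 (fun t => snd (f (t, 1))) x 1).
      apply (differentiable_pt_lim_ext _ _ _ _ _ _ (locally_2d_forall _ _ _ (fun u v => f_equal snd (eq_trans (Hv u v) (eq_sym (H0 u))))) D2). }
  assert (H1 : forall x y, x < y -> f (x, 1) = f (y, 1)).
  { intros x y Hxy. apply injective_projections.
    - apply (eq_is_derive (V := R_NormedModule) (fun t => fst (f (t, 1))) x y); [|assumption].
      intros t _. apply D.
    - apply (eq_is_derive (V := R_NormedModule) (fun t => snd (f (t, 1))) x y); [|assumption].
      intros t _. apply D. }
  assert (H2 : forall x y, f (x, 1) = f (y, 1)).
  { intros x y. destruct (Rtotal_order x y) as [H|[->|H]]; [|reflexivity|symmetry]; apply H1, H. }
  intros [x y] [x' y']. rewrite (Hv x y), (Hv x' y'), <- !H0. apply H2.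
Qed.

(** * The fibres of the map H *)

Lemma polar_mult u v u' v' : (polar u v * polar u' v')%C = polar (u + u') (v + v').
Proof.
  unfold polar. rewrite exp_plus, cos_plus, sin_plus. apply injective_projections; simpl; ring.
Qed.

Lemma polar_exists z : z <> RtoC 0 -> exists u v, z = polar u v.
Proof.
  intro Hz. assert (Hr : 0 < Cmod z) by (apply Cmod_gt_0; assumption).
  exists (ln (Cmod z)). unfold polar. rewrite exp_ln by assumption.
  set (r := Cmod z) in *. set (x := fst z / r).
  assert (E : fst z ^ 2 + snd z ^ 2 = r * r).
  { unfold r, Cmod. rewrite sqrt_sqrt; [reflexivity|nra]. }
  assert (Ex : fst z = r * x) by (unfold x; field; lra).
  assert (Ey : (snd z / r) ^ 2 = 1 - x ^ 2).
  { unfold x. field_simplify; [|lra|lra]. f_equal. nra. }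
  assert (Hx : -1 <= x <= 1) by (split; nra).
  assert (Es : (sin (acos x)) ^ 2 = (snd z / r) ^ 2).
  { rewrite Ey. assert (T := sin2_cos2 (acos x)). rewrite cos_acos in T by assumption.
    unfold Rsqr in T. nra. }
  assert (Hs : sin (acos x) = snd z / r \/ sin (acos x) = - (snd z / r)).
  { destruct (Req_dec (sin (acos x)) (snd z / r)); [left; assumption|right; nra]. }
  destruct Hs as [Hs|Hs].
  - exists (acos x). rewrite Hs, cos_acos by assumption.
    apply injective_projections; simpl; [assumption|field; lra].
  - exists (- acos x). rewrite cos_neg, sin_neg, Hs, cos_acos by assumption.
    apply injective_projections; simpl; [assumption|field; lra].
Qed.

Lemma Csqrt_exists z : exists w, (w * w)%C = z.
Proof.
  destruct (classic (z = RtoC 0)) as [->|Hz]; [exists (RtoC 0); ring|].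
  destruct (polar_exists z Hz) as [u [v ->]]. exists (polar (u / 2) (v / 2)).
  rewrite polar_mult. f_equal; field.
Qed.

Lemma Ccbrt_exists z : exists w, (w * w * w)%C = z.
Proof.
  destruct (classic (z = RtoC 0)) as [->|Hz]; [exists (RtoC 0); ring|].
  destruct (polar_exists z Hz) as [u [v ->]]. exists (polar (u / 3) (v / 3)).
  rewrite !polar_mult. f_equal; field.
Qed.

Lemma RtoC_neq_0 x : x <> 0 -> RtoC x <> RtoC 0.
Proof. intros H E. apply H. injection E. auto. Qed.

(** Cardano's formula. The numbers [-Q/2 + d] and [-Q/2 - d] have product [-P^3/27], so for nonzero
    [P] the cube root [r] of the first one cannot vanish. *)
Lemma depressed_cubic_root (P Q : C) : exists v, (v * v * v + P * v + Q)%C = RtoC 0.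
Proof.
  destruct (classic (P = RtoC 0)) as [->|HP].
  { destruct (Ccbrt_exists (- Q)%C) as [w Hw]. exists w. rewrite Hw. ring. }
  destruct (Csqrt_exists (Q * Q / RtoC 4 + P * P * P / RtoC 27)%C) as [d Hd].
  destruct (Ccbrt_exists (- Q / RtoC 2 + d)%C) as [r Hr].
  assert (K : (RtoC 27 * (r * r * r) * (- Q / RtoC 2 - d) = - (P * P * P))%C).
  { rewrite Hr. replace (RtoC 27 * (- Q / RtoC 2 + d) * (- Q / RtoC 2 - d))%C
      with (RtoC 27 * (Q * Q / RtoC 4 - d * d))%C by field.
    rewrite Hd. field. }
  assert (Nr : r <> RtoC 0).
  { intro E. apply (Cmult_neq_0 _ _ (Cmult_neq_0 _ _ HP HP) HP).
    replace (P * P * P)%C with (- - (P * P * P))%C by ring. rewrite <- K, E. ring. }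
  exists (r - P / (RtoC 3 * r))%C.
  replace ((r - P / (RtoC 3 * r)) * (r - P / (RtoC 3 * r)) * (r - P / (RtoC 3 * r)) +
     P * (r - P / (RtoC 3 * r)) + Q)%C
    with (r * r * r + - (P * P * P) / (RtoC 27 * (r * r * r)) + Q)%C by (field; assumption).
  rewrite <- K.
  replace (RtoC 27 * (r * r * r) * (- Q / RtoC 2 - d) / (RtoC 27 * (r * r * r)))%C
    with (- Q / RtoC 2 - d)%C by (field; assumption).
  rewrite Hr. field.
Qed.

(** One root comes from Cardano's formula after the shift by [e1/3]. The other two have sum [e1 - z]
    and product [e2 - z (e1 - z)], a quadratic solved by its discriminant. *)
Lemma cubic_roots (e1 e2 e3 : C) : exists z u t,
  (z + u + t)%C = e1 /\ (z * u + z * t + u * t)%C = e2 /\ (z * u * t)%C = e3.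
Proof.
  destruct (depressed_cubic_root (e2 - e1 * e1 / RtoC 3)%C
     (- RtoC 2 * (e1 * e1 * e1) / RtoC 27 + e1 * e2 / RtoC 3 - e3)%C) as [v Hv].
  set (z := (v + e1 / RtoC 3)%C).
  assert (Hz : (z * z * z - e1 * (z * z) + e2 * z - e3)%C = RtoC 0).
  { rewrite <- Hv. unfold z. field. }
  destruct (Csqrt_exists ((e1 - z) * (e1 - z) - RtoC 4 * (e2 - z * (e1 - z)))%C) as [d Hd].
  exists z, ((e1 - z + d) / RtoC 2)%C, ((e1 - z - d) / RtoC 2)%C.
  assert (T : ((e1 - z + d) / RtoC 2 * ((e1 - z - d) / RtoC 2))%C = (e2 - z * (e1 - z))%C).
  { replace ((e1 - z + d) / RtoC 2 * ((e1 - z - d) / RtoC 2))%C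
      with (((e1 - z) * (e1 - z) - d * d) / RtoC 4)%C by field.
    rewrite Hd. field. }
  split; [|split].
  - field.
  - rewrite T. field.
  - rewrite <- Cmult_assoc, T. replace e3 with (e3 + RtoC 0)%C by ring. rewrite <- Hz. ring.
Qed.

(* [Hmap c z = z + c/2 (1/(z-1) + 1/(z+1))]; it equals the map [H] when [c = (1-a^2)^2/(1+a^2)]. *)
Definition Hmap (c : R) (z : C) : C := (z + RtoC c * z / (z * z - RtoC 1))%C.

Definition nsq (z : C) : R := fst z ^ 2 + snd z ^ 2.

(* [|z^2-1|^2 - c (|z|^2+1)]: its zero set consists of the two closed curves that [Hmap c] sends to the cuts. *)
Definition qd (c : R) (z : C) : R := (nsq z + 1) ^ 2 - 4 * fst z ^ 2 - c * (nsq z + 1).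

Definition finite_pt (z : C) : Prop := (z * z - RtoC 1)%C <> RtoC 0.

Lemma finite_pt_iff z : finite_pt z <-> z <> RtoC 1 /\ z <> RtoC (-1).
Proof.
  unfold finite_pt.
  replace (z * z - RtoC 1)%C with ((z - RtoC 1) * (z + RtoC 1))%C by ring.
  split.
  - intro H; split; intros ->; apply H; apply injective_projections; simpl; ring.
  - intros [H1 H2]. apply Cmult_neq_0; [apply Cminus_eq_contra, H1|].
    intro E. apply H2. replace z with (z + RtoC 1 - RtoC 1)%C by ring. rewrite E.
    apply injective_projections; simpl; ring.
Qed.

Lemma Hmap_spec c z w : finite_pt z ->
  (Hmap c z = w <-> (z * (z * z - RtoC 1) + RtoC c * z)%C = (w * (z * z - RtoC 1))%C).
Proof.
  intro Hz. unfold Hmap. split; intro E.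
  - rewrite <- E. field. exact Hz.
  - replace (z + RtoC c * z / (z * z - RtoC 1))%C
      with ((z * (z * z - RtoC 1) + RtoC c * z) / (z * z - RtoC 1))%C by (field; exact Hz).
    rewrite E. field. exact Hz.
Qed.

(* [z, u, t] are the roots, with multiplicity, of [Hmap c = w]. *)
Definition fibre (c : R) (w z u t : C) : Prop :=
  (z + u + t)%C = w /\ (z * u + z * t + u * t)%C = RtoC (c - 1) /\ (z * u * t)%C = (- w)%C.

Lemma fibre_perm1 c w z u t : fibre c w z u t -> fibre c w u z t.
Proof.
  intros [H1 [H2 H3]]. repeat split; [rewrite <- H1|rewrite <- H2|rewrite <- H3]; ring.
Qed.

Lemma fibre_perm2 c w z u t : fibre c w z u t -> fibre c w z t u.
Proof.
  intros [H1 [H2 H3]]. repeat split; [rewrite <- H1|rewrite <- H2|rewrite <- H3]; ring.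
Qed.

Lemma fibre_exists c w : exists z u t, fibre c w z u t.
Proof. apply cubic_roots. Qed.

(** The fibre consists of the roots of [X^3 - w X^2 + (c-1) X + w]. Its values at [1] and, in the
    next lemma, at [-1] do not depend on [w], since the poles of [Hmap c] are there. *)
Lemma fibre_prod_minus c w z u t : fibre c w z u t ->
  ((RtoC 1 - z) * (RtoC 1 - u) * (RtoC 1 - t))%C = RtoC c.
Proof.
  intros [H1 [H2 H3]].
  replace ((RtoC 1 - z) * (RtoC 1 - u) * (RtoC 1 - t))%C
    with (RtoC 1 - (z + u + t) + (z * u + z * t + u * t) - z * u * t)%C by ring.
  rewrite H1, H2, H3. apply injective_projections; simpl; ring.
Qed.

Lemma fibre_prod_plus c w z u t : fibre c w z u t ->
  ((RtoC 1 + z) * (RtoC 1 + u) * (RtoC 1 + t))%C = RtoC c.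
Proof.
  intros [H1 [H2 H3]].
  replace ((RtoC 1 + z) * (RtoC 1 + u) * (RtoC 1 + t))%C
    with (RtoC 1 + (z + u + t) + (z * u + z * t + u * t) + z * u * t)%C by ring.
  rewrite H1, H2, H3. apply injective_projections; simpl; ring.
Qed.

(** Eliminating [w] leaves a relation between one root and the product of the other two. As its
    right side is nonzero for nonzero [c], no root of a fibre can be a pole. *)
Lemma fibre_pair c w z u t : fibre c w z u t ->
  ((u * t + RtoC 1) * (z * z - RtoC 1))%C = RtoC (- c).
Proof.
  intros [H1 [H2 H3]].
  assert (E : (u * t)%C = (RtoC (c - 1) - z * w + z * z)%C).
  { rewrite <- H2, <- H1. ring. }
  replace ((u * t + RtoC 1) * (z * z - RtoC 1))%C
    with (u * t * (z * z - RtoC 1) + (z * z - RtoC 1))%C by ring.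
  replace (u * t * (z * z - RtoC 1))%C with (z * (z * u * t) - u * t)%C by ring.
  rewrite H3, E. rewrite !RtoC_minus, RtoC_opp. ring.
Qed.

Lemma fibre_finite c w z u t : c <> 0 -> fibre c w z u t -> finite_pt z.
Proof.
  intros Hc H E. apply fibre_pair in H. rewrite E in H.
  injection H. intros. lra.
Qed.

Lemma fibre_Hmap c w z u t : c <> 0 -> fibre c w z u t -> Hmap c z = w.
Proof.
  intros Hc H. apply Hmap_spec; [exact (fibre_finite c w z u t Hc H)|].
  destruct H as [H1 [H2 H3]].
  replace (z * (z * z - RtoC 1) + RtoC c * z)%C
    with (z * (z * z) + z * (RtoC c - RtoC 1))%C by ring.
  rewrite <- RtoC_minus, <- H2.
  replace (w * (z * z - RtoC 1))%C with (w * (z * z) + - w)%C by ring.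
  rewrite <- H3, <- H1. ring.
Qed.

(** Subtracting the two cubic equations and cancelling [z - u] gives the second symmetric function;
    the third one then follows from the equation for [z]. *)
Lemma Hmap_fibre c w z u : finite_pt z -> finite_pt u -> z <> u ->
  Hmap c z = w -> Hmap c u = w -> fibre c w z u (w - z - u)%C.
Proof.
  intros Fz Fu Hne Hz Hu. apply Hmap_spec in Hz, Hu; try assumption.
  assert (Hd := Cminus_eq_contra z u Hne).
  assert (E2 : ((z - u) * (z * u + z * (w - z - u) + u * (w - z - u) - RtoC (c - 1)))%C = RtoC 0).
  { rewrite RtoC_minus.
    replace ((z - u) * (z * u + z * (w - z - u) + u * (w - z - u) - (RtoC c - RtoC 1)))%C
      with ((w * (z * z - RtoC 1) - (z * (z * z - RtoC 1) + RtoC c * z)) -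
            (w * (u * u - RtoC 1) - (u * (u * u - RtoC 1) + RtoC c * u)))%C by ring.
    rewrite Hz, Hu. ring. }
  assert (K2 : (z * u + z * (w - z - u) + u * (w - z - u))%C = RtoC (c - 1)).
  { apply NNPP. intro N. apply (Cmult_neq_0 _ _ Hd (Cminus_eq_contra _ _ N)). exact E2. }
  split; [ring|split; [exact K2|]].
  replace (z * u * (w - z - u))%C
    with (z * (z * u + z * (w - z - u) + u * (w - z - u)) - z * z * (w - z))%C by ring.
  rewrite K2, RtoC_minus.
  replace (z * (RtoC c - RtoC 1) - z * z * (w - z))%C
    with (z * (z * z - RtoC 1) + RtoC c * z - w * (z * z))%C by ring.
  rewrite Hz. ring.
Qed.

(** * Injectivity on the parts over the three sheets *)

Lemma nsq_sq_minus_one (z : C) : nsq (z * z - RtoC 1)%C = (nsq z + 1) ^ 2 - 4 * fst z ^ 2.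
Proof. destruct z as [x y]. unfold nsq; simpl. ring. Qed.

Lemma nsq_pos z : z <> RtoC 0 -> 0 < nsq z.
Proof. intro H. apply Cnorm2_neq_0 in H. unfold nsq. nra. Qed.

Lemma nsq_mult z u : nsq (z * u)%C = nsq z * nsq u.
Proof. destruct z, u. unfold nsq; simpl. ring. Qed.

Lemma snd_Hmap c z : finite_pt z ->
  snd (Hmap c z) * nsq (z * z - RtoC 1)%C = snd z * qd c z.
Proof.
  intro Hz.
  assert (E : (Hmap c z * (z * z - RtoC 1) = z * (z * z - RtoC 1) + RtoC c * z)%C).
  { symmetry. apply Hmap_spec; [exact Hz|reflexivity]. }
  set (w := Hmap c z) in *. clearbody w. destruct z as [x y], w as [p q].
  unfold qd, nsq in *. apply (f_equal (fun k => (k * Cconj ((x, y) * (x, y) - RtoC 1))%C)) in E.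
  apply (f_equal snd) in E. simpl in E |- *. nra.
Qed.

(** The inequalities are not strict because part of the boundary curve belongs to sheet 1. On the
    curve a point and its conjugate do share their value, which is real; [sheet_of] separates them
    by the sign of the imaginary part. *)
Lemma sheet1_injective c z u : 0 < c -> finite_pt z -> finite_pt u ->
  0 <= qd c z -> 0 <= qd c u -> Hmap c z = Hmap c u -> z <> u ->
  u = Cconj z /\ qd c z = 0.
Proof.
  intros Hc Fz Fu Qz Qu E Hne.
  assert (F := Hmap_fibre c (Hmap c u) z u Fz Fu Hne E eq_refl).
  set (t := (Hmap c u - z - u)%C) in *. clearbody t.
  assert (F' := fibre_perm1 _ _ _ _ _ (fibre_perm2 _ _ _ _ _ F)).
  assert (P := fibre_pair _ _ _ _ _ F').
  assert (M := fibre_prod_minus _ _ _ _ _ F). assert (Pl := fibre_prod_plus _ _ _ _ _ F).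
  (* Compare moduli in [K], using [|zu+1|^2 = (|z|^2+1)(|u|^2+1) - |z - conj u|^2]. *)
  assert (K : (RtoC c * (z * u + RtoC 1) = (z * z - RtoC 1) * (u * u - RtoC 1))%C).
  { assert (K1 : ((z * z - RtoC 1) * (u * u - RtoC 1) * (t * t - RtoC 1))%C = (- RtoC c * RtoC c)%C).
    { rewrite <- M at 1. rewrite <- Pl. ring. }
    assert (Ft : finite_pt t).
    { apply (fibre_finite c (Hmap c u) t z u); [lra|exact F']. }
    assert (K2 : ((RtoC c * (z * u + RtoC 1) - (z * z - RtoC 1) * (u * u - RtoC 1)) * (t * t - RtoC 1))%C = RtoC 0).
    { replace ((RtoC c * (z * u + RtoC 1) - (z * z - RtoC 1) * (u * u - RtoC 1)) * (t * t - RtoC 1))%C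
       with (RtoC c * ((z * u + RtoC 1) * (t * t - RtoC 1)) - (z * z - RtoC 1) * (u * u - RtoC 1) * (t * t - RtoC 1))%C by ring.
      rewrite K1, P, RtoC_opp. ring. }
    apply NNPP. intro N. exact (Cmult_neq_0 _ _ (Cminus_eq_contra _ _ N) Ft K2). }
  apply (f_equal nsq) in K. rewrite !nsq_mult, !nsq_sq_minus_one in K.
  assert (I : nsq (z * u + RtoC 1)%C = (nsq z + 1) * (nsq u + 1) - nsq (z - Cconj u)%C).
  { destruct z, u. unfold nsq; simpl. ring. }
  rewrite I in K.
  assert (Ic : nsq (RtoC c) = c * c) by (unfold nsq; simpl; ring).
  rewrite Ic in K.
  assert (B0 : 0 <= nsq (z - Cconj u)%C) by (unfold nsq; nra).
  assert (Bz : 0 < nsq z + 1) by (unfold nsq; nra). assert (Bu : 0 < nsq u + 1) by (unfold nsq; nra).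
  assert (Ez : (nsq z + 1) ^ 2 - 4 * fst z ^ 2 = qd c z + c * (nsq z + 1)) by (unfold qd; ring).
  assert (Eu : (nsq u + 1) ^ 2 - 4 * fst u ^ 2 = qd c u + c * (nsq u + 1)) by (unfold qd; ring).
  rewrite Ez, Eu in K.
  assert (Q0 : 0 <= qd c z * (c * (nsq u + 1))) by (apply Rmult_le_pos; nra).
  assert (Q1 : 0 <= qd c u * (c * (nsq z + 1))) by (apply Rmult_le_pos; nra).
  assert (Q2 : 0 <= qd c z * qd c u) by (apply Rmult_le_pos; assumption).
  assert (Q3 : 0 <= c * c * nsq (z - Cconj u)%C) by (apply Rmult_le_pos; nra).
  (* After substituting [|z^2-1|^2 = qd + c (|z|^2+1)] the products of the main terms cancel,
     leaving a sum of nonnegative terms equal to zero. *)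
  assert (K' : c * c * nsq (z - Cconj u)%C + qd c z * (c * (nsq u + 1)) +
            qd c u * (c * (nsq z + 1)) + qd c z * qd c u = 0).
  { apply Rminus_diag_eq in K. rewrite <- (Ropp_involutive 0), Ropp_0, <- K. ring. }
  assert (Z1 : c * c * nsq (z - Cconj u)%C = 0) by lra.
  assert (Z2 : qd c z * (c * (nsq u + 1)) = 0) by lra.
  split.
  - assert (Z3 : nsq (z - Cconj u)%C = 0)
      by (apply (Rmult_eq_reg_l (c * c)); [rewrite Rmult_0_r; exact Z1|nra]).
    destruct z as [x y], u as [p q]. unfold nsq in Z3.
    destruct (Rplus_sqr_eq_0 (x - p) (y + q)) as [Z4 Z5].
    { rewrite <- Z3. unfold Rsqr; simpl; ring. }
    apply injective_projections; simpl; lra.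
  - apply Rmult_integral in Z2. destruct Z2 as [|Z2]; [assumption|nra].
Qed.

(** Since [|1+v|^2 = |1-v|^2 + 4 Re v], a third root with nonnegative real part would make the
    product of the three [|1+v|] larger than that of the three [|1-v|], but both equal [c]. *)
Lemma fibre_third_fst c w z u t : 0 < c -> fibre c w z u t ->
  0 < fst z -> 0 < fst u -> fst t < 0.
Proof.
  intros Hc F Hz Hu.
  assert (M := f_equal nsq (fibre_prod_minus _ _ _ _ _ F)).
  assert (P := f_equal nsq (fibre_prod_plus _ _ _ _ _ F)).
  rewrite <- M, !nsq_mult in P. rewrite !nsq_mult in M.
  assert (E : forall v : C, nsq (RtoC 1 + v)%C = nsq (RtoC 1 - v)%C + 4 * fst v).
  { intros [x y]. unfold nsq; simpl. ring. }
  rewrite !E in P.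
  assert (N : forall v : C, 0 <= nsq v) by (intros [x y]; unfold nsq; simpl; nra).
  assert (Nc : 0 < nsq (RtoC c)) by (unfold nsq; simpl; nra).
  assert (A := N (RtoC 1 - z)%C). assert (B := N (RtoC 1 - u)%C). assert (D := N (RtoC 1 - t)%C).
  set (p := nsq (RtoC 1 - z)%C) in *. set (q := nsq (RtoC 1 - u)%C) in *.
  set (r := nsq (RtoC 1 - t)%C) in *. clearbody p q r.
  apply Rnot_le_lt. intro Ht.
  assert (Pq : 0 <= p * q) by nra.
  assert (Hr : 0 < r) by (destruct D as [D|D]; [assumption|rewrite <- D in M; lra]).
  assert (S1 : p * q < (p + 4 * fst z) * (q + 4 * fst u)) by nra.
  assert (S2 : 0 <= ((p + 4 * fst z) * (q + 4 * fst u)) * (4 * fst t)) by (apply Rmult_le_pos; nra).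
  assert (S3 : p * q * r < (p + 4 * fst z) * (q + 4 * fst u) * r) by (apply Rmult_lt_compat_r; assumption).
  lra.
Qed.

Lemma fibre_pair_snd c w z u t : fibre c w z u t ->
  snd (u * t)%C * nsq (z * z - RtoC 1)%C = c * (2 * fst z * snd z).
Proof.
  intro F. apply fibre_pair in F.
  apply (f_equal (fun k => snd (k * Cconj (z * z - RtoC 1))%C)) in F.
  destruct z as [x y]. destruct (u * t)%C as [p q]. unfold nsq.
  simpl in F |- *.
  match type of F with ?l = ?r => transitivity (l); [ring|rewrite F; ring] end.
Qed.

(* By [fibre_pair_snd] the imaginary parts of the three products of two roots would have the same sign,
   but their sum [c - 1] is real. *)
Lemma no_fibre_same_side c w z u t : 0 < c -> fibre c w z u t ->
  0 < fst z -> 0 < fst u -> snd z * snd w < 0 -> snd u * snd w < 0 -> False.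
Proof.
  intros Hc F Hz Hu Sz Su.
  assert (Ht := fibre_third_fst _ _ _ _ _ Hc F Hz Hu).
  assert (F1 := fibre_perm1 _ _ _ _ _ F).
  assert (F2 := fibre_perm1 _ _ _ _ _ (fibre_perm2 _ _ _ _ _ F)).
  assert (E1 : snd w = snd z + snd u + snd t).
  { rewrite <- (proj1 F). simpl. ring. }
  assert (E2 : snd (u * t)%C + snd (z * t)%C + snd (z * u)%C = 0).
  { assert (K := f_equal snd (proj1 (proj2 F))). simpl in K |- *. lra. }
  assert (St : 0 < snd t * snd w) by nra.
  assert (Nz := nsq_pos _ (fibre_finite _ _ _ _ _ (Rgt_not_eq _ _ Hc) F)).
  assert (Nu := nsq_pos _ (fibre_finite _ _ _ _ _ (Rgt_not_eq _ _ Hc) F1)).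
  assert (Nt := nsq_pos _ (fibre_finite _ _ _ _ _ (Rgt_not_eq _ _ Hc) F2)).
  assert (K : forall s n x y : R, 0 < n -> s * n = c * (2 * x * y) -> x * (y * snd w) < 0 -> s * snd w < 0).
  { intros s n x y Hn E Hs.
    assert (s * snd w * n < 0).
    { replace (s * snd w * n) with (2 * c * (x * (y * snd w))).
      - nra.
      - transitivity (s * n * snd w); [rewrite E|]; ring. }
    apply Rnot_le_lt. intro. assert (0 <= s * snd w * n) by (apply Rmult_le_pos; lra). lra. }
  assert (K1 := K _ _ _ _ Nz (fibre_pair_snd _ _ _ _ _ F)).
  assert (K2 := K _ _ _ _ Nu (fibre_pair_snd _ _ _ _ _ F1)).
  assert (K3 := K _ _ _ _ Nt (fibre_pair_snd _ _ _ _ _ F2)).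
  assert (K1' := K1 ltac:(nra)). assert (K2' := K2 ltac:(nra)). assert (K3' := K3 ltac:(nra)).
  assert (Z : (snd (u * t)%C + snd (z * t)%C + snd (z * u)%C) * snd w = 0) by (rewrite E2; ring).
  lra.
Qed.

Lemma nsq_conj z : nsq (Cconj z) = nsq z.
Proof. destruct z; unfold nsq; simpl; ring. Qed.

Lemma finite_pt_conj z : finite_pt z -> finite_pt (Cconj z).
Proof.
  intros H E. apply H. apply (f_equal Cconj) in E.
  destruct z as [x y]. injection E. intros E1 E2. apply injective_projections; simpl in *; lra.
Qed.

Lemma Cconj_Hmap c z : finite_pt z -> Hmap c (Cconj z) = Cconj (Hmap c z).
Proof.
  intro F. apply Hmap_spec; [apply finite_pt_conj, F|].
  assert (E := proj1 (Hmap_spec c z (Hmap c z) F) eq_refl).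
  apply (f_equal Cconj) in E. set (w := Hmap c z) in *. clearbody w.
  destruct z as [x y], w as [p q]. injection E. intros E1 E2.
  apply injective_projections; simpl in *; lra.
Qed.

Lemma Hmap_opp c z : finite_pt z -> Hmap c (- z)%C = (- Hmap c z)%C.
Proof.
  intro F. unfold Hmap. replace (- z * - z)%C with (z * z)%C by ring. field. exact F.
Qed.

Lemma finite_pt_opp z : finite_pt z -> finite_pt (- z)%C.
Proof. unfold finite_pt. intro H. replace (- z * - z)%C with (z * z)%C by ring. exact H. Qed.

(** An open part over sheet 0 or 2 together with its share of the boundary: the lower arcs and the
    critical points. *)
Definition lower_sheet (c : R) (z : C) : Prop := qd c z < 0 \/ (qd c z = 0 /\ snd z <= 0).

(** The left side of the equation is positive, so [x] and [u] lie on the same side of [1]. Below [1]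
    the chain [(x^2-1)(u^2-1) <= (x^2-1)^2 <= c (x^2+1) < c (x u+1)] is absurd; above [1] the bound
    at [u] gives [(u^2-1)(x u+1) <= (x^2-1)(u^2+1)], which fails for [x < u]. *)
Lemma sheet2_real_injective c x u : 0 < c ->
  (x * x - 1) ^ 2 <= c * (x * x + 1) -> (u * u - 1) ^ 2 <= c * (u * u + 1) ->
  0 < x -> x < u -> c * (x * u + 1) = (x * x - 1) * (u * u - 1) -> False.
Proof.
  intros Hc Qx Qu Hx Hxu E.
  assert (Hp : 0 < c * (x * u + 1)) by (apply Rmult_lt_0_compat; nra).
  destruct (Rle_dec u 1) as [Hu|Hu].
  - assert (Hu1 : u < 1) by (destruct Hu as [|Hu]; [assumption|subst; nra]).
    assert (T0 : x * x < u * u) by nra. assert (T3 : u * u < 1) by nra.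
    assert (T1 : (x * x - 1) * (u * u - 1) <= (x * x - 1) ^ 2).
    { replace ((x * x - 1) ^ 2) with ((x * x - 1) * (u * u - 1) + (1 - x * x) * (u * u - x * x)) by ring.
      assert (0 <= (1 - x * x) * (u * u - x * x)) by (apply Rmult_le_pos; lra). lra. }
    assert (T2 : c * (x * x + 1) < c * (x * u + 1)) by (apply Rmult_lt_compat_l; nra). lra.
  - destruct (Rle_dec x 1) as [Hx1|Hx1].
    { assert (0 <= (1 - x * x) * (u * u - 1)) by (apply Rmult_le_pos; nra). lra. }
    assert (T0 : 0 < u * u - 1) by nra.
    assert (T1 : (u * u - 1) * ((u * u - 1) * (x * u + 1)) <= (u * u - 1) * ((x * x - 1) * (u * u + 1))).
    { replace ((u * u - 1) * ((u * u - 1) * (x * u + 1))) with ((u * u - 1) ^ 2 * (x * u + 1)) by ring.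
      replace ((u * u - 1) * ((x * x - 1) * (u * u + 1)))
        with (c * (x * u + 1) * (u * u + 1)) by (rewrite E; ring).
      replace (c * (x * u + 1) * (u * u + 1)) with (c * (u * u + 1) * (x * u + 1)) by ring.
      apply Rmult_le_compat_r; nra. }
    apply Rmult_le_reg_l in T1; [|assumption].
    assert (T2 : 0 < (u - x) * (x * (u * u))) by (repeat apply Rmult_lt_0_compat; lra).
    nra.
Qed.

Lemma sheet2_injective c z u : 0 < c -> finite_pt z -> finite_pt u ->
  lower_sheet c z -> lower_sheet c u -> 0 < fst z -> 0 < fst u ->
  Hmap c z = Hmap c u -> z = u.
Proof.
  intros Hc Fz Fu Lz Lu Hz Hu E. apply NNPP. intro Hne.
  assert (F := Hmap_fibre c (Hmap c u) z u Fz Fu Hne E eq_refl).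
  assert (Iz := snd_Hmap c z Fz). rewrite E in Iz. assert (Iu := snd_Hmap c u Fu).
  assert (Eu : exists w, Hmap c u = w) by eauto. destruct Eu as [w Eu].
  rewrite Eu in *.
  assert (Nz := nsq_pos _ Fz). assert (Nu := nsq_pos _ Fu).
  destruct (Req_dec (snd w) 0) as [Hw|Hw].
  (* For real [w] a nonreal root lies on the curve, so its conjugate is a root as well. Both have
     positive real part, hence the remaining root has negative real part, and none of the three can
     be a different point of the same part. *)
  - assert (Real : forall v v' t, finite_pt v -> v <> v' -> lower_sheet c v -> lower_sheet c v' ->
        0 < fst v -> 0 < fst v' -> fibre c w v v' t -> Hmap c v = w ->
        snd v * qd c v = 0 -> snd v' * qd c v' = 0 -> snd v = 0).
    { intros v v' t Fv Hvv Lv Lv' Pv Pv' Fb Hv Q Q'. apply NNPP. intro Hs.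
      assert (Qv : qd c v = 0) by (apply Rmult_integral in Q; tauto).
      assert (Sv : snd v < 0) by (destruct Lv as [|[_ ?]]; lra).
      assert (Hc1 : Hmap c (Cconj v) = w).
      { rewrite Cconj_Hmap, Hv by assumption. apply injective_projections; simpl; lra. }
      assert (Hvc : v <> Cconj v).
      { intro K. apply (f_equal snd) in K. simpl in K. lra. }
      assert (Fc := Hmap_fibre c w v (Cconj v) Fv (finite_pt_conj v Fv) Hvc Hv Hc1).
      (* v' is a root of the cubic with roots v, conj v and w - v - conj v, hence the last one *)
      assert (R : ((v' - v) * (v' - Cconj v) * (v' - (w - v - Cconj v)))%C = RtoC 0).
      { destruct Fb as [B1 [B2 B3]]. destruct Fc as [C1 [C2 C3]].
        replace ((v' - v) * (v' - Cconj v) * (v' - (w - v - Cconj v)))%C with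
         (v' * v' * v' - w * (v' * v') + (v * Cconj v + v * (w - v - Cconj v) + Cconj v * (w - v - Cconj v)) * v'
          - v * Cconj v * (w - v - Cconj v))%C by ring.
        rewrite C2, C3, <- B2, <- B3, <- B1. ring. }
      assert (N1 : v' <> Cconj v).
      { intro K. subst v'.
        assert (qd c (Cconj v) = 0) by (rewrite <- Qv; unfold qd; rewrite nsq_conj; reflexivity).
        destruct Lv' as [|[_ Sv']]; simpl in *; lra. }
      assert (Ev : v' = (w - v - Cconj v)%C).
      { apply NNPP. intro N. revert R.
        apply Cmult_neq_0; [apply Cmult_neq_0|]; apply Cminus_eq_contra; auto. }
      assert (T := fibre_third_fst c w v (Cconj v) _ Hc Fc Pv Pv). rewrite <- Ev in T. lra. }
    rewrite Hw, Rmult_0_l in Iz, Iu. symmetry in Iz, Iu.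
    assert (Sz := Real z u _ Fz Hne Lz Lu Hz Hu F E Iz Iu).
    assert (Su := Real u z _ Fu (not_eq_sym Hne) Lu Lz Hu Hz (fibre_perm1 _ _ _ _ _ F) Eu Iu Iz).
    assert (P := fibre_prod_minus _ _ _ _ _ F). assert (P' := fibre_prod_plus _ _ _ _ _ F).
    assert (P2 := fibre_pair _ _ _ _ _ (fibre_perm1 _ _ _ _ _ (fibre_perm2 _ _ _ _ _ F))).
    destruct z as [x y], u as [p q]. simpl in Sz, Su, Hz, Hu. subst y q.
    unfold qd, nsq in *.
    assert (Qx : (x * x - 1) ^ 2 <= c * (x * x + 1)).
    { destruct Lz as [L|[L _]]; unfold qd, nsq in L; simpl in L; nra. }
    assert (Qp : (p * p - 1) ^ 2 <= c * (p * p + 1)).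
    { destruct Lu as [L|[L _]]; unfold qd, nsq in L; simpl in L; nra. }
    (* The relation [K] of [sheet1_injective] for real roots: the product over the three roots of
       [v^2 - 1] is [-c^2], and the factor of the third root [t] cancels. *)
    assert (Er : c * (x * p + 1) = (x * x - 1) * (p * p - 1)).
    { set (t := (w - (x, 0) - (p, 0))%C) in *. clearbody t. destruct t as [t t'].
      assert (Ht' : t' = 0).
      { assert (K := f_equal snd (proj1 F)). simpl in K. lra. }
      subst t'. apply (f_equal fst) in P, P', P2. simpl in P, P', P2.
      assert (Q1 : (1 - x) * (1 - p) * (1 - t) = c) by (rewrite <- P; ring).
      assert (Q2 : (1 + x) * (1 + p) * (1 + t) = c) by (rewrite <- P'; ring).
      assert (Q3 : (x * p + 1) * (t * t - 1) = - c) by (rewrite <- P2; ring).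
      assert (Q4 : (x * x - 1) * (p * p - 1) * (t * t - 1) = - c * c).
      { rewrite <- Q1 at 1. rewrite <- Q2. ring. }
      assert (t * t - 1 <> 0) by nra.
      apply (Rmult_eq_reg_r (t * t - 1)); [|assumption]. rewrite Q4, Rmult_assoc, Q3. ring. }
    assert (Hxp : x <> p) by (intros ->; apply Hne; reflexivity).
    destruct (Rdichotomy _ _ Hxp) as [H|H].
    + exact (sheet2_real_injective c x p Hc Qx Qp Hz H Er).
    + apply (sheet2_real_injective c p x Hc Qp Qx Hu H). lra.
  (* By [snd_Hmap], where [qd] is not positive a nonreal value lies on the opposite side of the real
     line from its preimage. *)
  - assert (Side : forall v, lower_sheet c v -> 0 < nsq (v * v - RtoC 1)%C ->
        snd w * nsq (v * v - RtoC 1)%C = snd v * qd c v -> snd v * snd w < 0).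
    { intros v Lv Nv Iv.
      assert (K : snd w * snd w * nsq (v * v - RtoC 1)%C = snd v * snd w * qd c v).
      { rewrite Rmult_assoc, Iv. ring. }
      assert (0 < snd w * snd w) by nra.
      assert (K2 : 0 < snd v * snd w * qd c v) by (rewrite <- K; apply Rmult_lt_0_compat; assumption).
      destruct Lv as [L|[L _]]; [nra|rewrite L in K2; lra]. }
    apply (no_fibre_same_side c w z u _ Hc F Hz Hu); apply Side; assumption.
Qed.

Lemma qd_conj_opp c z : qd c (- Cconj z)%C = qd c z.
Proof. destruct z; unfold qd, nsq; simpl; ring. Qed.

(** Reduction by the reflection in the imaginary axis, [z] to [-Cconj z]. Unlike [z] to [-z] it
    preserves imaginary parts, hence the distribution of the boundary arcs. *)
Lemma sheet0_injective c z u : 0 < c -> finite_pt z -> finite_pt u ->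
  lower_sheet c z -> lower_sheet c u -> fst z < 0 -> fst u < 0 ->
  Hmap c z = Hmap c u -> z = u.
Proof.
  intros Hc Fz Fu Lz Lu Hz Hu E.
  assert (K : (- Cconj z)%C = (- Cconj u)%C).
  { apply (sheet2_injective c); try assumption.
    - apply finite_pt_opp, finite_pt_conj, Fz.
    - apply finite_pt_opp, finite_pt_conj, Fu.
    - unfold lower_sheet. rewrite qd_conj_opp. destruct Lz as [|[]]; [left|right]; simpl; lra.
    - unfold lower_sheet. rewrite qd_conj_opp. destruct Lu as [|[]]; [left|right]; simpl; lra.
    - simpl; lra.
    - simpl; lra.
    - rewrite !Hmap_opp, !Cconj_Hmap by (try apply finite_pt_conj; assumption). rewrite E. reflexivity. }
  destruct z, u. injection K. intros. apply injective_projections; simpl; lra.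
Qed.

(** Makes the sign of the real part a valid test for the two components of [{qd < 0}]. At the origin
    [qd] equals [1 - c]. *)
Lemma qd_pos_imaginary c z : c < 1 -> fst z = 0 -> 0 < qd c z.
Proof. destruct z as [x y]; simpl. intros Hc ->. unfold qd, nsq; simpl. nra. Qed.

(* [H] maps [{qd > 0}] to sheet 1 and the components of [{qd < 0}] to sheets 0 and 2. The curves
   [qd = 0] are distributed in accordance with the convention of [allowed]: the pair [(k, x)] with [x]
   in a cut is the limit from above inside sheet [k]. *)
Definition sheet_of (c : R) (z : C) : sheet :=
  if Rlt_dec 0 (qd c z) then S1
  else if excluded_middle_informative (qd c z = 0 /\ 0 < snd z) then S1
  else if Rlt_dec 0 (fst z) then S2 else S0.

Lemma sheet_of_S1 c z : sheet_of c z = S1 <-> 0 < qd c z \/ (qd c z = 0 /\ 0 < snd z).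
Proof.
  unfold sheet_of. destruct (Rlt_dec 0 (qd c z)); [tauto|].
  destruct (excluded_middle_informative _); [tauto|].
  destruct (Rlt_dec 0 (fst z)); split; try discriminate; tauto.
Qed.

Lemma sheet_of_S2 c z : sheet_of c z = S2 <-> lower_sheet c z /\ 0 < fst z.
Proof.
  unfold sheet_of, lower_sheet. destruct (Rlt_dec 0 (qd c z)).
  { split; [discriminate|intros [[|[]] _]; lra]. }
  destruct (excluded_middle_informative _) as [[H1 H2]|H].
  { split; [discriminate|intros [[|[]] _]; lra]. }
  destruct (Rlt_dec 0 (fst z)); split; try discriminate; try tauto.
  intros _. split; [|assumption]. destruct (Req_dec (qd c z) 0); [right|left]; [|lra].
  split; [assumption|]. apply Rnot_lt_le. tauto.
Qed.

Lemma sheet_of_S0 c z : c < 1 -> (sheet_of c z = S0 <-> lower_sheet c z /\ fst z < 0).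
Proof.
  intro Hc. unfold sheet_of, lower_sheet. destruct (Rlt_dec 0 (qd c z)).
  { split; [discriminate|intros [[|[]] _]; lra]. }
  destruct (excluded_middle_informative _) as [[H1 H2]|H].
  { split; [discriminate|intros [[|[]] _]; lra]. }
  destruct (Rlt_dec 0 (fst z)); [split; [discriminate|intros [_ ?]; lra]|].
  split; [|reflexivity]. intros _. split.
  - destruct (Req_dec (qd c z) 0); [right|left]; [|lra].
    split; [assumption|]. apply Rnot_lt_le. tauto.
  - assert (fst z <> 0) by (intro E; generalize (qd_pos_imaginary c z Hc E); lra). lra.
Qed.

Lemma sheet_of_injective c z u : 0 < c < 1 -> finite_pt z -> finite_pt u ->
  Hmap c z = Hmap c u -> sheet_of c z = sheet_of c u -> z = u.
Proof.
  intros [Hc Hc1] Fz Fu E S. destruct (sheet_of c u) eqn:Su.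
  - apply sheet_of_S0 in S; [|assumption]. apply sheet_of_S0 in Su; [|assumption].
    apply (sheet0_injective c); tauto.
  - apply sheet_of_S1 in S. apply sheet_of_S1 in Su. apply NNPP. intro Hne.
    destruct (sheet1_injective c z u Hc Fz Fu) as [K1 K2]; try assumption; try lra.
    subst u. simpl in Su.
    assert (qd c (Cconj z) = 0) by (rewrite <- K2; unfold qd; rewrite nsq_conj; reflexivity). lra.
  - apply sheet_of_S2 in S. apply sheet_of_S2 in Su.
    apply (sheet2_injective c); tauto.
Qed.

(* [a] and [b] are the positive critical points of [Hmap c], with critical values
   [2a^3/(1+a^2)] and [2b^3/(1+b^2)]. *)
Record params (lam a b c : R) : Prop := {
  par_a : 0 < a < 1;
  par_b : 1 < b;
  par_ca : (a * a - 1) ^ 2 = c * (a * a + 1);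
  par_cb : (b * b - 1) ^ 2 = c * (b * b + 1);
  par_c : 0 < c < 1;
  par_lam : 1 < lam;
  par_val : 2 * b ^ 3 / (1 + b * b) = lam * (2 * a ^ 3 / (1 + a * a)) }.

(** * Critical values and the images of the curves *)

Definition crit_val (a : R) : R := 2 * a ^ 3 / (1 + a * a).

Lemma crit_val_pos lam a b c : params lam a b c -> 0 < crit_val a.
Proof.
  intros []. unfold crit_val. apply Rdiv_lt_0_compat; [|nra].
  assert (0 < a ^ 3) by (apply pow_lt; lra). lra.
Qed.

(** Vieta for [(X-1)^2 = c (X+1)], whose roots are [a^2] and [b^2]; the next lemma gives their
    product. *)
Lemma par_sum lam a b c : params lam a b c -> a * a + b * b = 2 + c.
Proof.
  intros []. apply (Rmult_eq_reg_l (b * b - a * a)); [|nra]. nra.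
Qed.

Lemma par_prod lam a b c : params lam a b c -> (a * a) * (b * b) = 1 - c.
Proof.
  intros P. assert (S := par_sum _ _ _ _ P). destruct P.
  replace (b * b) with (2 + c - a * a) by lra. nra.
Qed.

Definition Hreal (c x : R) : R := x + c * x / (x * x - 1).

Lemma Hmap_real c x : x * x - 1 <> 0 -> Hmap c (RtoC x) = RtoC (Hreal c x).
Proof.
  intro H. unfold Hmap, Hreal.
  rewrite RtoC_plus, RtoC_div, RtoC_mult, RtoC_minus, RtoC_mult by assumption. reflexivity.
Qed.

(* The critical point [d] is a double root of [Hreal c x = crit_val d]; the third root is [-2d/(1+d^2)]. *)
Lemma Hreal_minus_crit_val c d x : (d * d - 1) ^ 2 = c * (d * d + 1) -> x * x - 1 <> 0 ->
  Hreal c x - crit_val d = (x - d) ^ 2 * (x + 2 * d / (1 + d * d)) / (x * x - 1).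
Proof.
  intros Hd Hx. unfold Hreal, crit_val.
  assert (N : 1 + d * d <> 0) by nra.
  assert (Ec : c = (d * d - 1) ^ 2 / (1 + d * d)) by (rewrite Hd; field; assumption).
  rewrite Ec. field. split; assumption.
Qed.

Lemma Hreal_opp c x : Hreal c (- x) = - Hreal c x.
Proof.
  unfold Hreal. replace (- x * - x) with (x * x) by ring. unfold Rdiv. ring.
Qed.

(** The third root [-2a/(1+a^2)] lies to the left of [-a], so in [Hreal_minus_crit_val] the
    numerator is positive and only [x^2 - 1] decides the sign. *)
Lemma Hreal_inner lam a b c x : params lam a b c -> - a <= x < 1 -> x <> a -> Hreal c x < crit_val a.
Proof.
  intros P Hx Hne. destruct P.
  assert (N : x * x - 1 < 0) by nra.
  assert (E := Hreal_minus_crit_val c a x par_ca0 ltac:(lra)).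
  assert (T : a < 2 * a / (1 + a * a)).
  { apply (Rmult_lt_reg_r (1 + a * a)); [nra|]. unfold Rdiv.
    rewrite Rmult_assoc, Rinv_l by nra. nra. }
  assert (U : 0 < (x - a) ^ 2 * (x + 2 * a / (1 + a * a))).
  { apply Rmult_lt_0_compat; [|lra]. assert (x - a <> 0) by lra. nra. }
  assert (V : (x - a) ^ 2 * (x + 2 * a / (1 + a * a)) / (x * x - 1) < 0).
  { apply Rdiv_pos_neg; assumption. }
  lra.
Qed.

Lemma Hreal_outer lam a b c x : params lam a b c -> 1 < x -> x <> b -> crit_val b < Hreal c x.
Proof.
  intros P Hx Hne. destruct P.
  assert (N : 0 < x * x - 1) by nra.
  assert (E := Hreal_minus_crit_val c b x par_cb0 ltac:(lra)).
  assert (T : 0 < 2 * b / (1 + b * b)) by (apply Rdiv_lt_0_compat; nra).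
  assert (U : 0 < (x - b) ^ 2 * (x + 2 * b / (1 + b * b))).
  { apply Rmult_lt_0_compat; [|lra]. assert (x - b <> 0) by lra. nra. }
  assert (V : 0 < (x - b) ^ 2 * (x + 2 * b / (1 + b * b)) / (x * x - 1)).
  { apply Rdiv_lt_0_compat; assumption. }
  lra.
Qed.

Lemma Hreal_crit c d : (d * d - 1) ^ 2 = c * (d * d + 1) -> d * d - 1 <> 0 -> Hreal c d = crit_val d.
Proof.
  intros Hd Hx. assert (E := Hreal_minus_crit_val c d d Hd Hx).
  rewrite Rminus_diag in E. replace (0 ^ 2 * (d + 2 * d / (1 + d * d)) / (d * d - 1)) with 0 in E; [lra|].
  unfold Rdiv. ring.
Qed.

Lemma qd_real c x : qd c (RtoC x) = (x * x - 1) ^ 2 - c * (x * x + 1).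
Proof. unfold qd, nsq; simpl. ring. Qed.

Lemma qd_real_factor lam a b c x : params lam a b c ->
  qd c (RtoC x) = (x * x - a * a) * (x * x - b * b).
Proof.
  intro P. rewrite qd_real. assert (S := par_sum _ _ _ _ P). assert (M := par_prod _ _ _ _ P).
  replace ((x * x - a * a) * (x * x - b * b))
    with (x * x * (x * x) - (a * a + b * b) * (x * x) + a * a * (b * b)) by ring.
  rewrite S, M. ring.
Qed.

Lemma finite_pt_real x : finite_pt (RtoC x) -> x * x - 1 <> 0.
Proof.
  intros H E. apply H. apply injective_projections; simpl; lra.
Qed.

Lemma fst_Hmap c z : finite_pt z ->
  fst (Hmap c z) * nsq (z * z - RtoC 1)%C = fst z * (nsq (z * z - RtoC 1)%C + c * (nsq z - 1)).
Proof.
  intro Hz.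
  assert (E : (Hmap c z * (z * z - RtoC 1) = z * (z * z - RtoC 1) + RtoC c * z)%C).
  { symmetry. apply Hmap_spec; [exact Hz|reflexivity]. }
  set (w := Hmap c z) in *. clearbody w. destruct z as [x y], w as [p q].
  unfold nsq in *. apply (f_equal (fun k => fst (k * Cconj ((x, y) * (x, y) - RtoC 1))%C)) in E.
  simpl in E |- *. nra.
Qed.

Lemma Hmap_on_curve lam a b c z : params lam a b c -> finite_pt z -> qd c z = 0 -> snd z <> 0 ->
  snd (Hmap c z) = 0 /\
  (0 < fst z -> crit_val a < fst (Hmap c z) < crit_val b) /\
  (fst z < 0 -> - crit_val b < fst (Hmap c z) < - crit_val a).
Proof.
  intros P Fz Q Hy.
  assert (N := nsq_pos _ Fz).
  assert (Hs : snd (Hmap c z) = 0).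
  { assert (E := snd_Hmap c z Fz). rewrite Q, Rmult_0_r in E. apply Rmult_integral in E. destruct E; lra. }
  split; [assumption|].
  assert (S := par_sum _ _ _ _ P). assert (M := par_prod _ _ _ _ P).
  set (s := nsq z).
  assert (Hs0 : fst z ^ 2 < s) by (unfold s, nsq; nra).
  assert (Hs1 : 0 <= fst z ^ 2) by nra.
  assert (Q4 : 4 * fst z ^ 2 = (s + 1) ^ 2 - c * (s + 1)) by (unfold qd in Q; fold s in Q; lra).
  destruct (P) as [Ha Hb Hca Hcb Hc Hl Hv].
  (* On the curve this product equals [4 (fst z)^2 - 4 s], which is negative because [z] is not
     real; so [s] lies strictly between [a^2] and [b^2]. *)
  assert (Hr : (s - a * a) * (s - b * b) < 0).
  { replace ((s - a * a) * (s - b * b)) with (s * s - (a * a + b * b) * s + a * a * (b * b)) by ring.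
    rewrite S, M. nra. }
  assert (Hab : a * a < b * b) by nra.
  assert (Hsa : a * a < s) by nra. assert (Hsb : s < b * b) by nra.
  assert (EN : nsq (z * z - RtoC 1)%C = c * (s + 1)).
  { rewrite nsq_sq_minus_one. fold s. lra. }
  assert (E := fst_Hmap c z Fz). rewrite EN in E. fold s in E.
  assert (E1 : fst (Hmap c z) * (s + 1) = 2 * s * fst z).
  { apply (Rmult_eq_reg_l c); [|lra]. lra. }
  set (h := fst (Hmap c z)) in *. clearbody h.
  assert (E2 : h ^ 2 * (s + 1) = s ^ 2 * (s + 1 - c)).
  { apply (Rmult_eq_reg_r (s + 1)); [|lra].
    replace (h ^ 2 * (s + 1) * (s + 1)) with ((h * (s + 1)) ^ 2) by ring. rewrite E1.
    replace ((2 * s * fst z) ^ 2) with (s ^ 2 * (4 * fst z ^ 2)) by ring. rewrite Q4. ring. }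
  (* [h^2 = s^2 (1 - c/(s+1))] is increasing in [s]. *)
  assert (Mono : forall p q g k, 0 < p -> p < q -> g ^ 2 * (p + 1) = p ^ 2 * (p + 1 - c) ->
      k ^ 2 * (q + 1) = q ^ 2 * (q + 1 - c) -> g ^ 2 < k ^ 2).
  { intros p q g k Hp Hpq Eg Ek.
    apply (Rmult_lt_reg_r ((p + 1) * (q + 1))); [nra|].
    replace (g ^ 2 * ((p + 1) * (q + 1))) with (g ^ 2 * (p + 1) * (q + 1)) by ring.
    replace (k ^ 2 * ((p + 1) * (q + 1))) with (k ^ 2 * (q + 1) * (p + 1)) by ring.
    rewrite Eg, Ek.
    replace (p ^ 2 * (p + 1 - c) * (q + 1)) with (p ^ 2 * ((p + 1 - c) * (q + 1))) by ring.
    replace (q ^ 2 * (q + 1 - c) * (p + 1)) with (q ^ 2 * ((q + 1 - c) * (p + 1))) by ring.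
    apply Rmult_ge_0_gt_0_lt_compat; nra. }
  (* The critical values obey the same formula with [s = d^2], so comparing [s] with [a^2] and [b^2]
     compares [h] with the critical values. *)
  assert (Crit : forall d, (d * d - 1) ^ 2 = c * (d * d + 1) ->
     crit_val d ^ 2 * (d * d + 1) = (d * d) ^ 2 * (d * d + 1 - c)).
  { intros d Hd. apply (Rmult_eq_reg_r (d * d + 1)); [|nra].
    replace (crit_val d ^ 2 * (d * d + 1) * (d * d + 1)) with (4 * d ^ 6)
      by (unfold crit_val; field; nra).
    replace ((d * d) ^ 2 * (d * d + 1 - c) * (d * d + 1))
      with ((d * d) ^ 2 * ((d * d + 1) ^ 2 - c * (d * d + 1))) by ring.
    rewrite <- Hd. ring. }
  assert (Haa : 0 < a * a) by (apply Rmult_lt_0_compat; lra). assert (Hsp : 0 < s) by lra.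
  assert (B1 := Mono _ _ _ _ Haa Hsa (Crit a Hca) E2).
  assert (B2 := Mono _ _ _ _ Hsp Hsb E2 (Crit b Hcb)).
  assert (Pa := crit_val_pos _ _ _ _ P).
  assert (Pb : 0 < crit_val b).
  { unfold crit_val. rewrite Hv. apply Rmult_lt_0_compat; [lra|exact Pa]. }
  split; intro Hx.
  - assert (0 < h).
    { apply (Rmult_lt_reg_r (s + 1)); [lra|]. rewrite E1. nra. }
    split; apply Rnot_le_lt; intro; nra.
  - assert (h < 0).
    { apply (Rmult_lt_reg_r (s + 1)); [lra|]. rewrite E1. nra. }
    split; apply Rnot_le_lt; intro; nra.
Qed.

Lemma Hmap_real_axis c z : finite_pt z -> qd c z <> 0 -> snd (Hmap c z) = 0 ->
  exists x, z = RtoC x /\ x * x - 1 <> 0 /\ Hmap c z = RtoC (Hreal c x).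
Proof.
  intros Fz Q Hs. assert (E := snd_Hmap c z Fz). rewrite Hs, Rmult_0_l in E.
  symmetry in E. apply Rmult_integral in E. destruct E as [E|E]; [|contradiction].
  assert (Ez : z = RtoC (fst z)) by (apply injective_projections; simpl; auto).
  exists (fst z). rewrite Ez in Fz. assert (N := finite_pt_real _ Fz).
  split; [assumption|split; [assumption|]]. rewrite Ez at 1. apply Hmap_real, N.
Qed.

(** Off the curve a real value has a real preimage [x]. The factorisation of [qd] on the real axis
    locates [x] relative to the critical points, and the bounds on [Hreal] keep the value away from
    the cuts of its own sheet. *)
Lemma Hmap_off_curve lam a b c z : params lam a b c -> finite_pt z -> snd (Hmap c z) = 0 ->
  let h := fst (Hmap c z) in
  (0 < qd c z -> ~ (crit_val a <= h <= crit_val b) /\ ~ (- crit_val b <= h <= - crit_val a)) /\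
  (qd c z < 0 -> 0 < fst z -> ~ (crit_val a <= h <= crit_val b)) /\
  (qd c z < 0 -> fst z < 0 -> ~ (- crit_val b <= h <= - crit_val a)).
Proof.
  intros P Fz Hs h.
  assert (Pa := crit_val_pos _ _ _ _ P).
  assert (Pab : crit_val a < crit_val b).
  { destruct P. unfold crit_val in *. rewrite par_val0. nra. }
  destruct (Req_dec (qd c z) 0) as [Q|Q]; [rewrite Q; lra|].
  destruct (Hmap_real_axis c z Fz Q Hs) as [x [Ez [Nx Eh]]].
  assert (Eh' : h = Hreal c x) by (unfold h; rewrite Eh; reflexivity).
  clearbody h. subst h. rewrite Ez, (qd_real_factor _ _ _ _ x P). simpl fst.
  destruct (P) as [Ha Hb _ _ _ _ _].
  assert (I1 := fun x => Hreal_inner _ _ _ _ x P). assert (O1 := fun x => Hreal_outer _ _ _ _ x P).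
  assert (I2 := I1 (- x)). assert (O2 := O1 (- x)). rewrite Hreal_opp in I2, O2.
  specialize (I1 x). specialize (O1 x).
  assert (Hab : a * a < b * b) by nra.
  assert (Neg : (x * x - a * a) * (x * x - b * b) < 0 -> a * a < x * x < b * b) by (intro; split; nra).
  split; [|split].
  - intro Hq.
    assert (K : (- a < x < a) \/ b < x \/ x < - b).
    { destruct (Rlt_dec (x * x) (a * a)) as [L|L]; [left; split; nra|].
      right. assert (b * b < x * x) by nra.
      destruct (Rlt_dec 0 x); [left|right]; nra. }
    destruct K as [K|[K|K]].
    + specialize (I1 ltac:(lra) ltac:(lra)). specialize (I2 ltac:(lra) ltac:(lra)). lra.
    + specialize (O1 ltac:(lra) ltac:(lra)). lra.
    + specialize (O2 ltac:(lra) ltac:(lra)). lra.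
  - intros Hq Hx. destruct (Neg Hq).
    assert (K : a < x < b) by (split; nra).
    destruct (Rtotal_order x 1) as [L|[L|L]]; [|subst; lra|].
    + specialize (I1 ltac:(lra) ltac:(lra)). lra.
    + specialize (O1 ltac:(lra) ltac:(lra)). lra.
  - intros Hq Hx. destruct (Neg Hq).
    assert (K : a < - x < b) by (split; nra).
    destruct (Rtotal_order (- x) 1) as [L|[L|L]].
    + specialize (I2 ltac:(lra) ltac:(lra)). lra.
    + exfalso. apply Nx. replace x with (- - x) by ring. rewrite L. ring.
    + specialize (O2 ltac:(lra) ltac:(lra)). lra.
Qed.

Definition critical (a b : R) (z : C) : Prop :=
  z = RtoC a \/ z = RtoC (- a) \/ z = RtoC b \/ z = RtoC (- b).

(** The polynomial is the numerator of the derivative of [Hmap c]. *)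
Lemma critical_iff lam a b c z : params lam a b c ->
  (critical a b z <-> (z * z * (z * z) - RtoC (2 + c) * (z * z) + RtoC (1 - c))%C = RtoC 0).
Proof.
  intro P. rewrite <- (par_sum _ _ _ _ P), <- (par_prod _ _ _ _ P).
  rewrite RtoC_plus, !RtoC_mult.
  replace (z * z * (z * z) - (RtoC a * RtoC a + RtoC b * RtoC b) * (z * z) + RtoC a * RtoC a * (RtoC b * RtoC b))%C
    with ((z - RtoC a) * (z - RtoC (- a)) * ((z - RtoC b) * (z - RtoC (- b))))%C
    by (rewrite !RtoC_opp; ring).
  unfold critical. split.
  - intros [H|[H|[H|H]]]; rewrite H; ring.
  - intro H. apply NNPP. intro N. revert H.
    apply Cmult_neq_0; apply Cmult_neq_0; apply Cminus_eq_contra; intro; apply N; auto.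
Qed.

Lemma critical_qd lam a b c z : params lam a b c -> critical a b z -> qd c z = 0 /\ snd z = 0 /\ fst z <> 0.
Proof.
  intros P Hz. destruct (P) as [Ha Hb _ _ _ _ _].
  destruct Hz as [H|[H|[H|H]]]; rewrite H, (qd_real_factor _ _ _ _ _ P); simpl; repeat split; lra || ring.
Qed.

Lemma qd_zero_real lam a b c z : params lam a b c -> qd c z = 0 -> snd z = 0 -> critical a b z.
Proof.
  intros P Q Hs. assert (Ez : z = RtoC (fst z)) by (apply injective_projections; simpl; auto).
  rewrite Ez, (qd_real_factor _ _ _ _ _ P) in Q.
  replace ((fst z * fst z - a * a) * (fst z * fst z - b * b))
    with (((fst z - a) * (fst z + a)) * ((fst z - b) * (fst z + b))) in Q by ring.
  unfold critical. rewrite Ez. simpl fst in *.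
  apply Rmult_integral in Q. destruct Q as [Q|Q]; apply Rmult_integral in Q; destruct Q as [Q|Q];
   [left|right; left|right; right; left|right; right; right]; f_equal; lra.
Qed.

(** * Every sheet is reached: counting the roots of a fibre *)

Lemma fibre_double lam a b c w z t : params lam a b c -> fibre c w z z t -> critical a b z /\ t <> z.
Proof.
  intros P F. assert (K : critical a b z).
  { apply (critical_iff _ _ _ _ _ P). destruct F as [H1 [H2 H3]].
    assert (E : (t * (z * z + RtoC 1))%C = (- (RtoC 2 * z))%C).
    { transitivity (z * z * t + (z + z + t) - RtoC 2 * z)%C.
      - apply injective_projections; simpl; ring.
      - rewrite H3, H1. ring. }
    assert (E2 : (RtoC 2 * (z * t))%C = (RtoC (c - 1) - z * z)%C).
    { rewrite <- H2. apply injective_projections; simpl; ring. }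
    assert (E3 : ((RtoC (c - 1) - z * z) * (z * z + RtoC 1))%C = (- (RtoC 4 * (z * z)))%C).
    { rewrite <- E2. transitivity (RtoC 2 * z * (t * (z * z + RtoC 1)))%C; [ring|]. rewrite E.
      apply injective_projections; simpl; ring. }
    transitivity (- (((RtoC (c - 1) - z * z) * (z * z + RtoC 1)) + RtoC 4 * (z * z)))%C.
    - apply injective_projections; simpl; ring.
    - rewrite E3. ring. }
  split; [exact K|].
  (* A triple root would be real with [3 z^2 = c - 1 < 0]. *)
  intros ->. destruct (critical_qd _ _ _ _ _ P K) as [_ [S _]].
  assert (E := f_equal fst (proj1 (proj2 F))). simpl in E. rewrite S in E.
  destruct P as [_ _ _ _ Hc _ _]. nra.
Qed.

Lemma critical_sheet lam a b c z : params lam a b c -> critical a b z -> sheet_of c z <> S1.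
Proof.
  intros P K H. apply sheet_of_S1 in H. destruct (critical_qd _ _ _ _ _ P K). lra.
Qed.

(** A critical point lies on the curve, so [sheet1_injective] applies to it: another point over
    sheet 1 with the same value would be its conjugate, but critical points are real. *)
Lemma critical_fibre_sheet lam a b c z t : params lam a b c -> finite_pt z -> finite_pt t ->
  critical a b z -> Hmap c t = Hmap c z -> sheet_of c t <> S1.
Proof.
  intros P Fz Ft K E H. assert (H' := critical_sheet _ _ _ _ _ P K).
  assert (Hne : z <> t) by congruence. apply sheet_of_S1 in H.
  destruct (critical_qd _ _ _ _ _ P K) as [Q [S _]].
  destruct (sheet1_injective c z t) as [E' _]; auto; try lra.
  - destruct P; lra.
  - apply Hne. rewrite E'. apply injective_projections; simpl; lra.
Qed.

(** Three distinct roots occupy three different sheets. With a double root the two distinct ones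
    avoid sheet 1 and so occupy sheets 0 and 2; the second alternative records this, since the pair
    of [S1] and a branch point is not canonical. *)
Lemma sheet_of_surjective lam a b c k w : params lam a b c ->
  (exists z, finite_pt z /\ Hmap c z = w /\ sheet_of c z = k) \/
  (k = S1 /\ exists z, finite_pt z /\ critical a b z /\ Hmap c z = w).
Proof.
  intro P. destruct (P) as [_ _ _ _ Hc _ _].
  assert (Hc0 : c <> 0) by lra.
  destruct (fibre_exists c w) as [z [u [t F]]].
  assert (Fu := fibre_perm1 _ _ _ _ _ F).
  assert (Ft := fibre_perm1 _ _ _ _ _ (fibre_perm2 _ _ _ _ _ F)).
  assert (Pz := fibre_finite _ _ _ _ _ Hc0 F). assert (Ez := fibre_Hmap _ _ _ _ _ Hc0 F).
  assert (Pu := fibre_finite _ _ _ _ _ Hc0 Fu). assert (Eu := fibre_Hmap _ _ _ _ _ Hc0 Fu).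
  assert (Pt := fibre_finite _ _ _ _ _ Hc0 Ft). assert (Et := fibre_Hmap _ _ _ _ _ Hc0 Ft).
  assert (Double : forall v s, fibre c w v v s ->
    (exists z, finite_pt z /\ Hmap c z = w /\ sheet_of c z = k) \/
    (k = S1 /\ exists z, finite_pt z /\ critical a b z /\ Hmap c z = w)).
  { intros v s Fb. destruct (fibre_double _ _ _ _ _ _ _ P Fb) as [K Hne].
    assert (Fs := fibre_perm1 _ _ _ _ _ (fibre_perm2 _ _ _ _ _ Fb)).
    assert (Pv := fibre_finite _ _ _ _ _ Hc0 Fb). assert (Ev := fibre_Hmap _ _ _ _ _ Hc0 Fb).
    assert (Ps := fibre_finite _ _ _ _ _ Hc0 Fs). assert (Es := fibre_Hmap _ _ _ _ _ Hc0 Fs).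
    assert (S1' := critical_sheet _ _ _ _ _ P K).
    assert (S2' := critical_fibre_sheet _ _ _ _ v s P Pv Ps K ltac:(congruence)).
    assert (S3' : sheet_of c s <> sheet_of c v).
    { intro E. apply Hne. apply (sheet_of_injective c); auto. congruence. }
    destruct k.
    - left. destruct (sheet_of c v) eqn:A; destruct (sheet_of c s) eqn:B; try congruence;
        [exists v|exists s]; auto.
    - right. split; [reflexivity|exists v; auto].
    - left. destruct (sheet_of c v) eqn:A; destruct (sheet_of c s) eqn:B; try congruence;
        [exists s|exists v]; auto. }
  destruct (classic (z = u)) as [->|N1]; [apply (Double u t F)|].
  destruct (classic (z = t)) as [->|N2]; [apply (Double t u (fibre_perm2 _ _ _ _ _ F))|].
  destruct (classic (u = t)) as [->|N3]; [apply (Double t z (fibre_perm2 _ _ _ _ _ Fu))|].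
  left.
  assert (I : forall v v', finite_pt v -> finite_pt v' -> Hmap c v = w -> Hmap c v' = w ->
     v <> v' -> sheet_of c v <> sheet_of c v').
  { intros v v' Fv Fv' Ev Ev' Hn E. apply Hn. apply (sheet_of_injective c); auto. congruence. }
  assert (J1 := I z u Pz Pu Ez Eu N1). assert (J2 := I z t Pz Pt Ez Et N2).
  assert (J3 := I u t Pu Pt Eu Et N3).
  destruct (sheet_of c z) eqn:A; destruct (sheet_of c u) eqn:B; destruct (sheet_of c t) eqn:D;
    try congruence; destruct k;
    solve [exists z; auto|exists u; auto|exists t; auto].
Qed.

(** * The equation for [a] and the parameters derived from it *)

Definition equation (lam a : R) : Prop :=
  a ^ 8 + (16 * lam ^ 2 - 8) * a ^ 6 + 18 * a ^ 4 - 27 = 0.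

Lemma equation_unique lam : 1 < lam -> exists! a : R, 0 < a < 1 /\ equation lam a.
Proof.
  intro Hl. set (f := fun x => x ^ 8 + (16 * lam ^ 2 - 8) * x ^ 6 + 18 * x ^ 4 - 27).
  assert (Hk : 0 < 16 * lam ^ 2 - 8) by nra.
  assert (Hf : continuity f) by (unfold f; reg).
  assert (Mono : forall x y, 0 < x -> x < y -> f x < f y).
  { intros x y Hx Hxy. unfold f.
    assert (M : forall n, (0 < n)%nat -> x ^ n < y ^ n).
    { intros n Hn. destruct n as [|n]; [lia|]. clear Hn. induction n as [|n IH]; [simpl; lra|].
      assert (0 < x ^ S n) by (apply pow_lt; lra).
      rewrite <- (tech_pow_Rmult x), <- (tech_pow_Rmult y). apply Rmult_gt_0_lt_compat; lra. }
    assert (M8 := M 8%nat ltac:(lia)). assert (M6 := M 6%nat ltac:(lia)). assert (M4 := M 4%nat ltac:(lia)).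
    apply (Rmult_lt_compat_l _ _ _ Hk) in M6. lra. }
  (* The end values are [-27] and [16 (lam^2 - 1)]. *)
  destruct (IVT f 0 1 Hf Rlt_0_1) as [a [Ha E]]; [unfold f; lra|unfold f; simpl; nra|].
  exists a. split.
  - split; [|exact E]. split.
    + destruct Ha as [[H|H] _]; [assumption|]. subst a. unfold f in E. simpl in E. lra.
    + destruct Ha as [_ [H|H]]; [assumption|]. subst a. unfold f in E. simpl in E. nra.
  - intros a' [Ha' E']. change (f a' = 0) in E'.
    assert (Hp : 0 < a).
    { destruct Ha as [[H|H] _]; [assumption|]. subst a. unfold f in E. simpl in E. lra. }
    destruct (Rtotal_order a a') as [H|[H|H]]; [|assumption|].
    + specialize (Mono a a' Hp H). lra.
    + specialize (Mono a' a ltac:(lra) H). lra.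
Qed.

Lemma params_exist lam a : 1 < lam -> 0 < a < 1 -> equation lam a ->
  exists b, params lam a b ((1 - a ^ 2) ^ 2 / (1 + a ^ 2)).
Proof.
  intros Hl Ha E.
  assert (Ha2 : 0 < a * a < 1) by nra.
  (* [T] is [2 + c - a^2], the other root of the quadratic satisfied by the squares of the critical
     points. *)
  set (T := (3 - a * a) / (1 + a * a)).
  assert (HT : 1 < T).
  { unfold T. apply (Rmult_lt_reg_r (1 + a * a)); [lra|].
    unfold Rdiv. rewrite Rmult_assoc, Rinv_l by lra. lra. }
  exists (sqrt T). set (b := sqrt T).
  assert (Hb2 : b * b = T) by (apply sqrt_sqrt; lra).
  assert (Hb : 1 < b).
  { apply Rnot_le_lt. intro. assert (0 <= b) by apply sqrt_pos. nra. }
  assert (HbT : b * b = (3 - a * a) / (1 + a * a)) by exact Hb2.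
  clearbody b. clear Hb2 HT T.
  constructor; try assumption.
  - field. nra.
  - rewrite HbT. field. nra.
  - split.
    + apply Rdiv_lt_0_compat; [apply pow_lt|]; nra.
    + apply (Rmult_lt_reg_r (1 + a ^ 2)); [nra|]. unfold Rdiv.
      rewrite Rmult_assoc, Rinv_l by nra. nra.
  - assert (Hpow : forall n, 0 < a ^ n) by (intro; apply pow_lt; lra).
    assert (Hb3 : 0 < b ^ 3) by (apply pow_lt; lra).
    assert (Pl : 0 < 2 * b ^ 3 / (1 + b * b)) by (apply Rdiv_lt_0_compat; [lra|nra]).
    assert (Pr : 0 < lam * (2 * a ^ 3 / (1 + a * a))).
    { apply Rmult_lt_0_compat; [lra|]. apply Rdiv_lt_0_compat; [|lra].
      specialize (Hpow 3%nat). lra. }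
    (* After squaring only [b^2] occurs. With [1 + b^2 = 4/(1+a^2)] the difference of the two sides
       is a multiple of the polynomial of degree eight. *)
    apply Rsqr_inj; [left; assumption|left; assumption|]. unfold Rsqr.
    replace (2 * b ^ 3 / (1 + b * b) * (2 * b ^ 3 / (1 + b * b)))
      with (4 * (b * b) ^ 3 / (1 + b * b) ^ 2) by (field; nra).
    rewrite HbT. unfold equation in E.
    apply Rminus_diag_uniq.
    transitivity (- (a ^ 8 + (16 * lam ^ 2 - 8) * a ^ 6 + 18 * a ^ 4 - 27) / (4 * (1 + a * a) ^ 2)).
    + field. split; nra.
    + rewrite E. unfold Rdiv. ring.
Qed.

Lemma Hc_Hmap a z : finite_pt z -> Hc a z = Hmap ((1 - a ^ 2) ^ 2 / (1 + a ^ 2)) z.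
Proof.
  intro F. assert (N : 1 + a ^ 2 <> 0) by nra.
  assert (N' := RtoC_neq_0 _ N).
  assert (F' : (RtoC 1 - z * z)%C <> RtoC 0).
  { intro E. apply F. replace (z * z - RtoC 1)%C with (- (RtoC 1 - z * z))%C by ring. rewrite E. ring. }
  unfold Hc, Hmap. rewrite RtoC_div by assumption.
  set (p := RtoC ((1 - a ^ 2) ^ 2)). set (q := RtoC (1 + a ^ 2)) in *. clearbody p q.
  field. repeat split; assumption.
Qed.

Lemma Hc_critical lam a b c : params lam a b c -> c = (1 - a ^ 2) ^ 2 / (1 + a ^ 2) ->
  Hc a (RtoC a) = RtoC (crit_val a).
Proof.
  intros P Ec. assert (N : a * a - 1 <> 0) by (destruct P; nra).
  assert (F : finite_pt (RtoC a)).
  { intro E. apply N. injection E. intros. lra. }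
  rewrite (Hc_Hmap a _ F), <- Ec, Hmap_real by assumption.
  rewrite Hreal_crit; [reflexivity|destruct P; assumption|assumption].
Qed.

(** * Topology of the sphere and of the surface *)

Definition cs_nbhd (w : CS) (V : CS -> Prop) : Prop :=
  match w with
  | Some z => exists e, 0 < e /\ forall v, Cmod (v - z)%C < e -> V (Some v)
  | None => exists M, V None /\ forall v, M < Cmod v -> V (Some v)
  end.

Lemma cs_lim_nbhd u w :
  cs_lim u w <-> forall V, cs_nbhd w V -> exists N, forall n, (N <= n)%nat -> V (u n).
Proof.
  destruct w as [z|]; simpl; split.
  - intros H V [e [He HV]]. destruct (H e He) as [N HN]. exists N. intros n Hn.
    destruct (HN n Hn) as [v [E Hv]]. rewrite E. apply HV, Hv.
  - intros H eps He. apply (H (fun w => exists v, w = Some v /\ Cmod (v - z)%C < eps)).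
    exists eps. split; [assumption|]. intros v Hv. exists v. auto.
  - intros H V [M [H0 HV]]. destruct (H M) as [N HN]. exists N. intros n Hn.
    destruct (HN n Hn) as [E|[v [E Hv]]]; rewrite E; auto.
  - intros H M. apply (H (fun w => w = None \/ exists v, w = Some v /\ M < Cmod v)).
    exists M. split; [auto|]. intros v Hv. right. exists v; auto.
Qed.

Definition fin (w : CS) : C := match w with Some z => z | None => RtoC 0 end.

Lemma cs_lim_Some u z : cs_lim (fun n => Some (u n)) (Some z) <-> clim u z.
Proof.
  simpl. split; intros H eps He; destruct (H eps He) as [N HN]; exists N; intros n Hn.
  - destruct (HN n Hn) as [v [E Hv]]. injection E as ->. exact Hv.
  - exists (u n). auto.
Qed.

Lemma cs_lim_ext_loc u v w : (exists N, forall n, (N <= n)%nat -> u n = v n) ->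
  cs_lim u w -> cs_lim v w.
Proof.
  intros [N HN]. rewrite !cs_lim_nbhd. intros H V HV. destruct (H V HV) as [M HM].
  exists (N + M)%nat. intros n Hn. rewrite <- HN by lia. apply HM; lia.
Qed.

Lemma cs_lim_finite u z : cs_lim u (Some z) ->
  clim (fun n => fin (u n)) z /\ exists N, forall n, (N <= n)%nat -> u n = Some (fin (u n)).
Proof.
  intro H. split.
  - intros eps He. destruct (H eps He) as [N HN]. exists N. intros n Hn.
    destruct (HN n Hn) as [v [E Hv]]. rewrite E. exact Hv.
  - destruct (H 1 Rlt_0_1) as [N HN]. exists N. intros n Hn.
    destruct (HN n Hn) as [v [E Hv]]. rewrite E. reflexivity.
Qed.

Lemma cs_lim_subseq u w (phi : nat -> nat) : (forall n, (n <= phi n)%nat) ->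
  cs_lim u w -> cs_lim (fun n => u (phi n)) w.
Proof.
  intros Hphi. rewrite !cs_lim_nbhd. intros H V HV. destruct (H V HV) as [N HN].
  exists N. intros n Hn. apply HN. specialize (Hphi n). lia.
Qed.

Lemma cs_lim_unique u w w' : cs_lim u w -> cs_lim u w' -> w = w'.
Proof.
  assert (K : forall z, cs_lim u (Some z) -> cs_lim u None -> False).
  { intros z H1 H2. destruct (H1 1 Rlt_0_1) as [N1 HN1]. destruct (H2 (Cmod z + 1)) as [N2 HN2].
    destruct (HN1 (N1 + N2)%nat ltac:(lia)) as [v [E Hv]].
    destruct (HN2 (N1 + N2)%nat ltac:(lia)) as [E'|[v' [E' Hv']]]; rewrite E in E'; [discriminate|].
    injection E' as <-. assert (T := Cmod_triangle (v - z)%C z).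
    replace (v - z + z)%C with v in T by ring. lra. }
  destruct w as [z|], w' as [z'|]; intros H1 H2.
  - f_equal. destruct (cs_lim_finite _ _ H1) as [L1 _]. destruct (cs_lim_finite _ _ H2) as [L2 _].
    exact (clim_unique _ _ _ L1 L2).
  - destruct (K z H1 H2).
  - destruct (K z' H2 H1).
  - reflexivity.
Qed.

Lemma crecip_involutive w : crecip (crecip w) = w.
Proof.
  destruct w as [v|]; simpl.
  - destruct (excluded_middle_informative (v = RtoC 0)) as [E|E]; simpl; [rewrite E; reflexivity|].
    destruct (excluded_middle_informative (/ v = RtoC 0)%C) as [E'|E'].
    + destruct (Cinv_neq_0 v E E').
    + f_equal. field. exact E.
  - destruct (excluded_middle_informative (RtoC 0 = RtoC 0)) as [|E]; [reflexivity|destruct E; reflexivity].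
Qed.

Lemma crecip_Some v : v <> RtoC 0 -> crecip (Some v) = Some (/ v)%C.
Proof. intro H. simpl. destruct (excluded_middle_informative _); [contradiction|reflexivity]. Qed.

Lemma crecip_div p q : p <> RtoC 0 -> q <> RtoC 0 -> crecip (Some (p / q)%C) = Some (q / p)%C.
Proof.
  intros Hp Hq. rewrite crecip_Some.
  - f_equal. field. split; assumption.
  - apply Cmult_neq_0; [exact Hp|apply Cinv_neq_0, Hq].
Qed.

Lemma crecip_0 : crecip (Some (RtoC 0)) = None.
Proof. simpl. destruct (excluded_middle_informative _) as [|E]; [reflexivity|destruct E; reflexivity]. Qed.

Lemma Cmod_near_neq_0 (v z : C) : Cmod (v - z)%C < Cmod z -> v <> RtoC 0.
Proof.
  intros H E. rewrite E in H. replace (RtoC 0 - z)%C with (- z)%C in H by ring.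
  rewrite Cmod_opp in H. lra.
Qed.

Lemma cs_lim_crecip u w : cs_lim u w -> cs_lim (fun n => crecip (u n)) (crecip w).
Proof.
  intro H. destruct w as [z|].
  - destruct (cs_lim_finite _ _ H) as [L [N HN]].
    destruct (classic (z = RtoC 0)) as [->|Hz].
    + rewrite crecip_0. intro M. set (M' := Rabs M + 1).
      assert (HM : 0 < M') by (unfold M'; generalize (Rabs_pos M); lra).
      destruct (L (/ M') (Rinv_0_lt_compat _ HM)) as [N' HN'].
      exists (N + N')%nat. intros n Hn. rewrite (HN n) by lia.
      specialize (HN' n ltac:(lia)). set (v := fin (u n)) in *. clearbody v.
      destruct (classic (v = RtoC 0)) as [->|Hv]; [left; apply crecip_0|right].
      rewrite crecip_Some by assumption. exists (/ v)%C. split; [reflexivity|].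
      rewrite Cmod_inv by assumption.
      replace (v - RtoC 0)%C with v in HN' by ring.
      assert (Hp : 0 < Cmod v) by (apply Cmod_gt_0; assumption).
      apply Rinv_lt_contravar in HN'; [|apply Rmult_lt_0_compat; [assumption|apply Rinv_0_lt_compat; assumption]].
      rewrite Rinv_inv in HN'. generalize (Rle_abs M). unfold M' in HN'. lra.
    + rewrite crecip_Some by assumption.
      assert (Hp : 0 < Cmod z) by (apply Cmod_gt_0; assumption).
      destruct (L _ Hp) as [N' HN'].
      apply (cs_lim_ext_loc (fun n => Some (/ fin (u n))%C)).
      * exists (N + N')%nat. intros n Hn. rewrite (HN n) by lia. rewrite crecip_Some; [reflexivity|].
        apply (Cmod_near_neq_0 _ z). apply HN'. lia.
      * apply cs_lim_Some, clim_inv; assumption.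
  - simpl crecip. intros eps He. destruct (H (/ eps)) as [N HN]. exists N. intros n Hn.
    destruct (HN n Hn) as [E|[v [E Hv]]]; rewrite E.
    + exists (RtoC 0). split; [reflexivity|]. replace (RtoC 0 - RtoC 0)%C with (RtoC 0) by ring.
      rewrite Cmod_0; assumption.
    + assert (Hi := Rinv_0_lt_compat _ He).
      assert (Hv0 : v <> RtoC 0) by (intros ->; rewrite Cmod_0 in Hv; lra).
      exists (/ v)%C. split; [apply crecip_Some; assumption|].
      replace (/ v - RtoC 0)%C with (/ v)%C by ring. rewrite Cmod_inv by assumption.
      rewrite <- (Rinv_inv eps). apply Rinv_lt_contravar; [nra|assumption].
Qed.

Lemma ex_derive_ccont (f : C -> C) z : @ex_derive C_AbsRing C_NormedModule f z -> ccont f z.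
Proof. intro H. apply ex_derive_cder in H. destruct H as [l H]. exact (cder_ccont _ _ _ H). Qed.

Lemma holo_near_cont F z u : holo_near F z -> cs_lim u (Some z) -> cs_lim (fun n => F (u n)) (F (Some z)).
Proof.
  intros [d [Hd [F0 H]]] Hu. destruct (cs_lim_finite _ _ Hu) as [L [N HN]].
  destruct (L d Hd) as [N' HN'].
  assert (Hz : Cmod (z - z)%C < d) by (replace (z - z)%C with (RtoC 0) by ring; rewrite Cmod_0; assumption).
  destruct (H z Hz) as [E0 D0].
  rewrite E0. apply (cs_lim_ext_loc (fun n => Some (F0 (fin (u n))))).
  - exists (N + N')%nat. intros n Hn. rewrite (HN n) by lia. symmetry. apply H. apply HN'. lia.
  - apply cs_lim_Some. apply (ex_derive_ccont F0 z D0). exact L.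
Qed.

Lemma mero_at_cont F z u : mero_at F z -> cs_lim u (Some z) -> cs_lim (fun n => F (u n)) (F (Some z)).
Proof.
  intros [H|H] Hu; [apply holo_near_cont; assumption|].
  assert (K := cs_lim_crecip _ _ (holo_near_cont _ _ _ H Hu)). simpl in K.
  rewrite crecip_involutive in K. revert K. apply cs_lim_ext_loc. exists O. intros n _.
  apply crecip_involutive.
Qed.

Lemma mero_at_CS_cont F w u : mero_at_CS F w -> cs_lim u w -> cs_lim (fun n => F (u n)) (F w).
Proof.
  destruct w as [z|]; simpl; intros H Hu; [apply mero_at_cont; assumption|].
  assert (K := mero_at_cont _ _ (fun n => crecip (u n)) H (cs_lim_crecip u None Hu)).
  cbv beta in K. rewrite crecip_0 in K. revert K. apply cs_lim_ext_loc. exists O. intros n _.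
  rewrite crecip_involutive. reflexivity.
Qed.

(** * Sequential compactness and continuity of inverses *)

Lemma cluster_subsequence (u : nat -> R) (l : R) : ValAdh u l ->
  exists phi : nat -> nat, (forall n, (n <= phi n)%nat) /\ is_lim_seq (fun n => u (phi n)) l.
Proof.
  intro H.
  assert (K : forall n, exists p, (n <= p)%nat /\ Rabs (u p - l) < / (INR n + 1)).
  { intro n. assert (Hp : 0 < / (INR n + 1)) by (apply Rinv_0_lt_compat; generalize (pos_INR n); lra).
    destruct (H (disc l (mkposreal _ Hp)) n) as [p [Hp1 Hp2]].
    - exists (mkposreal _ Hp). intros x Hx; exact Hx.
    - exists p. split; assumption. }
  apply choice in K. destruct K as [phi Hphi]. exists phi. split; [intro n; apply Hphi|].
  apply is_lim_seq_eps. intros eps He.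
  destruct (proj1 (is_lim_seq_eps _ 0) is_lim_seq_inv_INR eps He) as [N HN].
  exists N. intros n Hn. specialize (HN n Hn). apply Rabs_def2 in HN.
  destruct (Hphi n) as [_ H2]. lra.
Qed.

Lemma bounded_subsequence (u : nat -> R) (M : R) : (forall n, Rabs (u n) <= M) ->
  exists phi (l : R), (forall n, (n <= phi n)%nat) /\ is_lim_seq (fun n => u (phi n)) l.
Proof.
  intro H. destruct (Bolzano_Weierstrass u (fun x => - M <= x <= M)) as [l Hl].
  - apply compact_P3.
  - intro n. apply Rabs_le_between, H.
  - destruct (cluster_subsequence u l Hl) as [phi Hphi]. exists phi, l. exact Hphi.
Qed.

Lemma is_lim_seq_extraction (u : nat -> R) (l : R) (phi : nat -> nat) :
  (forall n, (n <= phi n)%nat) -> is_lim_seq u l -> is_lim_seq (fun n => u (phi n)) l.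
Proof.
  intros Hphi H. rewrite is_lim_seq_eps in *. intros eps He. destruct (H eps He) as [N HN].
  exists N. intros n Hn. apply HN. specialize (Hphi n). lia.
Qed.

Lemma bounded_subsequence_C (u : nat -> C) (M : R) : (forall n, Cmod (u n) <= M) ->
  exists phi l, (forall n, (n <= phi n)%nat) /\ clim (fun n => u (phi n)) l.
Proof.
  intro H.
  destruct (bounded_subsequence (fun n => fst (u n)) M) as [p [x [Hp Lx]]].
  { intro n. eapply Rle_trans; [apply Rabs_fst_le_Cmod|apply H]. }
  destruct (bounded_subsequence (fun n => snd (u (p n))) M) as [q [y [Hq Ly]]].
  { intro n. eapply Rle_trans; [apply Rabs_snd_le_Cmod|apply H]. }
  exists (fun n => p (q n)), (x, y). split.
  - intro n. specialize (Hp (q n)). specialize (Hq n). lia.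
  - apply clim_components. split; [|exact Ly].
    apply (is_lim_seq_extraction (fun n => fst (u (p n))) x q Hq Lx).
Qed.

(** A sequence that is not eventually bounded has terms escaping to infinity. Extractions are only
    asked to satisfy [n <= phi n]: this is enough to pass limits on, and no monotone choice has to
    be built. *)
Lemma cs_compact (u : nat -> CS) :
  exists phi w, (forall n, (n <= phi n)%nat) /\ cs_lim (fun n => u (phi n)) w.
Proof.
  destruct (classic (exists M N, forall n, (N <= n)%nat -> exists v, u n = Some v /\ Cmod v <= M))
    as [[M [N H]]|H].
  - destruct (bounded_subsequence_C (fun n => fin (u (N + n)%nat)) M) as [phi [l [Hphi L]]].
    { intro n. destruct (H (N + n)%nat ltac:(lia)) as [v [E Hv]]. rewrite E. exact Hv. }
    exists (fun n => (N + phi n)%nat), (Some l). split.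
    + intro n. specialize (Hphi n). lia.
    + apply (cs_lim_ext_loc (fun n => Some (fin (u (N + phi n)%nat)))).
      * exists O. intros n _. destruct (H (N + phi n)%nat ltac:(lia)) as [v [E _]]. rewrite E. reflexivity.
      * apply cs_lim_Some, L.
  - assert (K : forall n, exists p, (n <= p)%nat /\ (u p = None \/ exists v, u p = Some v /\ INR n < Cmod v)).
    { intro n. apply NNPP. intro Hn. apply H. exists (INR n), n. intros p Hp.
      destruct (u p) as [v|] eqn:E.
      - exists v. split; [reflexivity|]. apply Rnot_lt_le. intro Hv. apply Hn. exists p.
        split; [assumption|]. rewrite E. right. exists v. auto.
      - exfalso. apply Hn. exists p. rewrite E. auto. }
    apply choice in K. destruct K as [phi Hphi]. exists phi, None. split; [intro n; apply Hphi|].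
    intro M. destruct (INR_unbounded M) as [N HN]. exists N. intros n Hn.
    destruct (Hphi n) as [_ [E|[v [E Hv]]]]; [left; assumption|right].
    exists v. split; [assumption|]. apply le_INR in Hn. lra.
Qed.

(** Stated for an abstract notion of limit because it serves for two targets: the surface, with the
    lift of [G], and the sphere, with the Moebius maps. *)
Lemma inverse_continuous (X : Type) (lim : (nat -> X) -> X -> Prop) (g : CS -> X) (h : X -> CS) :
  (forall u x y, lim u x -> lim u y -> x = y) ->
  (forall u x phi, (forall n, (n <= phi n)%nat) -> lim u x -> lim (fun n => u (phi n)) x) ->
  (forall u v x, (forall n, u n = v n) -> lim u x -> lim v x) ->
  (forall u z, cs_lim u z -> lim (fun n => g (u n)) (g z)) ->
  (forall z, h (g z) = z) -> (forall x, g (h x) = x) ->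
  forall u x, lim u x -> cs_lim (fun n => h (u n)) (h x).
Proof.
  intros Huniq Hsub Hext Hg Hhg Hgh u x Hu. apply cs_lim_nbhd. intros V HV.
  apply NNPP. intro Hn.
  assert (K : forall n, exists p, (n <= p)%nat /\ ~ V (h (u p))).
  { intro n. apply NNPP. intro Hc. apply Hn. exists n. intros p Hp. apply NNPP. intro Hv.
    apply Hc. exists p. auto. }
  apply choice in K. destruct K as [phi Hphi].
  destruct (cs_compact (fun n => h (u (phi n)))) as [psi [z [Hpsi Hz]]].
  assert (L1 := Hg _ _ Hz).
  assert (L2 : lim (fun n => u (phi (psi n))) x).
  { apply (Hsub u x (fun n => phi (psi n))); [|assumption].
    intro n. specialize (Hpsi n). destruct (Hphi (psi n)). lia. }
  assert (E : g z = x).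
  { apply (Huniq _ _ _ L1). apply (Hext (fun n => u (phi (psi n)))); [|exact L2].
    intro n. rewrite Hgh. reflexivity. }
  assert (Ez : z = h x) by (rewrite <- E, Hhg; reflexivity).
  rewrite <- Ez in HV. destruct (proj1 (cs_lim_nbhd _ _) Hz V HV) as [N HN].
  apply (proj2 (Hphi (psi N))). apply HN. lia.
Qed.

(** * Convergence on the surface *)

Lemma RS_ext lam (p q : RS lam) : rs_sheet lam p = rs_sheet lam q -> proj lam p = proj lam q -> p = q.
Proof.
  destruct p as [[k w] Hp], q as [[k' w'] Hq]. unfold rs_sheet, proj; simpl. intros -> ->.
  f_equal. apply UIP_dec. decide equality.
Qed.

Ltac decide_em :=
  repeat match goal with
  | |- context [excluded_middle_informative ?Q] =>
      destruct (excluded_middle_informative Q); try (exfalso; intuition congruence)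
  end.

(** This makes limits on the surface unique. At a branch point nearby points may be on two sheets,
    and only the canonical choice of representative keeps the limit point from having two names. *)
Lemma allowed_sheet_unique lam k k' w p : 1 < lam -> canon lam k w = k -> canon lam k' w = k' ->
  allowed lam (k, w) p -> allowed lam (k', w) p -> k = k'.
Proof.
  intro Hl. destruct p as [k1 y]. unfold allowed, canon.
  destruct w as [z|], y as [y|]; try congruence.
  unfold intD1, intD2, branch1, branch2.
  repeat match goal with
  | |- context [excluded_middle_informative ?P] => destruct (excluded_middle_informative P)
  | |- context [Rle_dec ?x ?y] => destruct (Rle_dec x y)
  end; destruct k, k', k1; simpl; try congruence; intros; exfalso;
  repeat match goal with
  | H : _ /\ _ |- _ => destruct H
  | H : ~ (_ /\ _) |- _ => apply not_and_or in H
  | H : ~ (_ \/ _) |- _ => apply not_or_and in H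
  | H : z = RtoC _ \/ z = RtoC _ |- _ => destruct H as [-> | ->]; simpl in *
  end; try congruence; try lra; intuition (try congruence; try lra);
  match goal with H : RtoC _ = RtoC _ |- _ => injection H; lra end.
Qed.

Lemma rs_lim_unique lam u p q : 1 < lam -> rs_lim lam u p -> rs_lim lam u q -> p = q.
Proof.
  intros Hl [L1 [N1 A1]] [L2 [N2 A2]].
  assert (E := cs_lim_unique _ _ _ L1 L2). apply RS_ext; [|assumption].
  specialize (A1 (N1 + N2)%nat ltac:(lia)). specialize (A2 (N1 + N2)%nat ltac:(lia)).
  destruct p as [[k w] Hp], q as [[k' w'] Hq]. unfold rs_sheet, proj in *. simpl in *. subst w'.
  exact (allowed_sheet_unique lam k k' w _ Hl Hp Hq A1 A2).
Qed.

Lemma rs_lim_subseq lam u p (phi : nat -> nat) : (forall n, (n <= phi n)%nat) ->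
  rs_lim lam u p -> rs_lim lam (fun n => u (phi n)) p.
Proof.
  intros Hphi [L [N A]]. split; [apply (cs_lim_subseq (fun n => proj lam (u n))); assumption|].
  exists N. intros n Hn. apply A. specialize (Hphi n). lia.
Qed.

Lemma rs_lim_ext_loc lam u v p : (exists N, forall n, (N <= n)%nat -> u n = v n) ->
  rs_lim lam u p -> rs_lim lam v p.
Proof.
  intros [N HN] [L [M A]]. split.
  - apply (cs_lim_ext_loc (fun n => proj lam (u n))); [|assumption].
    exists N. intros n Hn. rewrite (HN n Hn). reflexivity.
  - exists (N + M)%nat. intros n Hn. rewrite <- (HN n) by lia. apply A. lia.
Qed.

(** * The conformal homeomorphism *)

Definition cdiff (f : C -> C) (z : C) : Prop := exists l, cder f z l.

Lemma cdiff_const k z : cdiff (fun _ => k) z.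
Proof. eexists; apply cder_const. Qed.

Lemma cdiff_id z : cdiff (fun u => u) z.
Proof. eexists; apply cder_id. Qed.

Lemma cdiff_plus f g z : cdiff f z -> cdiff g z -> cdiff (fun u => f u + g u)%C z.
Proof. intros [l Hl] [m Hm]. eexists; apply cder_plus; eassumption. Qed.

Lemma cdiff_minus f g z : cdiff f z -> cdiff g z -> cdiff (fun u => f u - g u)%C z.
Proof. intros [l Hl] [m Hm]. eexists; apply cder_minus; eassumption. Qed.

Lemma cdiff_mult f g z : cdiff f z -> cdiff g z -> cdiff (fun u => f u * g u)%C z.
Proof. intros [l Hl] [m Hm]. eexists; apply cder_mult; eassumption. Qed.

Lemma cdiff_inv f z : f z <> RtoC 0 -> cdiff f z -> cdiff (fun u => / f u)%C z.
Proof. intros H [l Hl]. eexists; apply cder_inv; eassumption. Qed.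

Lemma cdiff_div f g z : g z <> RtoC 0 -> cdiff f z -> cdiff g z -> cdiff (fun u => f u / g u)%C z.
Proof. intros H Hf Hg. apply cdiff_mult; [assumption|]. apply cdiff_inv; assumption. Qed.

Ltac cdiff_tac :=
  repeat first [apply cdiff_div | apply cdiff_minus | apply cdiff_plus | apply cdiff_mult
               | apply cdiff_const | apply cdiff_id].

Lemma cdiff_ccont f z : cdiff f z -> ccont f z.
Proof. intros [l Hl]. exact (cder_ccont _ _ _ Hl). Qed.

Definition near (z : C) (Q : C -> Prop) : Prop :=
  exists d, 0 < d /\ forall u, Cmod (u - z)%C < d -> Q u.

Lemma near_and z Q Q' : near z Q -> near z Q' -> near z (fun u => Q u /\ Q' u).
Proof.
  intros [d [Hd H]] [d' [Hd' H']]. exists (Rmin d d'). split; [apply Rmin_glb_lt; assumption|].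
  intros u Hu. split; [apply H|apply H']; (eapply Rlt_le_trans; [exact Hu|]);
    [apply Rmin_l|apply Rmin_r].
Qed.

Lemma near_imp z (Q Q' : C -> Prop) : (forall u, Q u -> Q' u) -> near z Q -> near z Q'.
Proof. intros I [d [Hd H]]. exists d. split; [assumption|]. intros u Hu. apply I, H, Hu. Qed.

Lemma near_self z (Q : C -> Prop) : near z Q -> Q z.
Proof.
  intros [d [Hd H]]. apply H. replace (z - z)%C with (RtoC 0) by ring. rewrite Cmod_0; assumption.
Qed.

Lemma near_near z (Q : C -> Prop) : near z Q -> near z (fun u => near u Q).
Proof.
  intros [d [Hd H]]. exists (d / 2). split; [lra|]. intros u Hu. exists (d / 2). split; [lra|].
  intros v Hv. apply H. replace (v - z)%C with ((v - u) + (u - z))%C by ring.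
  eapply Rle_lt_trans; [apply Cmod_triangle|lra].
Qed.

Lemma near_clim z Q u : near z Q -> clim u z -> exists N, forall n, (N <= n)%nat -> Q (u n).
Proof.
  intros [d [Hd H]] Hu. destruct (Hu d Hd) as [N HN]. exists N. intros n Hn. apply H, HN, Hn.
Qed.

Lemma near_neq f z w : cdiff f z -> f z <> w -> near z (fun u => f u <> w).
Proof. intros Hf Hne. exact (ccont_neq f z w (cdiff_ccont f z Hf) Hne). Qed.

Lemma holo_near_intro F z F0 :
  near z (fun u => F (Some u) = Some (F0 u) /\ cdiff F0 u) -> holo_near F z.
Proof.
  intros [d [Hd H]]. exists d. split; [assumption|]. exists F0. intros u Hu.
  destruct (H u Hu) as [E D]. split; [exact E|]. apply ex_derive_cder, D.
Qed.

Lemma finite_pt_near z : finite_pt z -> near z finite_pt.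
Proof. intro H. apply (near_neq (fun u => u * u - RtoC 1)%C); [cdiff_tac|exact H]. Qed.

(** * The map [G] in charts of the sphere *)

Definition Wmap (a c : R) (z : C) : C := (Hmap c z / RtoC (crit_val a))%C.

Lemma par_c_eq lam a b c : params lam a b c -> c = (1 - a ^ 2) ^ 2 / (1 + a ^ 2).
Proof.
  intro P. apply (Rmult_eq_reg_r (a * a + 1)); [|nra].
  rewrite <- (par_ca _ _ _ _ P). field. nra.
Qed.

Lemma crit_val_neq_0 lam a b c : params lam a b c -> RtoC (crit_val a) <> RtoC 0.
Proof. intro P. apply RtoC_neq_0. generalize (crit_val_pos _ _ _ _ P). lra. Qed.

Lemma Gmap_finite lam a b c z : params lam a b c -> finite_pt z -> Gmap a (Some z) = Some (Wmap a c z).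
Proof.
  intros P F. destruct (proj1 (finite_pt_iff z) F) as [H1 H2]. unfold Gmap.
  destruct (excluded_middle_informative _) as [[|]|_]; try contradiction.
  rewrite (Hc_critical _ _ _ _ P (par_c_eq _ _ _ _ P)), (Hc_Hmap a z F), <- (par_c_eq _ _ _ _ P).
  reflexivity.
Qed.

Lemma Gmap_pole a z : ~ finite_pt z -> Gmap a (Some z) = None.
Proof.
  intro N. unfold Gmap. destruct (excluded_middle_informative _) as [|H]; [reflexivity|].
  destruct N. apply finite_pt_iff. split; intro E; apply H; auto.
Qed.

Lemma Hmap_cdiff c z : finite_pt z -> cdiff (Hmap c) z.
Proof. intro F. unfold Hmap. cdiff_tac. exact F. Qed.

Lemma Wmap_cdiff lam a b c z : params lam a b c -> finite_pt z -> cdiff (Wmap a c) z.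
Proof.
  intros P F. apply cdiff_div; [exact (crit_val_neq_0 _ _ _ _ P)|apply Hmap_cdiff, F|apply cdiff_const].
Qed.

(* [1/G] near the poles [1] and [-1]. *)
Definition Wrecip (a c : R) (z : C) : C :=
  (RtoC (crit_val a) * (z * z - RtoC 1) / (z * (z * z - RtoC 1 + RtoC c)))%C.

(* [x |-> 1/G(1/x)] near [0]. *)
Definition Wrecip_inf (a c : R) (x : C) : C :=
  (RtoC (crit_val a) * x * (RtoC 1 - x * x) / (RtoC 1 - RtoC (1 - c) * (x * x)))%C.

Lemma Gmap_recip_pole lam a b c z : params lam a b c -> ~ finite_pt z ->
  near z (fun u => crecip (Gmap a (Some u)) = Some (Wrecip a c u) /\ cdiff (Wrecip a c) u).
Proof.
  intros P N.
  assert (Ez : (z * z - RtoC 1)%C = RtoC 0) by (apply NNPP; exact N).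
  assert (H0 : z <> RtoC 0).
  { intros ->. apply (f_equal fst) in Ez. simpl in Ez. lra. }
  assert (H1 : (z * z - RtoC 1 + RtoC c)%C <> RtoC 0).
  { rewrite Ez. intro E. apply (f_equal fst) in E. simpl in E. destruct P; lra. }
  assert (N1 := near_neq (fun u => u) z _ (cdiff_id z) H0).
  assert (N2 := near_neq (fun u => u * u - RtoC 1 + RtoC c)%C z (RtoC 0) ltac:(cdiff_tac) H1).
  apply (near_imp _ _ _) with (2 := near_and _ _ _ N1 N2). intros u [U1 U2].
  assert (Hd : (u * (u * u - RtoC 1 + RtoC c))%C <> RtoC 0) by (apply Cmult_neq_0; assumption).
  split.
  - destruct (classic (finite_pt u)) as [F|F].
    + rewrite (Gmap_finite _ _ _ _ u P F).
      assert (Hc := crit_val_neq_0 _ _ _ _ P).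
      unfold Wmap, Wrecip.
      replace (Hmap c u) with (u * (u * u - RtoC 1 + RtoC c) / (u * u - RtoC 1))%C
        by (unfold Hmap; field; exact F).
      replace (u * (u * u - RtoC 1 + RtoC c) / (u * u - RtoC 1) / RtoC (crit_val a))%C
        with (u * (u * u - RtoC 1 + RtoC c) / (RtoC (crit_val a) * (u * u - RtoC 1)))%C
        by (field; split; assumption).
      apply crecip_div; [assumption|apply Cmult_neq_0; assumption].
    + rewrite Gmap_pole by assumption. simpl. f_equal. unfold Wrecip.
      replace (u * u - RtoC 1)%C with (RtoC 0) by (symmetry; apply NNPP; exact F).
      unfold Cdiv. ring.
  - unfold Wrecip. cdiff_tac. exact Hd.
Qed.

Lemma Gmap_recip_inf lam a b c : params lam a b c ->
  near (RtoC 0) (fun x => crecip (Gmap a (crecip (Some x))) = Some (Wrecip_inf a c x) /\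
     cdiff (Wrecip_inf a c) x).
Proof.
  intros P.
  assert (K1 : (RtoC 1 - RtoC 0 * RtoC 0)%C <> RtoC 0).
  { intro E. apply (f_equal fst) in E. simpl in E. lra. }
  assert (K2 : (RtoC 1 - RtoC (1 - c) * (RtoC 0 * RtoC 0))%C <> RtoC 0).
  { intro E. apply (f_equal fst) in E. simpl in E. lra. }
  assert (N1 := near_neq (fun x => RtoC 1 - x * x)%C (RtoC 0) (RtoC 0) ltac:(cdiff_tac) K1).
  assert (N2 := near_neq (fun x => RtoC 1 - RtoC (1 - c) * (x * x))%C (RtoC 0) (RtoC 0) ltac:(cdiff_tac) K2).
  apply (near_imp _ _ _) with (2 := near_and _ _ _ N1 N2). intros x [U1 U2].
  split.
  - destruct (classic (x = RtoC 0)) as [->|Hx].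
    + rewrite crecip_0. simpl. f_equal. unfold Wrecip_inf, Cdiv. ring.
    + rewrite crecip_Some by assumption.
      assert (E1 : (/ x * / x - RtoC 1)%C = ((RtoC 1 - x * x) / (x * x))%C) by (field; assumption).
      assert (F : finite_pt (/ x)%C).
      { intro E. rewrite E1 in E. apply U1.
        replace (RtoC 1 - x * x)%C with ((RtoC 1 - x * x) / (x * x) * (x * x))%C by (field; assumption).
        rewrite E. ring. }
      rewrite (Gmap_finite _ _ _ _ _ P F). assert (Hc := crit_val_neq_0 _ _ _ _ P).
      assert (EW : Wmap a c (/ x)%C =
        ((RtoC 1 - RtoC (1 - c) * (x * x)) / (RtoC (crit_val a) * x * (RtoC 1 - x * x)))%C).
      { unfold Wmap, Hmap. rewrite E1, RtoC_minus. field. repeat split; assumption. }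
      rewrite EW. apply crecip_div; [assumption|repeat apply Cmult_neq_0; assumption].
  - unfold Wrecip_inf. cdiff_tac. exact U2.
Qed.

Lemma Gmap_mero lam a b c w : params lam a b c -> mero_at_CS (Gmap a) w.
Proof.
  intro P. destruct w as [z|]; simpl.
  - destruct (classic (finite_pt z)) as [F|F].
    + left. apply (holo_near_intro _ _ (Wmap a c)).
      apply (near_imp _ _ _) with (2 := finite_pt_near z F). intros u Fu.
      split; [apply (Gmap_finite _ _ _ _ _ P Fu)|apply (Wmap_cdiff _ _ _ _ _ P Fu)].
    + right. apply (holo_near_intro _ _ (Wrecip a c)). apply (Gmap_recip_pole _ _ _ _ _ P F).
  - right. apply (holo_near_intro _ _ (Wrecip_inf a c)).
    apply (near_imp _ _ _) with (2 := Gmap_recip_inf _ _ _ _ P). auto.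
Qed.

(** * Local behaviour of the sheets and the images of the critical points *)

Definition seq_cont (f : C -> R) (z : C) : Prop :=
  forall u, clim u z -> is_lim_seq (fun n => f (u n)) (f z).

Lemma near_gt f z r : seq_cont f z -> r < f z -> near z (fun u => r < f u).
Proof.
  intros Hf Hp.
  destruct (seq_characterization (fun _ u => r < f u) z) with (eps := 1) as [d [Hd H]]; [|lra|].
  - intros u Hu eps _.
    destruct (proj1 (is_lim_seq_eps _ _) (Hf u Hu) (f z - r) ltac:(lra)) as [N HN].
    exists N. specialize (HN N (Nat.le_refl _)). apply Rabs_def2 in HN. lra.
  - exists d. split; assumption.
Qed.

Lemma near_lt f z r : seq_cont f z -> f z < r -> near z (fun u => f u < r).
Proof.
  intros Hf H. apply (near_imp z (fun u => - r < - f u)); [intros; lra|].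
  apply near_gt; [|lra]. intros u Hu. apply (is_lim_seq_opp _ (f z)), Hf, Hu.
Qed.

Lemma fst_cont z : seq_cont fst z.
Proof. intros u H. apply clim_components in H. tauto. Qed.

Lemma snd_cont z : seq_cont snd z.
Proof. intros u H. apply clim_components in H. tauto. Qed.

Lemma qd_cont c z : seq_cont (qd c) z.
Proof.
  intros u H. assert (Hf := fst_cont _ _ H). assert (Hs := snd_cont _ _ H).
  assert (Sq : forall f (l : R), is_lim_seq f l -> is_lim_seq (fun n => f n ^ 2) (l ^ 2)).
  { intros f l L. apply (is_lim_seq_ext (fun n => f n * f n)); [intro; ring|].
    replace (l ^ 2) with (l * l) by ring. apply is_lim_seq_mult'; exact L. }
  assert (N : is_lim_seq (fun n => nsq (u n) + 1) (nsq z + 1)).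
  { apply is_lim_seq_plus'; [|apply is_lim_seq_const].
    apply is_lim_seq_plus'; apply Sq; assumption. }
  unfold qd. apply is_lim_seq_minus'; [apply is_lim_seq_minus'|].
  - apply Sq, N.
  - apply is_lim_seq_mult'; [apply is_lim_seq_const|]. apply Sq, Hf.
  - apply is_lim_seq_mult'; [apply is_lim_seq_const|exact N].
Qed.

Lemma near_sheet c z : c < 1 -> qd c z <> 0 -> near z (fun u => sheet_of c u = sheet_of c z).
Proof.
  intros Hc Q. destruct (Rdichotomy _ _ Q) as [H|H].
  - assert (Hx : fst z <> 0) by (intro E; generalize (qd_pos_imaginary c z Hc E); lra).
    destruct (Rdichotomy _ _ Hx) as [Hx'|Hx'].
    + apply (near_imp _ _ _) with (2 := near_and _ _ _ (near_lt _ z 0 (qd_cont c z) H) (near_lt _ z 0 (fst_cont z) Hx')).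
      intros u [U1 U2]. transitivity S0; [|symmetry]; apply sheet_of_S0; unfold lower_sheet; auto.
    + apply (near_imp _ _ _) with (2 := near_and _ _ _ (near_lt _ z 0 (qd_cont c z) H) (near_gt _ z 0 (fst_cont z) Hx')).
      intros u [U1 U2]. transitivity S2; [|symmetry]; apply sheet_of_S2; unfold lower_sheet; auto.
  - apply (near_imp _ _ _) with (2 := near_gt _ z 0 (qd_cont c z) H).
    intros u U. transitivity S1; [|symmetry]; apply sheet_of_S1; auto.
Qed.

Lemma qd_pole c z : 0 < c -> ~ finite_pt z -> qd c z < 0.
Proof.
  intros Hc N. assert (E : (z * z - RtoC 1)%C = RtoC 0) by (apply NNPP; exact N).
  assert (K := nsq_sq_minus_one z). rewrite E in K. unfold qd.
  rewrite <- K. unfold nsq; simpl. nra.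
Qed.

Lemma Wmap_fst lam a b c z : params lam a b c -> fst (Wmap a c z) = fst (Hmap c z) / crit_val a.
Proof.
  intro P. assert (H := crit_val_pos _ _ _ _ P). unfold Wmap. destruct (Hmap c z) as [p q].
  simpl. field. lra.
Qed.

Lemma Wmap_snd lam a b c z : params lam a b c -> snd (Wmap a c z) = snd (Hmap c z) / crit_val a.
Proof.
  intro P. assert (H := crit_val_pos _ _ _ _ P). unfold Wmap. destruct (Hmap c z) as [p q].
  simpl. field. lra.
Qed.

Lemma Hmap_Wmap lam a b c z : params lam a b c ->
  fst (Hmap c z) = crit_val a * fst (Wmap a c z) /\ snd (Hmap c z) = crit_val a * snd (Wmap a c z).
Proof.
  intro P. rewrite (Wmap_fst _ _ _ _ z P), (Wmap_snd _ _ _ _ z P).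
  assert (H := crit_val_pos _ _ _ _ P). split; field; lra.
Qed.

Lemma crit_val_b lam a b c : params lam a b c -> crit_val b = crit_val a * lam.
Proof. intro P. unfold crit_val. rewrite (par_val _ _ _ _ P). ring. Qed.

Lemma Wmap_inj lam a b c z u : params lam a b c -> Wmap a c z = Wmap a c u -> Hmap c z = Hmap c u.
Proof.
  intros P E. destruct (Hmap_Wmap _ _ _ _ z P) as [A1 A2]. destruct (Hmap_Wmap _ _ _ _ u P) as [B1 B2].
  apply injective_projections; congruence.
Qed.

Lemma off_cut lam a b c z : params lam a b c -> finite_pt z -> qd c z <> 0 ->
  ~ on_cut lam (sheet_of c z) (Some (Wmap a c z)).
Proof.
  intros P F Q. destruct (Hmap_Wmap _ _ _ _ z P) as [A1 A2].
  assert (Hp := crit_val_pos _ _ _ _ P). assert (Hb := crit_val_b _ _ _ _ P).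
  assert (Hc : c < 1) by (destruct P; lra).
  assert (Hx : qd c z < 0 -> fst z <> 0).
  { intros H E; generalize (qd_pos_imaginary c z Hc E); lra. }
  simpl. unfold inD1, inD2. intros [[K [D0 D]]|[K [D0 D]]];
    rewrite D0, Rmult_0_r in A2; destruct (Hmap_off_curve _ _ _ _ z P F A2) as [O1 [O2 O3]];
    rewrite A1, Hb in O1, O2, O3.
  - assert (I : - (crit_val a * lam) <= crit_val a * fst (Wmap a c z) <= - crit_val a) by (split; nra).
    destruct (Rdichotomy _ _ Q) as [H|H]; [|destruct (O1 H); contradiction].
    destruct (Rdichotomy _ _ (Hx H)) as [Hx'|Hx']; [exact (O3 H Hx' I)|].
    apply K. apply sheet_of_S2. unfold lower_sheet; auto.
  - assert (I : crit_val a <= crit_val a * fst (Wmap a c z) <= crit_val a * lam) by (split; nra).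
    destruct (Rdichotomy _ _ Q) as [H|H]; [|destruct (O1 H); contradiction].
    destruct (Rdichotomy _ _ (Hx H)) as [Hx'|Hx']; [|exact (O2 H Hx' I)].
    apply K. apply sheet_of_S0; unfold lower_sheet; auto.
Qed.

Lemma critical_finite lam a b c z : params lam a b c -> critical a b z -> finite_pt z.
Proof.
  intros P K. apply NNPP. intro N. destruct (critical_qd _ _ _ _ _ P K) as [Q _].
  assert (H := qd_pole c z ltac:(destruct P; lra) N). lra.
Qed.

Lemma Wmap_real_value lam a b c d : params lam a b c -> (d * d - 1) ^ 2 = c * (d * d + 1) ->
  d * d - 1 <> 0 -> Wmap a c (RtoC d) = RtoC (crit_val d / crit_val a).
Proof.
  intros P E N. unfold Wmap. rewrite Hmap_real, (Hreal_crit c d E N) by assumption.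
  rewrite RtoC_div; [reflexivity|]. generalize (crit_val_pos _ _ _ _ P). lra.
Qed.

Lemma crit_val_opp d : crit_val (- d) = - crit_val d.
Proof. unfold crit_val. field. nra. Qed.

Lemma Wmap_critical lam a b c : params lam a b c ->
  Wmap a c (RtoC a) = RtoC 1 /\ Wmap a c (RtoC (- a)) = RtoC (-1) /\
  Wmap a c (RtoC b) = RtoC lam /\ Wmap a c (RtoC (- b)) = RtoC (- lam).
Proof.
  intro P. assert (Hp := crit_val_pos _ _ _ _ P). assert (Hb := crit_val_b _ _ _ _ P).
  assert (K := fun d => Wmap_real_value _ _ _ _ d P). destruct P.
  rewrite !K by nra.
  rewrite !crit_val_opp, Hb. repeat split; f_equal; field; lra.
Qed.

Definition branch_value (lam : R) (w : C) : Prop := branch1 lam w \/ branch2 lam w.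

Lemma branch_value_critical lam a b c w : params lam a b c -> branch_value lam w ->
  exists z, critical a b z /\ Wmap a c z = w.
Proof.
  intros P H. destruct (Wmap_critical _ _ _ _ P) as [W1 [W2 [W3 W4]]]. unfold critical.
  destruct H as [[H|H]|[H|H]]; rewrite H;
    [exists (RtoC (- b))|exists (RtoC (- a))|exists (RtoC a)|exists (RtoC b)]; auto.
Qed.

Lemma critical_branch_value lam a b c z : params lam a b c -> critical a b z ->
  (0 < fst z -> branch2 lam (Wmap a c z)) /\ (fst z < 0 -> branch1 lam (Wmap a c z)).
Proof.
  intros P H. destruct (Wmap_critical _ _ _ _ P) as [W1 [W2 [W3 W4]]].
  unfold branch1, branch2. destruct P.
  destruct H as [H|[H|[H|H]]]; rewrite H; rewrite ?W1, ?W2, ?W3, ?W4; simpl; split; auto; intro; lra.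
Qed.

Lemma sheet_of_branch_value lam a b c z : params lam a b c -> finite_pt z ->
  branch_value lam (Wmap a c z) -> sheet_of c z <> S1.
Proof.
  intros P F H. destruct (branch_value_critical _ _ _ _ _ P H) as [v [K E]].
  apply (critical_fibre_sheet _ _ _ _ v z P (critical_finite _ _ _ _ _ P K) F K).
  symmetry. exact (Wmap_inj _ _ _ _ _ _ P E).
Qed.

(** * The lift of [G] to the surface *)

Definition gsheet (c : R) (w : CS) : sheet := match w with None => S1 | Some z => sheet_of c z end.

Definition gmap (lam a c : R) (w : CS) : RS lam := mkpt lam (gsheet c w) (Gmap a w).

Lemma proj_gmap lam a c w : proj lam (gmap lam a c w) = Gmap a w.
Proof. reflexivity. Qed.

(** [canon] changes only the sheet [S1] over a branch point, and no preimage of a branch point is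
    assigned to [S1]. *)
Lemma sheet_gmap lam a b c w : params lam a b c -> rs_sheet lam (gmap lam a c w) = gsheet c w.
Proof.
  intro P. unfold rs_sheet, gmap, mkpt. simpl.
  destruct w as [z|]; [|reflexivity]. simpl gsheet.
  destruct (classic (finite_pt z)) as [F|F].
  - rewrite (Gmap_finite _ _ _ _ z P F).
    destruct (sheet_of c z) eqn:S; try reflexivity. unfold canon.
    assert (B : ~ branch_value lam (Wmap a c z)).
    { intro H. exact (sheet_of_branch_value _ _ _ _ z P F H S). }
    unfold branch_value in B.
    destruct (excluded_middle_informative (branch1 lam (Wmap a c z))); [tauto|].
    destruct (excluded_middle_informative (branch2 lam (Wmap a c z))); [tauto|reflexivity].
  - rewrite Gmap_pole by assumption. destruct (sheet_of c z); reflexivity.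
Qed.

Lemma gmap_pair lam a b c w : params lam a b c ->
  proj1_sig (gmap lam a c w) = (gsheet c w, Gmap a w).
Proof.
  intro P. assert (E := sheet_gmap _ _ _ _ w P). unfold rs_sheet in E.
  apply injective_projections; [exact E|reflexivity].
Qed.

Lemma branch_not_int lam w : 1 < lam -> (branch1 lam w \/ branch2 lam w) -> ~ intD1 lam w /\ ~ intD2 lam w.
Proof.
  unfold branch1, branch2, intD1, intD2.
  intros Hl [[H|H]|[H|H]]; rewrite H; simpl; lra.
Qed.

Lemma allowed_off_cut lam k z y : 1 < lam -> ~ on_cut lam k (Some z) -> allowed lam (k, Some z) (k, Some y).
Proof.
  intros Hl H. unfold allowed. simpl in H. unfold inD1, inD2 in H. unfold intD1, intD2, branch1, branch2.
  destruct (excluded_middle_informative _) as [E1|_].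
  { exfalso. apply H. left. split; [tauto|]. lra. }
  destruct (excluded_middle_informative _) as [E2|_].
  { exfalso. apply H. right. split; [tauto|]. lra. }
  destruct (excluded_middle_informative _) as [[E3 K]|_].
  { exfalso. apply H. left. destruct E3 as [E3|E3]; rewrite E3, K; simpl; (split; [discriminate|lra]). }
  destruct (excluded_middle_informative _) as [[E4 K]|_]; [|reflexivity].
  exfalso. apply H. right. destruct E4 as [E4|E4]; rewrite E4, K; simpl; (split; [discriminate|lra]).
Qed.

(** At a pole or off the curve the sheet is locally constant. At a critical point [allowed] excludes
    one sheet, which the sign of the real part rules out. Elsewhere on the curve, crossing it
    changes the sheet exactly when the value changes sides of the cut. *)
Lemma near_allowed lam a b c z : params lam a b c ->
  near z (fun u => allowed lam (sheet_of c z, Gmap a (Some z)) (sheet_of c u, Gmap a (Some u))).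
Proof.
  intro P. assert (Hc : 0 < c < 1) by (destruct P; assumption). assert (Hl := par_lam _ _ _ _ P).
  destruct (classic (finite_pt z)) as [F|F].
  2:{ rewrite (Gmap_pole a z F).
      apply (near_imp _ _ _) with (2 := near_sheet c z ltac:(lra) ltac:(generalize (qd_pole c z ltac:(lra) F); lra)).
      intros u Hu. exact Hu. }
  rewrite (Gmap_finite _ _ _ _ z P F).
  assert (NF := finite_pt_near z F).
  destruct (Req_dec (qd c z) 0) as [Q|Q].
  2:{ apply (near_imp _ _ _) with (2 := near_and _ _ _ NF (near_sheet c z ltac:(lra) Q)).
      intros u [Fu Hu]. rewrite (Gmap_finite _ _ _ _ u P Fu), Hu.
      apply allowed_off_cut; [assumption|]. exact (off_cut _ _ _ _ z P F Q). }
  assert (Hx : fst z <> 0) by (intro E; generalize (qd_pos_imaginary c z ltac:(lra) E); lra).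
  assert (Hp := crit_val_pos _ _ _ _ P). assert (Hb := crit_val_b _ _ _ _ P).
  destruct (Req_dec (snd z) 0) as [Hy|Hy].
  { assert (K := qd_zero_real _ _ _ _ z P Q Hy).
    destruct (critical_branch_value _ _ _ _ z P K) as [B2 B1].
    destruct (Rdichotomy _ _ Hx) as [Hx'|Hx'].
    - specialize (B1 Hx'). destruct (branch_not_int lam (Wmap a c z) Hl (or_introl B1)) as [I1 I2].
      assert (S : sheet_of c z = S0) by (apply sheet_of_S0; unfold lower_sheet; lra). rewrite S.
      apply (near_imp _ _ _) with (2 := near_and _ _ _ NF (near_lt _ z 0 (fst_cont z) Hx')).
      intros u [Fu Hu]. rewrite (Gmap_finite _ _ _ _ u P Fu). unfold allowed.
      decide_em.
      intro E. apply sheet_of_S2 in E. lra.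
    - specialize (B2 Hx'). destruct (branch_not_int lam (Wmap a c z) Hl (or_intror B2)) as [I1 I2].
      assert (S : sheet_of c z = S2) by (apply sheet_of_S2; unfold lower_sheet; lra). rewrite S.
      apply (near_imp _ _ _) with (2 := near_and _ _ _ NF (near_gt _ z 0 (fst_cont z) Hx')).
      intros u [Fu Hu]. rewrite (Gmap_finite _ _ _ _ u P Fu). unfold allowed.
      decide_em.
      intro E. apply sheet_of_S0 in E; lra. }
  destruct (Hmap_on_curve _ _ _ _ z P F Q Hy) as [C0 [C2 C1]].
  destruct (Hmap_Wmap _ _ _ _ z P) as [A1 A2].
  assert (W0 : snd (Wmap a c z) = 0) by (rewrite (Wmap_snd _ _ _ _ z P), C0; unfold Rdiv; ring).
  (* Translates the half-plane test of [allowed] into the sign of [qd], given that the imaginary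
     part of [u] has a fixed sign near a nonreal [z]. *)
  assert (Sgn : forall u, finite_pt u -> (0 <= snd (Wmap a c u) <-> 0 <= snd u * qd c u)).
  { intros u Fu. assert (E := snd_Hmap c u Fu). destruct (Hmap_Wmap _ _ _ _ u P) as [_ E'].
    assert (N := nsq_pos _ Fu). rewrite E' in E. rewrite <- E.
    set (s := snd (Wmap a c u)). set (n := nsq (u * u - RtoC 1)%C) in *.
    assert (0 < crit_val a * n) by nra. split; intro; nra. }
  assert (Side : near z (fun u => 0 < snd z /\ 0 < snd u \/ snd z < 0 /\ snd u < 0)).
  { destruct (Rdichotomy _ _ Hy) as [H|H].
    - apply (near_imp _ _ _) with (2 := near_lt _ z 0 (snd_cont z) H). auto.
    - apply (near_imp _ _ _) with (2 := near_gt _ z 0 (snd_cont z) H). auto. }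
  destruct (Rdichotomy _ _ Hx) as [Hx'|Hx'].
  - specialize (C1 Hx'). rewrite A1, Hb in C1.
    assert (I1 : intD1 lam (Wmap a c z)) by (split; [assumption|split; nra]).
    apply (near_imp _ _ _) with (2 := near_and _ _ _ NF (near_and _ _ _ Side (near_lt _ z 0 (fst_cont z) Hx'))).
    intros u [Fu [Hs Hu]]. rewrite (Gmap_finite _ _ _ _ u P Fu). specialize (Sgn u Fu).
    assert (Kz : sheet_of c z <> S2) by (intro E; apply sheet_of_S2 in E; lra).
    unfold allowed.
    decide_em.
    destruct Hs as [[Hz Hs]|[Hz Hs]].
    + assert (S : sheet_of c z = S1) by (apply sheet_of_S1; auto). rewrite S.
      destruct (Rle_dec 0 (snd (Wmap a c u))) as [L|L].
      * apply Sgn in L. apply sheet_of_S1. assert (0 <= qd c u) by nra. lra.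
      * simpl. apply sheet_of_S0; [lra|]. split; [left|assumption]. apply Rnot_le_lt. intro. apply L, Sgn. nra.
    + assert (S : sheet_of c z = S0) by (apply sheet_of_S0; unfold lower_sheet; lra). rewrite S.
      destruct (Rle_dec 0 (snd (Wmap a c u))) as [L|L].
      * apply Sgn in L. apply sheet_of_S0; [lra|]. unfold lower_sheet. assert (qd c u <= 0) by nra. lra.
      * simpl. apply sheet_of_S1. left. apply Rnot_le_lt. intro. apply L, Sgn. nra.
  - specialize (C2 Hx'). rewrite A1, Hb in C2.
    assert (I2 : intD2 lam (Wmap a c z)) by (split; [assumption|split; nra]).
    assert (I1 : ~ intD1 lam (Wmap a c z)) by (unfold intD1, intD2 in *; lra).
    apply (near_imp _ _ _) with (2 := near_and _ _ _ NF (near_and _ _ _ Side (near_gt _ z 0 (fst_cont z) Hx'))).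
    intros u [Fu [Hs Hu]]. rewrite (Gmap_finite _ _ _ _ u P Fu). specialize (Sgn u Fu).
    assert (Kz : sheet_of c z <> S0) by (intro E; apply sheet_of_S0 in E; lra).
    unfold allowed.
    decide_em.
    destruct Hs as [[Hz Hs]|[Hz Hs]].
    + assert (S : sheet_of c z = S1) by (apply sheet_of_S1; auto). rewrite S.
      destruct (Rle_dec 0 (snd (Wmap a c u))) as [L|L].
      * apply Sgn in L. apply sheet_of_S1. assert (0 <= qd c u) by nra. lra.
      * simpl. apply sheet_of_S2. split; [left|assumption]. apply Rnot_le_lt. intro. apply L, Sgn. nra.
    + assert (S : sheet_of c z = S2) by (apply sheet_of_S2; unfold lower_sheet; lra). rewrite S.
      destruct (Rle_dec 0 (snd (Wmap a c u))) as [L|L].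
      * apply Sgn in L. apply sheet_of_S2. unfold lower_sheet. assert (qd c u <= 0) by nra. lra.
      * simpl. apply sheet_of_S1. left. apply Rnot_le_lt. intro. apply L, Sgn. nra.
Qed.

Lemma qd_far c z : 0 < c < 1 -> 3 < Cmod z -> 0 < qd c z.
Proof.
  intros Hc Hz. assert (E : nsq z = Cmod z * Cmod z).
  { unfold nsq, Cmod. rewrite sqrt_sqrt; [reflexivity|nra]. }
  assert (H : fst z ^ 2 <= nsq z) by (unfold nsq; nra).
  assert (9 < nsq z) by nra. unfold qd. nra.
Qed.

Lemma gmap_continuous lam a b c : params lam a b c -> cont_CR lam (gmap lam a c).
Proof.
  intros P u z Hu. split.
  - apply (mero_at_CS_cont (Gmap a)); [exact (Gmap_mero _ _ _ _ z P)|exact Hu].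
  - rewrite (gmap_pair _ _ _ _ z P). destruct z as [z|].
    + destruct (cs_lim_finite _ _ Hu) as [L [N HN]].
      destruct (near_clim _ _ _ (near_allowed _ _ _ _ z P) L) as [M HM].
      exists (N + M)%nat. intros n Hn. rewrite (HN n) by lia.
      rewrite (gmap_pair _ _ _ _ _ P). apply HM. lia.
    + destruct (Hu 3) as [N HN]. exists N. intros n Hn.
      rewrite (gmap_pair _ _ _ _ _ P). destruct (HN n Hn) as [E|[v [E Hv]]]; rewrite E; simpl.
      * reflexivity.
      * apply sheet_of_S1. left. apply qd_far; [destruct P; assumption|assumption].
Qed.

Lemma gmap_injective lam a b c z u : params lam a b c -> gmap lam a c z = gmap lam a c u -> z = u.
Proof.
  intros P E. assert (Hc : 0 < c < 1) by (destruct P; assumption).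
  assert (Es := f_equal (rs_sheet lam) E). rewrite !(sheet_gmap _ _ _ _ _ P) in Es.
  assert (Ep := f_equal (proj lam) E). rewrite !proj_gmap in Ep.
  (* The three points mapped to infinity are told apart by their sheets: [1] on sheet 2, [-1] on
     sheet 0 and infinity on sheet 1. *)
  assert (Pole : forall v, ~ finite_pt v -> v = RtoC 1 /\ sheet_of c v = S2 \/ v = RtoC (-1) /\ sheet_of c v = S0).
  { intros v F. assert (Q := qd_pole c v ltac:(lra) F).
    destruct (classic (v = RtoC 1)) as [H1|H1].
    - left. split; [assumption|]. apply sheet_of_S2. split; [left; assumption|]. rewrite H1; simpl; lra.
    - destruct (classic (v = RtoC (-1))) as [H2|H2].
      + right. split; [assumption|]. apply sheet_of_S0; [lra|]. split; [left; assumption|]. rewrite H2; simpl; lra.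
      + destruct F. apply finite_pt_iff. auto. }
  destruct z as [z|], u as [u|]; try reflexivity.
  - f_equal. simpl in Es.
    destruct (classic (finite_pt z)) as [Fz|Fz]; destruct (classic (finite_pt u)) as [Fu|Fu].
    + rewrite (Gmap_finite _ _ _ _ z P Fz), (Gmap_finite _ _ _ _ u P Fu) in Ep. apply (f_equal fin) in Ep. unfold fin in Ep.
      apply (sheet_of_injective c); auto. exact (Wmap_inj _ _ _ _ _ _ P Ep).
    + rewrite (Gmap_finite _ _ _ _ z P Fz), (Gmap_pole a u Fu) in Ep. discriminate.
    + rewrite (Gmap_finite _ _ _ _ u P Fu), (Gmap_pole a z Fz) in Ep. discriminate.
    + destruct (Pole z Fz) as [[Z1 Z2]|[Z1 Z2]], (Pole u Fu) as [[U1 U2]|[U1 U2]]; congruence.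
  - simpl in Es. destruct (classic (finite_pt z)) as [Fz|Fz].
    + rewrite (Gmap_finite _ _ _ _ z P Fz) in Ep. discriminate.
    + destruct (Pole z Fz) as [[Z1 Z2]|[Z1 Z2]]; congruence.
  - simpl in Es. destruct (classic (finite_pt u)) as [Fu|Fu].
    + rewrite (Gmap_finite _ _ _ _ u P Fu) in Ep. discriminate.
    + destruct (Pole u Fu) as [[Z1 Z2]|[Z1 Z2]]; congruence.
Qed.

Lemma not_finite_1 : ~ finite_pt (RtoC 1).
Proof. intro H. apply finite_pt_iff in H. tauto. Qed.

Lemma not_finite_m1 : ~ finite_pt (RtoC (-1)).
Proof. intro H. apply finite_pt_iff in H. tauto. Qed.

Lemma gmap_surjective lam a b c p : params lam a b c -> exists z, gmap lam a c z = p.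
Proof.
  intro P. assert (Hc : 0 < c < 1) by (destruct P; assumption).
  assert (K : exists z, gsheet c z = rs_sheet lam p /\ Gmap a z = proj lam p).
  { destruct p as [[k w] Hp]. unfold rs_sheet, proj. simpl in *. destruct w as [w|].
    - destruct (sheet_of_surjective _ _ _ _ k (w * RtoC (crit_val a))%C P)
        as [[z [F [E S]]]|[-> [z [F [K E]]]]].
      + exists (Some z). split; [exact S|]. rewrite (Gmap_finite _ _ _ _ z P F).
        unfold Wmap. rewrite E. f_equal. field. exact (crit_val_neq_0 _ _ _ _ P).
      (* A point of the surface carries a canonical pair, so the sheet [S1] over a branch point
         cannot occur. *)
      + exfalso. assert (EW : Wmap a c z = w).
        { unfold Wmap. rewrite E. field. exact (crit_val_neq_0 _ _ _ _ P). }
        destruct (critical_branch_value _ _ _ _ z P K) as [B2 B1]. rewrite EW in B1, B2.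
        destruct (critical_qd _ _ _ _ _ P K) as [_ [_ Hx]].
        revert Hp. unfold canon. destruct (excluded_middle_informative (branch1 lam w)); [discriminate|].
        destruct (excluded_middle_informative (branch2 lam w)); [discriminate|]. intros _.
        destruct (Rdichotomy _ _ Hx); tauto.
    - destruct k.
      + exists (Some (RtoC (-1))). split; [|apply Gmap_pole, not_finite_m1].
        apply sheet_of_S0; [lra|]. split; [left; apply qd_pole; [lra|apply not_finite_m1]|simpl; lra].
      + exists None. split; reflexivity.
      + exists (Some (RtoC 1)). split; [|apply Gmap_pole, not_finite_1].
        apply sheet_of_S2. split; [left; apply qd_pole; [lra|apply not_finite_1]|simpl; lra]. }
  destruct K as [z [E1 E2]]. exists z. apply RS_ext; [|exact E2].
  rewrite (sheet_gmap _ _ _ _ z P). exact E1.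
Qed.

Lemma gmap_homeo lam a b c : params lam a b c -> exists h : RS lam -> CS,
  (forall z, h (gmap lam a c z) = z) /\ (forall p, gmap lam a c (h p) = p) /\ cont_RC lam h.
Proof.
  intro P. destruct (choice (fun p z => gmap lam a c z = p)) as [h Hh].
  { intro p. exact (gmap_surjective _ _ _ _ p P). }
  assert (H1 : forall z, h (gmap lam a c z) = z).
  { intro z. apply (gmap_injective _ _ _ _ _ _ P). apply Hh. }
  exists h. split; [exact H1|split; [exact Hh|]].
  intros u q Hu. apply (inverse_continuous (RS lam) (rs_lim lam) (gmap lam a c) h); auto.
  - intros; apply (rs_lim_unique lam u0); auto. exact (par_lam _ _ _ _ P).
  - intros; apply rs_lim_subseq; assumption.
  - intros u0 v x E. apply rs_lim_ext_loc. exists O. auto.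
  - apply (gmap_continuous _ _ _ _ P).
Qed.

Lemma gmap_conformal lam a b c : params lam a b c -> conformal_homeo lam (gmap lam a c).
Proof.
  intro P. destruct (gmap_homeo _ _ _ _ P) as [h [H1 [H2 H3]]]. split.
  - exists h. repeat split; auto; apply (gmap_continuous _ _ _ _ P); assumption.
  - intro w. exact (Gmap_mero _ _ _ _ w P).
Qed.

(** * Local inverses of G on the sheets *)

Lemma cdiff_comp f g z : cdiff g z -> cdiff f (g z) -> cdiff (fun u => f (g u)) z.
Proof.
  intros Hg [m [q [H4 [H5 H6]]]]. assert (Cg := cdiff_ccont g z Hg).
  destruct Hg as [l [p [H1 [H2 H3]]]].
  exists (m * l)%C, (fun u => q (g u) * p u)%C. split; [|split; [congruence|]].
  - apply ccont_mult; [apply ccont_comp; assumption|assumption].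
  - intro u. rewrite (H6 (g u)). rewrite (H3 u) at 2. ring.
Qed.

Lemma cdiff_near_ext f g z : near z (fun u => f u = g u) -> cdiff f z -> cdiff g z.
Proof. intros [d [Hd H]] [l Hl]. exists l. exact (cder_ext_loc f g z l d Hd H Hl). Qed.

Lemma near_preimage f z Q : ccont f z -> near (f z) Q -> near z (fun u => Q (f u)).
Proof.
  intros Hf [d [Hd H]]. destruct (proj1 (ccont_eps f z) Hf d Hd) as [e [He H']].
  exists e. split; [assumption|]. intros u Hu. apply H, H', Hu.
Qed.

Lemma holo_near_elim F z : holo_near F z -> exists F0,
  near z (fun u => F (Some u) = Some (F0 u) /\ cdiff F0 u).
Proof.
  intros [d [Hd [F0 H]]]. exists F0, d. split; [assumption|]. intros u Hu.
  destruct (H u Hu) as [E D]. split; [exact E|]. apply ex_derive_cder, D.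
Qed.

Lemma holo_near_comp m F z F0 : near z (fun u => F (Some u) = Some (F0 u) /\ cdiff F0 u) ->
  holo_near m (F0 z) -> holo_near (fun w => m (F w)) z.
Proof.
  intros HF Hm. apply holo_near_elim in Hm. destruct Hm as [m0 Hm].
  apply (holo_near_intro _ _ (fun u => m0 (F0 u))).
  assert (Hc := cdiff_ccont _ _ (proj2 (near_self _ _ HF))).
  apply (near_imp _ _ _) with (2 := near_and _ _ _ HF (near_preimage _ _ _ Hc Hm)).
  intros u [[E D] [E' D']]. split; [rewrite E; exact E'|apply cdiff_comp; assumption].
Qed.

Lemma mero_at_comp_holo m F z F0 : near z (fun u => F (Some u) = Some (F0 u) /\ cdiff F0 u) ->
  mero_at m (F0 z) -> mero_at (fun w => m (F w)) z.
Proof.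
  intros HF [Hm|Hm]; [left|right].
  - exact (holo_near_comp m F z F0 HF Hm).
  - exact (holo_near_comp (fun w => crecip (m w)) F z F0 HF Hm).
Qed.

Lemma mero_at_ext F F' z : (forall w, F w = F' w) -> mero_at F z -> mero_at F' z.
Proof.
  intros E [[d [Hd [F0 H]]]|[d [Hd [F0 H]]]]; [left|right]; exists d; (split; [assumption|]);
    exists F0; intros u Hu; rewrite <- E; exact (H u Hu).
Qed.

Lemma mero_at_CS_ext F F' w : (forall x, F x = F' x) -> mero_at_CS F w -> mero_at_CS F' w.
Proof.
  intro E. destruct w as [z|]; simpl; apply mero_at_ext; [exact E|]. intro x. apply E.
Qed.

Lemma mero_at_comp m F z : (forall w, mero_at_CS m w) -> mero_at F z -> mero_at (fun w => m (F w)) z.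
Proof.
  intros Hm [HF|HF]; apply holo_near_elim in HF; destruct HF as [F0 HF].
  - apply (mero_at_comp_holo m F z F0 HF). exact (Hm (Some (F0 z))).
  (* Here [F0] represents [1/F]. At a zero of [F0] the value of [F] is infinite and the chart of [m]
     at infinity is needed; otherwise [F] itself is finite near [z] and equals [1/F0]. *)
  - destruct (classic (F0 z = RtoC 0)) as [E|E].
    + apply (mero_at_ext (fun w => (fun x => m (crecip x)) (crecip (F w)))).
      { intro w. rewrite crecip_involutive. reflexivity. }
      apply (mero_at_comp_holo (fun x => m (crecip x)) (fun w => crecip (F w)) z F0 HF).
      rewrite E. exact (Hm None).
    + apply (mero_at_comp_holo m F z (fun u => / F0 u)%C); [|exact (Hm (Some (/ F0 z)%C))].
      assert (N := near_neq F0 z _ (proj2 (near_self _ _ HF)) E).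
      apply (near_imp _ _ _) with (2 := near_and _ _ _ HF N). intros u [[E1 D] E2].
      split; [|apply cdiff_inv; assumption].
      rewrite <- (crecip_involutive (F (Some u))), E1. apply crecip_Some, E2.
Qed.

Lemma mero_at_CS_comp m F w : (forall w, mero_at_CS m w) -> mero_at_CS F w ->
  mero_at_CS (fun x => m (F x)) w.
Proof.
  intros Hm. destruct w as [z|]; simpl; intro H; [apply mero_at_comp; assumption|].
  exact (mero_at_comp m (fun x => F (crecip x)) (RtoC 0) Hm H).
Qed.

(** The numerator of the derivative is the polynomial of [critical_iff]. *)
Lemma Wmap_der_neq_0 lam a b c z : params lam a b c -> finite_pt z -> ~ critical a b z ->
  exists l, cder (Wmap a c) z l /\ l <> RtoC 0.
Proof.
  intros P F K. assert (Hv := crit_val_neq_0 _ _ _ _ P).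
  assert (D : cder (fun u => (u + RtoC c * u * / (u * u - RtoC 1)) * / RtoC (crit_val a))%C z
    ((z * z * (z * z) - RtoC (2 + c) * (z * z) + RtoC (1 - c)) /
      ((z * z - RtoC 1) * (z * z - RtoC 1) * RtoC (crit_val a)))%C).
  { match goal with |- cder ?f z ?r => assert (E : exists l, cder f z l /\ l = r) end.
    { eexists. split.
      - apply cder_mult; [apply cder_plus; [apply cder_id|]|apply cder_const].
        apply cder_mult; [apply cder_mult; [apply cder_const|apply cder_id]|].
        apply cder_inv; [exact F|].
        apply cder_minus; [apply cder_mult; apply cder_id|apply cder_const].
      - cbv beta. rewrite RtoC_plus, RtoC_minus.
        field. split; assumption. }
    destruct E as [l [D E]]. rewrite <- E. exact D. }
  eexists. split; [exact D|].
  intro E. apply K. apply (critical_iff _ _ _ _ _ P).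
  match type of E with (?n / ?d)%C = _ =>
    assert (Hd : d <> RtoC 0) by (repeat apply Cmult_neq_0; assumption);
    replace n with ((n / d) * d)%C by (field; repeat split; assumption); rewrite E
  end. ring.
Qed.

Lemma near_snd_neq z : snd z <> 0 -> near z (fun u => snd u <> 0).
Proof.
  intro H. destruct (Rdichotomy _ _ H) as [H'|H'].
  - apply (near_imp _ _ _) with (2 := near_lt _ z 0 (snd_cont z) H'). intros; lra.
  - apply (near_imp _ _ _) with (2 := near_gt _ z 0 (snd_cont z) H'). intros; lra.
Qed.

Lemma near_not_segment p q z : ~ (snd z = 0 /\ p <= fst z <= q) ->
  near z (fun u => ~ (snd u = 0 /\ p <= fst u <= q)).
Proof.
  intro H. destruct (Req_dec (snd z) 0) as [E|E].
  - destruct (Rlt_dec (fst z) p) as [L|L].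
    + apply (near_imp _ _ _) with (2 := near_lt _ z p (fst_cont z) L). intros; lra.
    + apply (near_imp _ _ _) with (2 := near_gt _ z q (fst_cont z) ltac:(lra)). intros; lra.
  - apply (near_imp _ _ _) with (2 := near_snd_neq z E). intros; lra.
Qed.

Lemma near_true z (Q : C -> Prop) : (forall u, Q u) -> near z Q.
Proof. intro H. exists 1. split; [lra|auto]. Qed.

Lemma near_off_cut lam k z : ~ on_cut lam k (Some z) -> near z (fun u => ~ on_cut lam k (Some u)).
Proof.
  intro H. simpl in H. unfold inD1, inD2 in H.
  assert (N1 : near z (fun u => ~ (k <> S2 /\ inD1 lam u))).
  { destruct (classic (k = S2)) as [E|E]; [apply near_true; tauto|].
    apply (near_imp _ _ _) with (2 := near_not_segment (- lam) (-1) z ltac:(tauto)). unfold inD1; tauto. }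
  assert (N2 : near z (fun u => ~ (k <> S0 /\ inD2 lam u))).
  { destruct (classic (k = S0)) as [E|E]; [apply near_true; tauto|].
    apply (near_imp _ _ _) with (2 := near_not_segment 1 lam z ltac:(tauto)). unfold inD2; tauto. }
  apply (near_imp _ _ _) with (2 := near_and _ _ _ N1 N2). simpl. tauto.
Qed.

Lemma canon_off_cut lam k w : 1 < lam -> ~ on_cut lam k w -> canon lam k w = k.
Proof.
  intros Hl H. destruct k, w as [z|]; try reflexivity. simpl in H. unfold inD1, inD2 in H. unfold canon.
  destruct (excluded_middle_informative (branch1 lam z)) as [[E|E]|_].
  - exfalso. apply H. left. rewrite E; simpl. split; [discriminate|lra].
  - exfalso. apply H. left. rewrite E; simpl. split; [discriminate|lra].
  - destruct (excluded_middle_informative (branch2 lam z)) as [[E|E]|_]; [| |reflexivity].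
    + exfalso. apply H. right. rewrite E; simpl. split; [discriminate|lra].
    + exfalso. apply H. right. rewrite E; simpl. split; [discriminate|lra].
Qed.

Lemma canon_canon_allowed lam k w y : 1 < lam -> ~ on_cut lam k w -> ~ on_cut lam k y ->
  allowed lam (canon lam k w, w) (canon lam k y, y).
Proof.
  intros Hl Hw Hy. rewrite !canon_off_cut by assumption.
  destruct w as [z|], y as [y|]; try reflexivity. apply allowed_off_cut; assumption.
Qed.

Lemma on_cut_bounded lam k v : 1 < lam -> on_cut lam k (Some v) -> Cmod v <= lam.
Proof.
  intros Hl H. eapply Rle_trans; [apply Cmod_le_sum|]. simpl in H. unfold inD1, inD2 in H.
  destruct H as [[_ [H1 H2]]|[_ [H1 H2]]]; rewrite H1, Rabs_R0.
  - rewrite Rabs_left by lra. lra.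
  - rewrite Rabs_right by lra. lra.
Qed.

Lemma mkpt_lim lam k u w : 1 < lam -> ~ on_cut lam k w -> cs_lim u w ->
  rs_lim lam (fun n => mkpt lam k (u n)) (mkpt lam k w).
Proof.
  intros Hl Hw Hu. split; [exact Hu|].
  assert (K : exists N, forall n, (N <= n)%nat -> ~ on_cut lam k (u n)).
  { destruct w as [z|].
    - destruct (cs_lim_finite _ _ Hu) as [L [N HN]].
      destruct (near_clim _ _ _ (near_off_cut lam k z Hw) L) as [M HM].
      exists (N + M)%nat. intros n Hn. rewrite (HN n) by lia. apply HM. lia.
    - destruct (Hu lam) as [N HN]. exists N. intros n Hn.
      destruct (HN n Hn) as [E|[v [E Hv]]]; rewrite E; [simpl; tauto|].
      intro H. apply (on_cut_bounded lam k v Hl) in H. lra. }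
  destruct K as [N HN]. exists N. intros n Hn. unfold mkpt; simpl.
  apply canon_canon_allowed; auto.
Qed.

(** * Holomorphy of the inverse of the lift in the coordinates of the sheets *)

Section Charts.
Variables (lam a b c : R) (h : RS lam -> CS).
Hypothesis P : params lam a b c.
Hypothesis Hgh : forall p, gmap lam a c (h p) = p.
Hypothesis Hhg : forall z, h (gmap lam a c z) = z.
Hypothesis Hcont : cont_RC lam h.

Lemma chart_lim k u w : ~ on_cut lam k w -> cs_lim u w ->
  cs_lim (fun n => h (mkpt lam k (u n))) (h (mkpt lam k w)).
Proof.
  intros Hw Hu. apply (Hcont (fun n => mkpt lam k (u n))).
  apply mkpt_lim; [exact (par_lam _ _ _ _ P)|assumption|assumption].
Qed.

Lemma Gmap_chart k w : Gmap a (h (mkpt lam k w)) = w.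
Proof. rewrite <- (proj_gmap lam a c), Hgh. reflexivity. Qed.

Lemma sheet_chart k w : ~ on_cut lam k w -> gsheet c (h (mkpt lam k w)) = k.
Proof.
  intro Hw. rewrite <- (sheet_gmap _ _ _ _ _ P), Hgh.
  apply canon_off_cut; [exact (par_lam _ _ _ _ P)|assumption].
Qed.

Lemma chart_finite k w : ~ on_cut lam k (Some w) ->
  exists z, h (mkpt lam k (Some w)) = Some z /\ finite_pt z /\ Wmap a c z = w /\
    ~ critical a b z /\ sheet_of c z = k.
Proof.
  intro Hw. assert (E := Gmap_chart k (Some w)). assert (S := sheet_chart k (Some w) Hw).
  destruct (h (mkpt lam k (Some w))) as [z|]; [|discriminate].
  exists z. destruct (classic (finite_pt z)) as [F|F]; [|rewrite Gmap_pole in E by assumption; discriminate].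
  rewrite (Gmap_finite _ _ _ _ z P F) in E.
  assert (EW : Wmap a c z = w) by (apply (f_equal fin) in E; exact E).
  repeat split; try assumption. intro K. apply Hw. simpl in S.
  destruct (critical_branch_value _ _ _ _ z P K) as [B2 B1]. rewrite EW in B1, B2.
  destruct (critical_qd _ _ _ _ z P K) as [Q [Hy Hx]].
  assert (Hl := par_lam _ _ _ _ P). assert (Hc := par_c _ _ _ _ P).
  destruct (Rdichotomy _ _ Hx) as [Hx'|Hx'].
  - left. assert (Sz : sheet_of c z = S0) by (apply sheet_of_S0; unfold lower_sheet; lra).
    split; [congruence|]. unfold inD1. destruct (B1 Hx') as [H|H]; rewrite H; simpl; lra.
  - right. assert (Sz : sheet_of c z = S2) by (apply sheet_of_S2; unfold lower_sheet; lra).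
    split; [congruence|]. unfold inD2. destruct (B2 Hx') as [H|H]; rewrite H; simpl; lra.
Qed.

Definition chart (k : sheet) (u : C) : C := fin (h (mkpt lam k (Some u))).

(** [chart k] is a continuous local right inverse of [Wmap a c], and off the cuts its values are not
    critical, so [cder_inverse] applies. *)
Lemma chart_spec k u : ~ on_cut lam k (Some u) ->
  h (mkpt lam k (Some u)) = Some (chart k u) /\ cdiff (chart k) u.
Proof.
  intro Hu. destruct (chart_finite k u Hu) as [z [E [F [EW [K _]]]]].
  assert (Ez : chart k u = z) by (unfold chart; rewrite E; reflexivity).
  split; [rewrite Ez; exact E|].
  assert (Cc : ccont (chart k) u).
  { intros v Hv.
    assert (L := chart_lim k (fun n => Some (v n)) (Some u) Hu (proj2 (cs_lim_Some v u) Hv)).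
    rewrite E in L. rewrite Ez. exact (proj1 (cs_lim_finite _ _ L)). }
  destruct (near_off_cut lam k u Hu) as [d [Hd Hn]].
  rewrite <- Ez in F, K. destruct (Wmap_der_neq_0 _ _ _ _ _ P F K) as [l [D Hl]].
  eexists. apply (cder_inverse (Wmap a c) (chart k) u l d Hd); try assumption.
  intros v Hv. destruct (chart_finite k v (Hn v Hv)) as [z' [E' [_ [EW' _]]]].
  unfold chart. rewrite E'. exact EW'.
Qed.

Lemma chart_inf : h (mkpt lam S1 None) = None /\ h (mkpt lam S0 None) = Some (RtoC (-1)) /\
  h (mkpt lam S2 None) = Some (RtoC 1).
Proof.
  assert (Hc := par_c _ _ _ _ P).
  assert (K : forall k z, gsheet c z = k -> Gmap a z = None -> h (mkpt lam k None) = z).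
  { intros k z E1 E2. rewrite <- (Hhg z). f_equal. apply RS_ext.
    - rewrite (sheet_gmap _ _ _ _ z P), E1. unfold rs_sheet, mkpt; simpl. destruct k; reflexivity.
    - rewrite proj_gmap, E2. reflexivity. }
  split; [|split]; apply K; try reflexivity.
  - apply sheet_of_S0; [lra|]. split; [left; apply qd_pole; [lra|apply not_finite_m1]|simpl; lra].
  - apply Gmap_pole, not_finite_m1.
  - apply sheet_of_S2. split; [left; apply qd_pole; [lra|apply not_finite_1]|simpl; lra].
  - apply Gmap_pole, not_finite_1.
Qed.

Lemma off_cut_near_inf k : near (RtoC 0) (fun x => x <> RtoC 0 -> ~ on_cut lam k (Some (/ x)%C)).
Proof.
  assert (Hl := par_lam _ _ _ _ P).
  exists (/ lam). split; [apply Rinv_0_lt_compat; lra|]. intros x Hx H0 Hc.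
  apply (on_cut_bounded lam k _ Hl) in Hc. rewrite Cmod_inv in Hc by assumption.
  replace (x - RtoC 0)%C with x in Hx by ring.
  assert (Hp : 0 < Cmod x) by (apply Cmod_gt_0; assumption).
  apply Rinv_lt_contravar in Hx; [|apply Rmult_lt_0_compat; [assumption|apply Rinv_0_lt_compat; lra]].
  rewrite Rinv_inv in Hx. lra.
Qed.

Lemma chart_inf_lim k (u : nat -> C) : clim u (RtoC 0) ->
  cs_lim (fun n => h (mkpt lam k (crecip (Some (u n))))) (h (mkpt lam k None)).
Proof.
  intro Hu. apply chart_lim; [simpl; tauto|]. rewrite <- crecip_0.
  apply cs_lim_crecip, cs_lim_Some, Hu.
Qed.

Lemma Wrecip_der z : ~ finite_pt z -> exists l, cder (Wrecip a c) z l /\ l <> RtoC 0.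
Proof.
  intro N. assert (Ez : (z * z - RtoC 1)%C = RtoC 0) by (apply NNPP; exact N).
  assert (Hv := crit_val_neq_0 _ _ _ _ P). assert (Hc := par_c _ _ _ _ P).
  assert (H0 : z <> RtoC 0).
  { intros ->. apply (f_equal fst) in Ez. simpl in Ez. lra. }
  assert (Hc0 : RtoC c <> RtoC 0) by (apply RtoC_neq_0; lra).
  assert (H1 : (z * (z * z - RtoC 1 + RtoC c))%C <> RtoC 0).
  { apply Cmult_neq_0; [assumption|]. rewrite Ez. replace (RtoC 0 + RtoC c)%C with (RtoC c) by ring. assumption. }
  match goal with |- exists l, cder _ z l /\ _ => assert (D : exists l, cder (Wrecip a c) z l /\
     l = (RtoC (crit_val a) * RtoC 2 / RtoC c)%C) end.
  { eexists. split.
    - apply cder_mult.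
      + apply cder_mult; [apply cder_const|]. apply cder_minus; [apply cder_mult; apply cder_id|apply cder_const].
      + apply cder_inv; [exact H1|]. apply cder_mult; [apply cder_id|].
        apply cder_plus; [apply cder_minus; [apply cder_mult; apply cder_id|apply cder_const]|apply cder_const].
    - cbv beta. rewrite Ez.
      field; repeat split; assumption. }
  destruct D as [l [D E]]. exists l. split; [exact D|]. rewrite E.
  apply Cmult_neq_0; [|apply Cinv_neq_0, Hc0].
  apply Cmult_neq_0; [assumption|apply RtoC_neq_0; lra].
Qed.

(** Over infinity the coordinate is [1/w], and [Wrecip] takes over the role of [Wmap]: its
    derivative at [1] and [-1] is nonzero because the poles of [G] are simple. Away from [x = 0] the
    map is a finite chart composed with inversion. *)
Lemma chart_mero_pole k z : h (mkpt lam k None) = Some z -> ~ finite_pt z ->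
  holo_near (fun x => h (mkpt lam k (crecip x))) (RtoC 0).
Proof.
  intros Hz N. set (f := fun x => fin (h (mkpt lam k (crecip (Some x))))).
  assert (f0 : f (RtoC 0) = z) by (unfold f; rewrite crecip_0, Hz; reflexivity).
  assert (Cf : ccont f (RtoC 0)).
  { intros v Hv. assert (L := chart_inf_lim k v Hv). rewrite Hz in L. rewrite f0.
    exact (proj1 (cs_lim_finite _ _ L)). }
  assert (Off := off_cut_near_inf k).
  assert (Fs : forall x, (x <> RtoC 0 -> ~ on_cut lam k (Some (/ x)%C)) ->
     h (mkpt lam k (crecip (Some x))) = Some (f x)).
  { intros x Hx. unfold f. destruct (classic (x = RtoC 0)) as [->|H0].
    - rewrite crecip_0, Hz. reflexivity.
    - rewrite crecip_Some by assumption. destruct (chart_spec k _ (Hx H0)) as [E _].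
      rewrite E. reflexivity. }
  apply (holo_near_intro _ _ f). apply (near_imp _ _ _) with (2 := near_near _ _ Off).
  intros x Hx. split; [apply Fs, (near_self _ _ Hx)|].
  destruct (classic (x = RtoC 0)) as [->|H0].
  - assert (G := Gmap_recip_pole _ _ _ _ z P N). rewrite <- f0 in G.
    destruct (near_and _ _ _ Off (near_preimage _ _ _ Cf G)) as [d [Hd Hn]].
    destruct (Wrecip_der z N) as [l [D Hl]]. rewrite <- f0 in D.
    eexists. apply (cder_inverse (Wrecip a c) f (RtoC 0) l d Hd); try assumption.
    intros u Hu. destruct (Hn u Hu) as [O [E _]]. rewrite <- (Fs u O), Gmap_chart, crecip_involutive in E.
    apply (f_equal fin) in E. simpl in E. congruence.
  - destruct (chart_spec k _ (near_self _ _ Hx H0)) as [E D].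
    apply (cdiff_near_ext (fun u => chart k (/ u)%C)).
    + apply (near_imp _ _ _) with (2 := near_neq (fun u => u) x _ (cdiff_id x) H0).
      intros u Hu. unfold f, chart. rewrite crecip_Some by assumption. reflexivity.
    + apply (cdiff_comp (chart k) (fun u => / u)%C); [|exact D].
      apply cdiff_inv; [assumption|apply cdiff_id].
Qed.

Lemma Wrecip_inf_der : exists l, cder (Wrecip_inf a c) (RtoC 0) l /\ l <> RtoC 0.
Proof.
  assert (K2 : (RtoC 1 - RtoC (1 - c) * (RtoC 0 * RtoC 0))%C <> RtoC 0).
  { intro E. apply (f_equal fst) in E. simpl in E. lra. }
  assert (D : exists l, cder (Wrecip_inf a c) (RtoC 0) l /\ l = RtoC (crit_val a)).
  { eexists. split.
    - apply cder_mult.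
      + apply cder_mult; [apply cder_mult; [apply cder_const|apply cder_id]|].
        apply cder_minus; [apply cder_const|apply cder_mult; apply cder_id].
      + apply cder_inv; [exact K2|]. apply cder_minus; [apply cder_const|].
        apply cder_mult; [apply cder_const|apply cder_mult; apply cder_id].
    - cbv beta.
      replace (RtoC 1 - RtoC (1 - c) * (RtoC 0 * RtoC 0))%C with (RtoC 1) by ring.
      field. }
  destruct D as [l [D E]]. exists l. split; [exact D|]. rewrite E. exact (crit_val_neq_0 _ _ _ _ P).
Qed.

Lemma chart_mero_S1 : holo_near (fun x => crecip (h (mkpt lam S1 (crecip x)))) (RtoC 0).
Proof.
  destruct chart_inf as [Hz _].
  set (f := fun x => fin (crecip (h (mkpt lam S1 (crecip (Some x)))))).
  assert (L : forall v, clim v (RtoC 0) ->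
     cs_lim (fun n => crecip (h (mkpt lam S1 (crecip (Some (v n)))))) (Some (RtoC 0))).
  { intros v Hv. assert (L := cs_lim_crecip _ _ (chart_inf_lim S1 v Hv)). rewrite Hz in L. exact L. }
  assert (f0 : f (RtoC 0) = RtoC 0) by (unfold f; rewrite crecip_0, Hz; reflexivity).
  assert (Cf : ccont f (RtoC 0)).
  { intros v Hv. rewrite f0. exact (proj1 (cs_lim_finite _ _ (L v Hv))). }
  (* On sheet 1 the inverse tends to infinity, so its reciprocal is finite near [x = 0]; continuity
     turns this into a neighbourhood. *)
  assert (Fin : near (RtoC 0) (fun x => crecip (h (mkpt lam S1 (crecip (Some x)))) = Some (f x))).
  { destruct (seq_characterization (fun _ x => crecip (h (mkpt lam S1 (crecip (Some x)))) = Some (f x)) (RtoC 0))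
      with (eps := 1) as [d Hd]; [|lra|exists d; exact Hd].
    intros v Hv eps _. destruct (proj2 (cs_lim_finite _ _ (L v Hv))) as [N HN].
    exists N. apply HN. lia. }
  assert (Off := near_and _ _ _ Fin (off_cut_near_inf S1)).
  apply (holo_near_intro _ _ f). apply (near_imp _ _ _) with (2 := near_near _ _ Off).
  intros x Hx. destruct (near_self _ _ Hx) as [E O]. split; [exact E|].
  destruct (classic (x = RtoC 0)) as [->|H0].
  - assert (G := Gmap_recip_inf _ _ _ _ P). rewrite <- f0 in G at 1.
    destruct (near_and _ _ _ Fin (near_preimage _ _ _ Cf G)) as [d [Hd Hn]].
    destruct Wrecip_inf_der as [l [D Hl]]. rewrite <- f0 in D.
    eexists. apply (cder_inverse (Wrecip_inf a c) f (RtoC 0) l d Hd); try assumption.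
    intros u Hu. destruct (Hn u Hu) as [O' [E' _]].
    rewrite <- O', crecip_involutive, Gmap_chart, crecip_involutive in E'.
    apply (f_equal fin) in E'. simpl in E'. congruence.
  - destruct (chart_spec S1 _ (O H0)) as [E1 D1].
    assert (Nz : chart S1 (/ x)%C <> RtoC 0).
    { intro Z. rewrite crecip_Some, E1, Z, crecip_0 in E by assumption. discriminate. }
    assert (Dc : cdiff (fun u => chart S1 (/ u)%C) x).
    { apply (cdiff_comp (chart S1) (fun u => / u)%C); [|exact D1].
      apply cdiff_inv; [assumption|apply cdiff_id]. }
    apply (cdiff_near_ext (fun u => / chart S1 (/ u))%C); [|apply cdiff_inv; assumption].
    apply (near_imp _ _ _) with (2 := near_and _ _ _ Hx (near_and _ _ _ (near_neq (fun u => u) x _ (cdiff_id x) H0)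
       (near_neq _ _ _ Dc Nz))).
    intros u [[Eu Ou] [Hu0 Hu1]]. unfold f. rewrite crecip_Some by assumption.
    destruct (chart_spec S1 _ (Ou Hu0)) as [E2 _]. rewrite E2, crecip_Some by assumption. reflexivity.
Qed.

Lemma chart_mero k w : ~ on_cut lam k w -> mero_at_CS (fun x => h (mkpt lam k x)) w.
Proof.
  intro Hw. destruct w as [z|]; simpl.
  - left. apply (holo_near_intro _ _ (chart k)).
    apply (near_imp _ _ _) with (2 := near_off_cut lam k z Hw). intros u Hu. apply chart_spec, Hu.
  - destruct chart_inf as [H1 [H0 H2]]. destruct k.
    + left. exact (chart_mero_pole S0 _ H0 not_finite_m1).
    + right. exact chart_mero_S1.
    + left. exact (chart_mero_pole S2 _ H2 not_finite_1).
Qed.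
End Charts.

(** * The conformal maps of the surface *)

Lemma m1_factor_neq_0 a : 0 < a -> RtoC ((1 + a ^ 2) / (2 * a ^ 3)) <> RtoC 0.
Proof.
  intro Ha. assert (0 < a ^ 3) by (apply pow_lt, Ha).
  apply RtoC_neq_0, Rgt_not_eq, Rdiv_lt_0_compat; [nra|lra].
Qed.

Lemma m2_factor_neq_0 a : 0 < a < 1 -> RtoC ((1 - a ^ 2) ^ 2 / (8 * a ^ 3)) <> RtoC 0.
Proof.
  intro Ha. assert (0 < a ^ 3) by (apply pow_lt, Ha).
  apply RtoC_neq_0, Rgt_not_eq, Rdiv_lt_0_compat; [apply pow_lt; nra|lra].
Qed.

Lemma m2_Some a z : z <> RtoC 1 ->
  m2 a (Some z) = Some (RtoC ((1 - a ^ 2) ^ 2 / (8 * a ^ 3)) * ((z + RtoC 1) / (z - RtoC 1)))%C.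
Proof.
  intro Hz. unfold m2. destruct (excluded_middle_informative (z = RtoC 1)); [contradiction|reflexivity].
Qed.

Lemma m1_mero a w : 0 < a -> mero_at_CS (m1 a) w.
Proof.
  intro Ha. set (K := RtoC ((1 + a ^ 2) / (2 * a ^ 3))).
  assert (HK : K <> RtoC 0) by (apply m1_factor_neq_0, Ha).
  destruct w as [z|]; simpl.
  - left. apply (holo_near_intro _ _ (fun z => K * (z + RtoC 1))%C). apply near_true.
    intro u. split; [reflexivity|cdiff_tac].
  - right. assert (N1 : (RtoC 1 + RtoC 0)%C <> RtoC 0).
    { replace (RtoC 1 + RtoC 0)%C with (RtoC 1) by ring. apply RtoC_neq_0; lra. }
    apply (holo_near_intro _ _ (fun x => x / (K * (RtoC 1 + x)))%C).
    apply (near_imp _ _ _) with (2 := near_neq (fun x => RtoC 1 + x)%C (RtoC 0) (RtoC 0) ltac:(cdiff_tac) N1).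
    intros x Hx. assert (D : (K * (RtoC 1 + x))%C <> RtoC 0) by (apply Cmult_neq_0; assumption).
    split; [|cdiff_tac; exact D].
    destruct (classic (x = RtoC 0)) as [->|H0].
    + rewrite crecip_0. simpl. f_equal. unfold Cdiv. ring.
    + rewrite (crecip_Some x H0). unfold m1. fold K.
      replace (K * (/ x + RtoC 1))%C with (K * (RtoC 1 + x) / x)%C by (field; assumption).
      apply crecip_div; assumption.
Qed.

Lemma m2_mero a w : 0 < a < 1 -> mero_at_CS (m2 a) w.
Proof.
  intro Ha. set (K := RtoC ((1 - a ^ 2) ^ 2 / (8 * a ^ 3))).
  assert (HK : K <> RtoC 0) by (apply m2_factor_neq_0, Ha).
  assert (Hm := m2_Some a). fold K in Hm.
  destruct w as [z|]; cbn [mero_at_CS].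
  - destruct (classic (z = RtoC 1)) as [->|Hz].
    + right. assert (N1 : (RtoC 1 + RtoC 1)%C <> RtoC 0).
      { intro E. apply (f_equal fst) in E. simpl in E. lra. }
      apply (holo_near_intro _ _ (fun z => (z - RtoC 1) / (K * (z + RtoC 1)))%C).
      apply (near_imp _ _ _) with (2 := near_neq (fun x => x + RtoC 1)%C (RtoC 1) (RtoC 0) ltac:(cdiff_tac) N1).
      intros u Hu. assert (D : (K * (u + RtoC 1))%C <> RtoC 0) by (apply Cmult_neq_0; assumption).
      split; [|cdiff_tac; exact D].
      destruct (classic (u = RtoC 1)) as [->|Hu1].
      * unfold m2. destruct (excluded_middle_informative (RtoC 1 = RtoC 1)) as [_|N]; [|congruence].
        simpl. f_equal. unfold Cdiv. ring.
      * rewrite Hm by assumption. assert (Hd := Cminus_eq_contra _ _ Hu1).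
        replace (K * ((u + RtoC 1) / (u - RtoC 1)))%C with (K * (u + RtoC 1) / (u - RtoC 1))%C
          by (unfold Cdiv; ring).
        apply crecip_div; assumption.
    + left. apply (holo_near_intro _ _ (fun z => K * ((z + RtoC 1) / (z - RtoC 1)))%C).
      apply (near_imp _ _ _) with (2 := near_neq (fun u => u) z _ (cdiff_id z) Hz).
      intros u Hu. split; [apply Hm, Hu|]. cdiff_tac. apply Cminus_eq_contra, Hu.
  - left. assert (N1 : (RtoC 1 - RtoC 0)%C <> RtoC 0).
    { replace (RtoC 1 - RtoC 0)%C with (RtoC 1) by ring. apply RtoC_neq_0; lra. }
    apply (holo_near_intro _ _ (fun x => K * ((RtoC 1 + x) / (RtoC 1 - x)))%C).
    apply (near_imp _ _ _) with (2 := near_neq (fun x => RtoC 1 - x)%C (RtoC 0) (RtoC 0) ltac:(cdiff_tac) N1).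
    intros x Hx. split; [|cdiff_tac; exact Hx].
    destruct (classic (x = RtoC 0)) as [->|H0].
    + rewrite crecip_0. unfold m2. f_equal. fold K. field.
    + rewrite (crecip_Some x H0).
      assert (E1 : (/ x - RtoC 1)%C = ((RtoC 1 - x) / x)%C) by (field; assumption).
      rewrite Hm.
      * f_equal. field. repeat split; try assumption.
      * intro E. apply Hx. replace (RtoC 1 - x)%C with ((/ x - RtoC 1) * x)%C by (field; assumption).
        rewrite E. ring.
Qed.

Lemma m1_bijective a : 0 < a -> exists mi, (forall z, mi (m1 a z) = z) /\ (forall w, m1 a (mi w) = w).
Proof.
  intro Ha. set (K := RtoC ((1 + a ^ 2) / (2 * a ^ 3))).
  assert (HK : K <> RtoC 0) by (apply m1_factor_neq_0, Ha).
  exists (fun w => match w with None => None | Some v => Some (v / K - RtoC 1)%C end).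
  split; intros [z|]; try reflexivity; unfold m1; fold K; f_equal; field; assumption.
Qed.

Lemma m2_bijective a : 0 < a < 1 -> exists mi, (forall z, mi (m2 a z) = z) /\ (forall w, m2 a (mi w) = w).
Proof.
  intro Ha. set (K := RtoC ((1 - a ^ 2) ^ 2 / (8 * a ^ 3))).
  assert (HK : K <> RtoC 0) by (apply m2_factor_neq_0, Ha).
  assert (H2 : RtoC 2 <> RtoC 0) by (apply RtoC_neq_0; lra).
  exists (fun w => match w with None => Some (RtoC 1)
     | Some v => if excluded_middle_informative (v = K) then None else Some ((v + K) / (v - K))%C end).
  split; intros [z|]; unfold m2; fold K.
  - destruct (excluded_middle_informative (z = RtoC 1)) as [->|Hz]; [reflexivity|].
    assert (Hd := Cminus_eq_contra _ _ Hz).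
    assert (ED : (K * ((z + RtoC 1) / (z - RtoC 1)) - K)%C = (K * RtoC 2 / (z - RtoC 1))%C)
      by (field; assumption).
    destruct (excluded_middle_informative _) as [E|_].
    + exfalso. assert (Z : (K * RtoC 2)%C = RtoC 0).
      { replace (K * RtoC 2)%C with (K * RtoC 2 / (z - RtoC 1) * (z - RtoC 1))%C by (field; assumption).
        rewrite <- ED, E. ring. }
      revert Z. apply Cmult_neq_0; assumption.
    + f_equal. rewrite ED. field; repeat split; assumption.
  - destruct (excluded_middle_informative (K = K)); [reflexivity|congruence].
  - destruct (excluded_middle_informative (z = K)) as [->|Hz]; [reflexivity|].
    assert (Hd := Cminus_eq_contra _ _ Hz).
    assert (ED : ((z + K) / (z - K) - RtoC 1)%C = (K * RtoC 2 / (z - K))%C)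
      by (field; assumption).
    destruct (excluded_middle_informative _) as [E|_].
    + exfalso. assert (Z : (K * RtoC 2)%C = RtoC 0).
      { replace (K * RtoC 2)%C with (K * RtoC 2 / (z - K) * (z - K))%C by (field; assumption).
        rewrite <- ED, E. ring. }
      revert Z. apply Cmult_neq_0; assumption.
    + f_equal. rewrite ED. field; repeat split; assumption.
  - destruct (excluded_middle_informative (RtoC 1 = RtoC 1)); [reflexivity|congruence].
Qed.

Section Asymptotics.
Variables (lam a b c : R) (h : RS lam -> CS).
Hypothesis P : params lam a b c.
Hypothesis Hgh : forall p, gmap lam a c (h p) = p.
Hypothesis Hhg : forall z, h (gmap lam a c z) = z.
Hypothesis Hcont : cont_RC lam h.

(** Converts the sequential continuity of [h] at infinity of a sheet into a threshold [M], the form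
    in which [is_psi] states its asymptotics. *)
Lemma chart_nbhd_inf k V : cs_nbhd (h (mkpt lam k None)) V -> exists M, forall w, M < Cmod w ->
  exists z, h (mkpt lam k (Some w)) = Some z /\ finite_pt z /\ Wmap a c z = w /\ V (Some z).
Proof.
  intro HV. apply NNPP. intro Hn.
  assert (K : forall n : nat, exists w, INR n < Cmod w /\ lam < Cmod w /\ ~ V (h (mkpt lam k (Some w)))).
  { intro n. apply NNPP. intro Hc. apply Hn. exists (Rmax (INR n) lam). intros w Hw.
    assert (W1 := Rmax_l (INR n) lam). assert (W2 := Rmax_r (INR n) lam).
    assert (Off : ~ on_cut lam k (Some w)).
    { intro H. apply (on_cut_bounded lam k w (par_lam _ _ _ _ P)) in H. lra. }
    destruct (chart_finite lam a b c h P Hgh k w Off) as [z [E [F [EW _]]]].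
    exists z. repeat split; try assumption. apply NNPP. intro NV. apply Hc. exists w.
    rewrite E. repeat split; try assumption; lra. }
  apply choice in K. destruct K as [u Hu].
  assert (L : cs_lim (fun n => Some (u n)) None).
  { intro M. destruct (INR_unbounded M) as [N HN]. exists N. intros n Hn'. right. exists (u n).
    split; [reflexivity|]. destruct (Hu n) as [H _]. apply le_INR in Hn'. lra. }
  assert (L' := chart_lim lam a b c h P Hcont k _ None (fun H => H) L).
  destruct (proj1 (cs_lim_nbhd _ _) L' V HV) as [N HN].
  apply (proj2 (proj2 (Hu N))). apply HN. lia.
Qed.

(** Removes the pole at [-1], the point of the sphere corresponding to infinity on sheet 0. *)
Lemma Hmap_factor z : finite_pt z ->
  ((z + RtoC 1) * Hmap c z)%C = (z * (z * z - RtoC 1 + RtoC c) / (z - RtoC 1))%C.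
Proof.
  intro F. assert (F' := F). apply finite_pt_iff in F'. destruct F' as [H1 H2].
  assert (Hd := Cminus_eq_contra _ _ H1).
  assert (Hs : (z + RtoC 1)%C <> RtoC 0).
  { intro E. apply H2. replace z with (z + RtoC 1 - RtoC 1)%C by ring. rewrite E.
    apply injective_projections; simpl; ring. }
  unfold Hmap. unfold finite_pt in F.
  replace (z * z - RtoC 1)%C with ((z - RtoC 1) * (z + RtoC 1))%C by ring.
  field. split; assumption.
Qed.

(* Near [z = -1] put [w = A(z)/(z+1)] and [v = (z+1) B(z)]: then [v w = A B] is differentiable at [-1],
   so [w (v w - C1)] stays bounded, where [C1 = (A B)(-1)]. *)
Lemma decay_at_inf0 (m : CS -> CS) (B : C -> C) :
  cdiff B (RtoC (-1)) ->
  near (RtoC (-1)) (fun z => m (Some z) = Some ((z + RtoC 1) * B z)%C) ->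
  exists C1 M K, forall w, M < Cmod w ->
     exists v, m (h (mkpt lam S0 (Some w))) = Some v /\
       Cmod (Cminus v (Cdiv C1 w)) <= K / (Cmod w ^ 2).
Proof.
  intros HB Hm. set (o := RtoC (-1)).
  set (A := fun z => (z * (z * z - RtoC 1 + RtoC c) / (z - RtoC 1) / RtoC (crit_val a))%C).
  assert (Hv := crit_val_neq_0 _ _ _ _ P).
  assert (Ho : (o - RtoC 1)%C <> RtoC 0).
  { intro E. apply (f_equal fst) in E. simpl in E. lra. }
  assert (HA : cdiff A o) by (unfold A; cdiff_tac; assumption).
  assert (HQ : cdiff (fun z => A z * B z)%C o) by (apply cdiff_mult; assumption).
  destruct HQ as [l [phi [Cphi [_ Ephi]]]].
  set (T := fun z => (A z * phi z)%C).
  assert (CT : ccont T o) by (apply ccont_mult; [apply cdiff_ccont, HA|exact Cphi]).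
  destruct (proj1 (ccont_eps T o) CT 1 Rlt_0_1) as [d [Hd HT]].
  destruct (near_and _ _ _ (ex_intro _ d (conj Hd HT)) Hm) as [e [He Hn]].
  destruct (chart_inf lam a b c h P Hhg) as [_ [H0 _]].
  destruct (chart_nbhd_inf S0 (fun w => match w with Some z => Cmod (z - o)%C < e | None => False end)) as [M HM].
  { rewrite H0. exists e. split; [assumption|]. intros v H; exact H. }
  exists (A o * B o)%C, (Rmax M 0), (Cmod (T o) + 1). intros w Hw.
  assert (M1 := Rmax_l M 0). assert (M2 := Rmax_r M 0).
  destruct (HM w ltac:(lra)) as [z [E [F [EW Hz]]]]. destruct (Hn z Hz) as [Tz Ez].
  exists ((z + RtoC 1) * B z)%C. rewrite E. split; [exact Ez|].
  assert (Hw0 : w <> RtoC 0) by (intros ->; rewrite Cmod_0 in Hw; lra).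
  assert (Ew : ((z + RtoC 1) * w)%C = A z).
  { rewrite <- EW. unfold Wmap, A. rewrite <- Hmap_factor by assumption. field. assumption. }
  assert (Key : ((z + RtoC 1) * B z - A o * B o / w)%C = (T z / (w * w))%C).
  { assert (Eo : (z - o)%C = (z + RtoC 1)%C) by (unfold o; apply injective_projections; simpl; ring).
    specialize (Ephi z). cbv beta in Ephi. rewrite Eo in Ephi.
    unfold T. rewrite <- Ew.
    replace (A o * B o)%C with (A z * B z - phi z * (z + RtoC 1))%C by (rewrite Ephi; ring).
    rewrite <- Ew. field. assumption. }
  rewrite Key, Cmod_div, Cmod_mult by (apply Cmult_neq_0; assumption).
  assert (Pw : 0 < Cmod w) by (apply Cmod_gt_0; assumption).
  replace (Cmod w ^ 2) with (Cmod w * Cmod w) by ring.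
  apply Rmult_le_compat_r; [left; apply Rinv_0_lt_compat; nra|].
  assert (Tr := Cmod_triangle (T z - T o)%C (T o)).
  replace (T z - T o + T o)%C with (T z) in Tr by ring. lra.
Qed.

(** The part common to both Moebius maps. [B] is the cofactor of the zero of [m] at [-1], which
    gives the decay on sheet 0; [V] is a neighbourhood of the point corresponding to infinity on
    sheet [l] in which [m - G] is bounded by [K]. *)
Lemma is_psi_intro (l : sheet) (m mi : CS -> CS) (B : C -> C) (V : CS -> Prop) (K : R) (psi : RS lam -> CS) :
  (forall w, mero_at_CS m w) -> (forall z, mi (m z) = z) -> (forall w, m (mi w) = w) ->
  cdiff B (RtoC (-1)) ->
  near (RtoC (-1)) (fun z => m (Some z) = Some ((z + RtoC 1) * B z)%C) ->
  cs_nbhd (h (mkpt lam l None)) V ->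
  (forall z, finite_pt z -> V (Some z) -> exists v, m (Some z) = Some v /\ Cmod (v - Wmap a c z)%C <= K) ->
  (forall z, psi (gmap lam a c z) = m z) -> is_psi lam l psi.
Proof.
  intros Hm Hmi1 Hmi2 HB Hm0 HV HK Hpsi.
  assert (Epsi : forall p, psi p = m (h p)) by (intro p; rewrite <- Hpsi, Hgh; reflexivity).
  split; [split; [|split]|split].
  - exists (fun w => gmap lam a c (mi w)). split.
    + intro p. rewrite Epsi, Hmi1. apply Hgh.
    + intro w. rewrite Hpsi. apply Hmi2.
  - intros u q Hu. rewrite Epsi. apply (cs_lim_ext_loc (fun n => m (h (u n)))).
    + exists O. intros n _. rewrite Epsi. reflexivity.
    + apply (mero_at_CS_cont m (h q) (fun n => h (u n)) (Hm (h q))). apply Hcont, Hu.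
  - intros k w Hw.
    apply (mero_at_CS_ext (fun x => m (h (mkpt lam k x)))); [intro; symmetry; apply Epsi|].
    apply (mero_at_CS_comp m (fun x => h (mkpt lam k x))); [exact Hm|].
    apply (chart_mero lam a b c h); assumption.
  - destruct (chart_nbhd_inf l V HV) as [M HM]. exists M, K. intros w Hw.
    destruct (HM w Hw) as [z [E [F [EW Vz]]]]. rewrite Epsi, E.
    destruct (HK z F Vz) as [v [Ev Hv]]. exists v. rewrite EW in Hv. split; assumption.
  - destruct (decay_at_inf0 m B HB Hm0) as [C1 [M [K0 H]]]. exists C1, M, K0. intros w Hw.
    rewrite Epsi. exact (H w Hw).
Qed.

(** Infinity on sheet 1 corresponds to infinity of the sphere, where [G(z)] behaves like [z / H(a)];
    this fixes the leading coefficient of [m1]. *)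
Lemma m1_factor_eq : RtoC ((1 + a ^ 2) / (2 * a ^ 3)) = (/ RtoC (crit_val a))%C.
Proof.
  assert (Hv := crit_val_pos _ _ _ _ P). assert (Ha := par_a _ _ _ _ P).
  rewrite <- RtoC_inv by lra. f_equal. unfold crit_val. field. split; nra.
Qed.

(** Infinity on sheet 2 corresponds to [z = 1], where [G] has residue [c / (2 H(a))]. The map [m2]
    has twice its prefactor as residue there, so the prefactor must be half of this. *)
Lemma m2_factor_eq : RtoC ((1 - a ^ 2) ^ 2 / (8 * a ^ 3)) = (RtoC c / (RtoC 4 * RtoC (crit_val a)))%C.
Proof.
  assert (Hv := crit_val_pos _ _ _ _ P). assert (Ha := par_a _ _ _ _ P).
  rewrite <- RtoC_mult, <- RtoC_div by lra. f_equal. rewrite (par_c_eq _ _ _ _ P).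
  unfold crit_val. field. split; nra.
Qed.

Lemma is_psi_m1 psi : (forall z, psi (gmap lam a c z) = m1 a z) -> is_psi lam S1 psi.
Proof.
  intro Hpsi. assert (Ha := par_a _ _ _ _ P). assert (Hc := par_c _ _ _ _ P).
  assert (Hv := crit_val_neq_0 _ _ _ _ P).
  destruct (m1_bijective a ltac:(lra)) as [mi [Hmi1 Hmi2]].
  apply (is_psi_intro S1 (m1 a) mi (fun _ => RtoC ((1 + a ^ 2) / (2 * a ^ 3)))
    (fun w => match w with Some z => 2 < Cmod z | None => True end)
    (Cmod (/ RtoC (crit_val a))%C * 2) psi); try assumption.
  - intro w. apply m1_mero. lra.
  - apply cdiff_const.
  - apply near_true. intro z. simpl. f_equal. ring.
  - destruct (chart_inf lam a b c h P Hhg) as [H1 _]. rewrite H1. exists 2. auto.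
  - intros z F Hz. eexists. split; [reflexivity|]. rewrite m1_factor_eq. unfold Wmap, Hmap.
    replace (/ RtoC (crit_val a) * (z + RtoC 1) - (z + RtoC c * z / (z * z - RtoC 1)) / RtoC (crit_val a))%C
      with (/ RtoC (crit_val a) * (RtoC 1 - RtoC c * z / (z * z - RtoC 1)))%C
      by (field; split; assumption).
    rewrite Cmod_mult. apply Rmult_le_compat_l; [apply Cmod_ge_0|].
    assert (T1 : Cmod (RtoC 1 - RtoC c * z / (z * z - RtoC 1))%C <= 1 + Cmod (RtoC c * z / (z * z - RtoC 1))%C).
    { unfold Cminus at 1. eapply Rle_trans; [apply Cmod_triangle|]. rewrite Cmod_opp, Cmod_1. lra. }
    rewrite Cmod_div, Cmod_mult, Cmod_R, (Rabs_pos_eq c) in T1 by (assumption || lra).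
    assert (T2 := Cmod_triangle (z * z - RtoC 1)%C (RtoC 1)).
    replace (z * z - RtoC 1 + RtoC 1)%C with (z * z)%C in T2 by ring.
    rewrite Cmod_mult, Cmod_1 in T2.
    (* For [|z| > 2] one has [|z^2-1| >= |z|^2 - 1 > |z|], and [c < 1]. *)
    assert (T3 : c * Cmod z / Cmod (z * z - RtoC 1)%C <= 1).
    { apply (Rmult_le_reg_r (Cmod (z * z - RtoC 1)%C)); [nra|].
      unfold Rdiv. rewrite Rmult_assoc, Rinv_l by nra. nra. }
    lra.
Qed.

Lemma is_psi_m2 psi : (forall z, psi (gmap lam a c z) = m2 a z) -> is_psi lam S2 psi.
Proof.
  intro Hpsi. assert (Ha := par_a _ _ _ _ P). assert (Hc := par_c _ _ _ _ P).
  assert (Hv := crit_val_neq_0 _ _ _ _ P).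
  destruct (m2_bijective a ltac:(lra)) as [mi [Hmi1 Hmi2]].
  set (K := RtoC ((1 - a ^ 2) ^ 2 / (8 * a ^ 3))).
  assert (Hm := m2_Some a). fold K in Hm.
  assert (N1 : RtoC (-1) <> RtoC 1) by (intro E; injection E; lra).
  apply (is_psi_intro S2 (m2 a) mi (fun z => K / (z - RtoC 1))%C
    (fun w => match w with Some z => Cmod (z - RtoC 1)%C < 1 | None => True end)
    (Cmod K + Cmod (/ RtoC (crit_val a))%C * 2) psi); try assumption.
  - intro w. apply m2_mero. lra.
  - cdiff_tac. apply Cminus_eq_contra, N1.
  - apply (near_imp _ _ _) with (2 := near_neq (fun u => u) (RtoC (-1)) _ (cdiff_id _) N1).
    intros u Hu. rewrite Hm by assumption. f_equal. field. apply Cminus_eq_contra, Hu.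
  - destruct (chart_inf lam a b c h P Hhg) as [_ [_ H2]]. rewrite H2. exists 1. split; [lra|]. auto.
  - intros z F Hz. assert (F' := F). apply finite_pt_iff in F'. destruct F' as [H1 H2].
    assert (Hd := Cminus_eq_contra _ _ H1).
    assert (T2 : 1 < Cmod (z + RtoC 1)%C).
    { assert (T := Cmod_triangle (z + RtoC 1)%C (- (z - RtoC 1))%C). rewrite Cmod_opp in T.
      replace (z + RtoC 1 + - (z - RtoC 1))%C with (RtoC 2) in T by (apply injective_projections; simpl; ring).
      rewrite Cmod_R, Rabs_pos_eq in T by lra. lra. }
    assert (Hs : (z + RtoC 1)%C <> RtoC 0) by (intro E; rewrite E, Cmod_0 in T2; lra).
    assert (T3 : Cmod z <= 2).
    { assert (T := Cmod_triangle (z - RtoC 1)%C (RtoC 1)).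
      replace (z - RtoC 1 + RtoC 1)%C with z in T by ring. rewrite Cmod_1 in T. lra. }
    eexists. split; [apply Hm, H1|].
    (* With [c = 4 K H(a)] the pole at [1] cancels through [(z+1)^2 - 4 z = (z-1)^2], leaving a
       function bounded near [1]. *)
    assert (E : (K * ((z + RtoC 1) / (z - RtoC 1)) - Wmap a c z)%C =
      (K * ((z - RtoC 1) / (z + RtoC 1)) + - (/ RtoC (crit_val a) * z))%C).
    { assert (Ec : RtoC c = (RtoC 4 * RtoC (crit_val a) * K)%C).
      { unfold K. rewrite m2_factor_eq. field. assumption. }
      unfold Wmap, Hmap. rewrite Ec.
      replace (z * z - RtoC 1)%C with ((z - RtoC 1) * (z + RtoC 1))%C by ring.
      field. repeat split; assumption. }
    rewrite E. eapply Rle_trans; [apply Cmod_triangle|]. rewrite Cmod_opp, !Cmod_mult.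
    apply Rplus_le_compat.
    + rewrite <- (Rmult_1_r (Cmod K)) at 2. apply Rmult_le_compat_l; [apply Cmod_ge_0|].
      rewrite Cmod_div by assumption.
      apply (Rmult_le_reg_r (Cmod (z + RtoC 1)%C)); [lra|].
      unfold Rdiv. rewrite Rmult_assoc, Rinv_l by lra. lra.
    + apply Rmult_le_compat_l; [apply Cmod_ge_0|exact T3].
Qed.
End Asymptotics.

(** * Uniqueness of the conformal maps *)

Lemma holo_near_cdiff F f z : holo_near F z -> (forall u, F (Some u) = Some (f u)) -> cdiff f z.
Proof.
  intros H E. apply holo_near_elim in H. destruct H as [F0 H].
  apply (cdiff_near_ext F0); [|exact (proj2 (near_self _ _ H))].
  apply (near_imp _ _ _) with (2 := H). intros u [E' _]. rewrite E in E'.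
  apply (f_equal fin) in E'. symmetry. exact E'.
Qed.

(** A meromorphic map with finite values is differentiable: in the chart at infinity its reciprocal
    is differentiable and cannot vanish, so it can be inverted back. *)
Lemma mero_at_cdiff F f z : mero_at F z -> (forall u, F (Some u) = Some (f u)) -> cdiff f z.
Proof.
  intros [H|H] E; [exact (holo_near_cdiff F f z H E)|].
  apply holo_near_elim in H. destruct H as [F0 H].
  assert (K : near z (fun u => (f u <> RtoC 0 /\ F0 u = / f u)%C)).
  { apply (near_imp _ _ _) with (2 := H). intros u [E' _]. rewrite E in E'.
    destruct (classic (f u = RtoC 0)) as [Z|Z].
    - rewrite Z, crecip_0 in E'. discriminate.
    - rewrite crecip_Some in E' by assumption. split; [assumption|].
      apply (f_equal fin) in E'. symmetry. exact E'. }
  destruct (near_self _ _ K) as [Z EZ].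
  apply (cdiff_near_ext (fun u => / F0 u)%C).
  - apply (near_imp _ _ _) with (2 := K). intros u [Zu Eu]. rewrite Eu. field. assumption.
  - apply cdiff_inv; [|exact (proj2 (near_self _ _ H))]. rewrite EZ.
    apply Cinv_neq_0, Z.
Qed.

Lemma Rabs_Cmod_minus x y : Rabs (Cmod x - Cmod y) <= Cmod (x - y)%C.
Proof.
  assert (T1 := Cmod_triangle (x - y)%C y). replace (x - y + y)%C with x in T1 by ring.
  assert (T2 := Cmod_triangle (- (x - y))%C x). rewrite Cmod_opp in T2.
  replace (- (x - y) + x)%C with y in T2 by ring. apply Rabs_le. lra.
Qed.

(** Along a segment from [z] to [w] the distance of [E] to [E z] takes every value from [0] to its
    final value, by the intermediate value theorem, whereas only three values are possible. Four
    intermediate ones give the contradiction. *)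
Lemma three_values_constant (E : C -> C) (d0 d1 d2 : C) : (forall z, ccont E z) ->
  (forall z, ((d0 - E z) * (d1 - E z) * (d2 - E z))%C = RtoC 0) -> forall z w, E z = E w.
Proof.
  intros HE HP z w. apply NNPP. intro Hne.
  set (f := fun t => Cmod (E (z + RtoC t * (w - z)) - E z)%C).
  assert (Cf : continuity f).
  { intro t. apply continuity_pt_filterlim. apply filterlim_locally. intro eps.
    destruct (proj1 (ccont_eps _ _) (HE (z + RtoC t * (w - z))%C) eps (cond_pos eps)) as [d [Hd H]].
    set (r := Cmod (w - z)%C). assert (Hr : 0 <= r) by apply Cmod_ge_0.
    assert (Hd' : 0 < d / (r + 1)) by (apply Rdiv_lt_0_compat; lra).
    exists (mkposreal _ Hd'). intros s Hs. change (Rabs (s - t) < d / (r + 1)) in Hs.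
    change (Rabs (f s - f t) < eps).
    eapply Rle_lt_trans; [|apply (H (z + RtoC s * (w - z))%C)].
    - unfold f. eapply Rle_trans; [apply Rabs_Cmod_minus|]. right. f_equal. ring.
    - replace (z + RtoC s * (w - z) - (z + RtoC t * (w - z)))%C with (RtoC (s - t) * (w - z))%C
        by (rewrite RtoC_minus; ring).
      rewrite Cmod_mult, Cmod_R. fold r.
      apply (Rmult_lt_compat_r (r + 1)) in Hs; [|lra].
      unfold Rdiv in Hs. rewrite Rmult_assoc, Rinv_l in Hs by lra.
      generalize (Rabs_pos (s - t)). nra. }
  assert (f0 : f 0 = 0).
  { unfold f. replace (z + RtoC 0 * (w - z))%C with z by ring.
    replace (E z - E z)%C with (RtoC 0) by ring. apply Cmod_0. }
  assert (f1 : 0 < f 1).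
  { unfold f. replace (z + RtoC 1 * (w - z))%C with w by ring.
    apply Cmod_gt_0, Cminus_eq_contra. auto. }
  assert (V : forall v, 0 <= v <= f 1 ->
     v = Cmod (d0 - E z)%C \/ v = Cmod (d1 - E z)%C \/ v = Cmod (d2 - E z)%C).
  { intros v Hv. destruct (IVT_gen f 0 1 v Cf) as [t [_ Et]].
    { rewrite f0, Rmin_left, Rmax_right by lra. exact Hv. }
    assert (HPt := HP (z + RtoC t * (w - z))%C). unfold f in Et.
    set (e := E (z + RtoC t * (w - z))%C) in *.
    assert (K : d0 = e \/ d1 = e \/ d2 = e).
    { apply NNPP. intro N. revert HPt.
      apply Cmult_neq_0; [apply Cmult_neq_0|]; apply Cminus_eq_contra; tauto. }
    destruct K as [K|[K|K]]; rewrite <- K in Et; auto. }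
  assert (V1 := V (f 1 * (1 / 5)) ltac:(lra)). assert (V2 := V (f 1 * (2 / 5)) ltac:(lra)).
  assert (V3 := V (f 1 * (3 / 5)) ltac:(lra)). assert (V4 := V (f 1 * (4 / 5)) ltac:(lra)).
  destruct V1 as [V1|[V1|V1]]; destruct V2 as [V2|[V2|V2]]; try lra;
  destruct V3 as [V3|[V3|V3]]; try lra; destruct V4 as [V4|[V4|V4]]; lra.
Qed.

Lemma near_isolated (w : C) (r : R) : near w (fun u => u = w \/ u <> RtoC r).
Proof.
  destruct (classic (w = RtoC r)) as [-> | H].
  - apply near_true. intro u. apply classic.
  - apply (near_imp _ _ _) with (2 := near_neq (fun u => u) w _ (cdiff_id w) H). auto.
Qed.

Lemma near_not_branch lam (w : C) :
  near w (fun u => u = w \/ (~ branch1 lam u /\ ~ branch2 lam u)).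
Proof.
  apply (near_imp _ _ _) with (2 := near_and _ _ _
    (near_and _ _ _ (near_isolated w (- lam)) (near_isolated w (-1)))
    (near_and _ _ _ (near_isolated w 1) (near_isolated w lam))).
  intros u. unfold branch1, branch2. tauto.
Qed.

(* The sheets over a moving base point can be relabelled so that all three lifts are continuous. *)
Lemma lift_relabel lam (v : nat -> C) (w : C) : 1 < lam -> clim v w ->
  exists sigma : nat -> sheet -> sheet,
    (forall n, sigma n = (fun k => k) \/ sigma n = swap01 \/ sigma n = swap12) /\
    forall k, rs_lim lam (fun n => mkpt lam (sigma n k) (Some (v n))) (mkpt lam k (Some w)).
Proof.
  intros Hl Hv.
  exists (fun n => if Rle_dec 0 (snd (v n)) then (fun k => k)
     else if excluded_middle_informative (intD1 lam w) then swap01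
     else if excluded_middle_informative (intD2 lam w) then swap12 else (fun k => k)).
  split.
  { intro n. destruct (Rle_dec 0 (snd (v n))); [auto|].
    destruct (excluded_middle_informative (intD1 lam w)); [auto|].
    destruct (excluded_middle_informative (intD2 lam w)); auto. }
  (* Close to [w] the only possible branch point is [w] itself, so [canon] can change the sheet over
     [v n] only when [v n = w]. *)
  destruct (near_clim _ _ _ (near_not_branch lam w) Hv) as [N HN].
  intro k. split; [apply cs_lim_Some, Hv|]. exists N. intros n Hn. specialize (HN n Hn).
  unfold mkpt. cbn [proj1_sig]. set (u := v n) in *. clearbody u.
  assert (X12 : intD1 lam w -> ~ intD2 lam w) by (unfold intD1, intD2; lra).
  assert (XB : intD1 lam w \/ intD2 lam w -> ~ branch1 lam w /\ ~ branch2 lam w).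
  { intro I. split; intro B; destruct (branch_not_int lam w Hl); tauto. }
  assert (X34 : branch1 lam w -> ~ branch2 lam w).
  { unfold branch1, branch2. intros [-> | ->] [E|E]; injection E; lra. }
  assert (NB : ~ branch1 lam w -> ~ branch2 lam w -> ~ branch1 lam u /\ ~ branch2 lam u).
  { intros. destruct HN as [-> | HN]; tauto. }
  unfold allowed, canon.
  destruct (classic (branch1 lam w \/ branch2 lam w)) as [B|B].
  - assert (I1 : ~ intD1 lam w) by tauto. assert (I2 : ~ intD2 lam w) by tauto.
    assert (NBu : branch1 lam w -> ~ branch2 lam u) by (destruct HN as [-> | HN]; tauto).
    assert (NBu' : branch2 lam w -> ~ branch1 lam u) by (destruct HN as [-> | HN]; tauto).
    clear NB XB X12 HN.
    destruct (Rle_dec 0 (snd u)); destruct k; decide_em; congruence.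
  - destruct (NB ltac:(tauto) ltac:(tauto)) as [U1 U2].
    assert (W1 : ~ branch1 lam w) by tauto. assert (W2 : ~ branch2 lam w) by tauto.
    clear NB XB X34 HN B.
    destruct (Rle_dec 0 (snd u)); destruct k; decide_em; reflexivity.
Qed.

Lemma cs_lim_INR : cs_lim (fun n => Some (RtoC (INR n))) None.
Proof.
  intro M. destruct (INR_unbounded M) as [N HN]. exists N. intros n Hn. right.
  exists (RtoC (INR n)). split; [reflexivity|]. rewrite Cmod_R, Rabs_pos_eq by apply pos_INR.
  apply le_INR in Hn. lra.
Qed.

Lemma INR_eventually M : exists N, forall n, (N <= n)%nat -> M < Cmod (RtoC (INR n)).
Proof.
  destruct (INR_unbounded M) as [N HN]. exists N. intros n Hn.
  rewrite Cmod_R, Rabs_pos_eq by apply pos_INR. apply le_INR in Hn. lra.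
Qed.

(** The asymptotics in [is_psi] speak of finite points only; the value at infinity follows from
    continuity, tested along the integers. *)
Lemma is_psi_pole lam l psi : 1 < lam -> is_psi lam l psi -> psi (mkpt lam l None) = None.
Proof.
  intros Hl [[_ [Hc _]] [[M [K HK]] _]].
  assert (L := Hc _ _ (mkpt_lim lam l _ None Hl (fun H => H) cs_lim_INR)).
  refine (cs_lim_unique _ _ _ L _).
  intro M'. destruct (INR_eventually (Rmax M (M' + K))) as [N HN]. exists N. intros n Hn. right.
  assert (M1 := Rmax_l M (M' + K)). assert (M2 := Rmax_r M (M' + K)). specialize (HN n Hn).
  destruct (HK (RtoC (INR n)) ltac:(lra)) as [v [E Hv]]. exists v. split; [exact E|].
  assert (T := Cmod_triangle v (RtoC (INR n) - v)%C).
  replace (v + (RtoC (INR n) - v))%C with (RtoC (INR n)) in T by ring.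
  rewrite <- (Cmod_opp (RtoC (INR n) - v)%C) in T.
  replace (- (RtoC (INR n) - v))%C with (v - RtoC (INR n))%C in T by ring. lra.
Qed.

Lemma is_psi_zero lam l psi : 1 < lam -> is_psi lam l psi -> psi (mkpt lam S0 None) = Some (RtoC 0).
Proof.
  intros Hl [[_ [Hc _]] [_ [C1 [M [K HK]]]]].
  assert (L := Hc _ _ (mkpt_lim lam S0 _ None Hl (fun H => H) cs_lim_INR)).
  refine (cs_lim_unique _ _ _ L _).
  intros eps He. set (r := (Cmod C1 + Rabs K) / eps).
  destruct (INR_eventually (Rmax (Rmax M 1) r)) as [N HN]. exists N. intros n Hn.
  specialize (HN n Hn). set (w := RtoC (INR n)) in *.
  assert (M1 := Rmax_l (Rmax M 1) r). assert (M2 := Rmax_r (Rmax M 1) r).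
  assert (M3 := Rmax_l M 1). assert (M4 := Rmax_r M 1).
  destruct (HK w ltac:(lra)) as [v [E Hv]]. exists v. split; [exact E|].
  replace (v - RtoC 0)%C with ((v - C1 / w) + C1 / w)%C by ring.
  eapply Rle_lt_trans; [apply Cmod_triangle|].
  assert (Hw : 1 < Cmod w) by lra.
  assert (Hw0 : w <> RtoC 0) by (intro Z; rewrite Z, Cmod_0 in Hw; lra).
  rewrite Cmod_div by assumption.
  assert (B : K / Cmod w ^ 2 <= Rabs K / Cmod w).
  { apply Rle_trans with (Rabs K / Cmod w ^ 2).
    - apply Rmult_le_compat_r; [left; apply Rinv_0_lt_compat; nra|apply Rle_abs].
    - apply Rmult_le_compat_l; [apply Rabs_pos|]. apply Rinv_le_contravar; nra. }
  apply Rle_lt_trans with ((Cmod C1 + Rabs K) / Cmod w).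
  { unfold Rdiv in *. rewrite Rmult_plus_distr_r. lra. }
  apply (Rmult_lt_reg_r (Cmod w)); [lra|].
  unfold Rdiv. rewrite Rmult_assoc, Rinv_l, Rmult_1_r by lra.
  assert (Hr : r < Cmod w) by lra. unfold r in Hr.
  apply (Rmult_lt_compat_r eps) in Hr; [|assumption].
  unfold Rdiv in Hr. rewrite Rmult_assoc, Rinv_l, Rmult_1_r in Hr by lra. lra.
Qed.

Lemma is_psi_finite lam l psi p : 1 < lam -> is_psi lam l psi -> p <> mkpt lam l None ->
  psi p = Some (fin (psi p)).
Proof.
  intros Hl H Hp. assert (E := is_psi_pole lam l psi Hl H).
  destruct H as [[[hi [Hi _]] _] _].
  destruct (psi p) as [v|] eqn:Ep; [reflexivity|]. exfalso. apply Hp.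
  rewrite <- (Hi p), <- (Hi (mkpt lam l None)), Ep, E. reflexivity.
Qed.

Lemma mkpt_Some_neq lam k l w : mkpt lam k (Some w) <> mkpt lam l None.
Proof. intro E. apply (f_equal (proj lam)) in E. discriminate. Qed.

Lemma mkpt_None_neq lam k l : k <> l -> mkpt lam k None <> mkpt lam l None.
Proof.
  intros H E. apply (f_equal (rs_sheet lam)) in E. unfold rs_sheet, mkpt in E. simpl in E.
  destruct k, l; simpl in E; congruence.
Qed.

Lemma RS_mkpt lam p : p = mkpt lam (rs_sheet lam p) (proj lam p).
Proof.
  destruct p as [[k w] Hp]. apply RS_ext; [|reflexivity]. unfold rs_sheet, mkpt, proj; simpl in *.
  symmetry. exact Hp.
Qed.

Section Uniqueness.
Variables (lam : R) (l : sheet) (psi phi : RS lam -> CS) (phi' : CS -> RS lam).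
Hypothesis Hl : 1 < lam.
Hypothesis Hpsi : is_psi lam l psi.
Hypothesis Hphi : is_psi lam l phi.
Hypothesis Hphi' : forall w, phi (phi' w) = w.
Hypothesis Hphi'' : forall p, phi' (phi p) = p.
Hypothesis Hphi'c : cont_CR lam phi'.
Hypothesis Hl0 : l <> S0.

(** At [inf] both maps are infinite and [D] is a mere default value; that point is treated
    separately. *)
Let D (p : RS lam) : C := (fin (psi p) - fin (phi p))%C.
Let inf := mkpt lam l None.

Lemma diff_cont u q : q <> inf -> rs_lim lam u q -> clim (fun n => D (u n)) (D q).
Proof.
  intros Hq Hu. unfold D.
  assert (K : forall f, is_psi lam l f -> clim (fun n => fin (f (u n))) (fin (f q))).
  { intros f Hf. assert (E := is_psi_finite lam l f q Hl Hf Hq).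
    destruct Hf as [[_ [Hc _]] _]. assert (L := Hc u q Hu). rewrite E in L.
    exact (proj1 (cs_lim_finite _ _ L)). }
  apply clim_minus; apply K; assumption.
Qed.

(** On sheet [l] the poles cancel because both maps are [w + O(1)]; on the other sheets [D] is
    continuous at the point over infinity. *)
Lemma diff_bounded_far k : exists M B, forall w, M < Cmod w -> Cmod (D (mkpt lam k (Some w))) <= B.
Proof.
  destruct (classic (k = l)) as [->|Hk].
  - destruct Hpsi as [_ [[M1 [K1 H1]] _]]. destruct Hphi as [_ [[M2 [K2 H2]] _]].
    exists (Rmax M1 M2), (K1 + K2). intros w Hw.
    assert (A1 := Rmax_l M1 M2). assert (A2 := Rmax_r M1 M2).
    destruct (H1 w ltac:(lra)) as [v1 [E1 B1]]. destruct (H2 w ltac:(lra)) as [v2 [E2 B2]].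
    unfold D. rewrite E1, E2. simpl fin.
    replace (v1 - v2)%C with ((v1 - w) + - (v2 - w))%C by ring.
    eapply Rle_trans; [apply Cmod_triangle|]. rewrite Cmod_opp. lra.
  - set (d := D (mkpt lam k None)). apply NNPP. intro Hn.
    assert (K : forall n : nat, exists w, INR n < Cmod w /\ Cmod d + 1 < Cmod (D (mkpt lam k (Some w)))).
    { intro n. apply NNPP. intro Hc. apply Hn. exists (INR n), (Cmod d + 1). intros w Hw.
      apply Rnot_lt_le. intro. apply Hc. exists w. auto. }
    apply choice in K. destruct K as [u Hu].
    assert (L : cs_lim (fun n => Some (u n)) None).
    { intro M. destruct (INR_unbounded M) as [N HN]. exists N. intros n Hn'. right. exists (u n).
      split; [reflexivity|]. destruct (Hu n) as [H _]. apply le_INR in Hn'. lra. }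
    assert (L' := diff_cont _ _ (mkpt_None_neq lam k l Hk) (mkpt_lim lam k _ None Hl (fun H => H) L)).
    destruct (L' 1 Rlt_0_1) as [N HN]. specialize (HN N (Nat.le_refl _)). fold d in HN.
    destruct (Hu N) as [_ HB].
    assert (T := Cmod_triangle (D (mkpt lam k (Some (u N))) - d)%C d).
    replace (D (mkpt lam k (Some (u N))) - d + d)%C with (D (mkpt lam k (Some (u N)))) in T by ring. lra.
Qed.

(* The norm of [D - s] down to the base. *)
Let N (s w : C) : C :=
  ((D (mkpt lam S0 (Some w)) - s) * (D (mkpt lam S1 (Some w)) - s) * (D (mkpt lam S2 (Some w)) - s))%C.

Lemma norm_cont s w : ccont (N s) w.
Proof.
  intros v Hv. destruct (lift_relabel lam v w Hl Hv) as [sigma [Hs HL]].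
  assert (L : forall k, clim (fun n => D (mkpt lam (sigma n k) (Some (v n))) - s)%C (D (mkpt lam k (Some w)) - s)%C).
  { intro k. apply clim_minus; [|apply clim_const]. apply diff_cont; [apply mkpt_Some_neq|apply HL]. }
  assert (LL := clim_mult _ _ _ _ (clim_mult _ _ _ _ (L S0) (L S1)) (L S2)).
  apply (clim_ext_loc _ _ _) with (2 := LL). exists O. intros n _. unfold N.
  destruct (Hs n) as [E|[E|E]]; rewrite E; simpl; ring.
Qed.

Lemma norm_holomorphic s : off_line_holomorphic (N s).
Proof.
  split; [apply norm_cont|]. intros z Hz.
  assert (K : forall k, cdiff (fun w => D (mkpt lam k (Some w))) z).
  { intro k.
    assert (F : forall f, is_psi lam l f -> cdiff (fun w => fin (f (mkpt lam k (Some w)))) z).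
    { intros f Hf. apply (mero_at_cdiff (fun x => f (mkpt lam k x))).
      - destruct Hf as [[_ [_ Hm]] _]. apply (Hm k (Some z)). simpl. unfold inD1, inD2. tauto.
      - intro u. apply (is_psi_finite lam l f); [assumption|assumption|apply mkpt_Some_neq]. }
    unfold D. apply cdiff_minus; apply F; assumption. }
  change (cdiff (N s) z). unfold N.
  repeat apply cdiff_mult; apply cdiff_minus; auto using cdiff_const.
Qed.

Lemma norm_bounded s : exists B, forall w, Cmod (N s w) <= B.
Proof.
  destruct (diff_bounded_far S0) as [M0 [B0 H0]]. destruct (diff_bounded_far S1) as [M1 [B1 H1]].
  destruct (diff_bounded_far S2) as [M2 [B2 H2]].
  set (M := Rmax M0 (Rmax M1 M2)).
  assert (A0 : M0 <= M) by apply Rmax_l.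
  assert (A1 : M1 <= M) by (eapply Rle_trans; [apply Rmax_l|apply Rmax_r]).
  assert (A2 : M2 <= M) by (eapply Rle_trans; [apply Rmax_r|apply Rmax_r]).
  assert (Far : forall w, M < Cmod w ->
     Cmod (N s w) <= (B0 + Cmod s) * (B1 + Cmod s) * (B2 + Cmod s)).
  { intros w Hw. unfold N. rewrite !Cmod_mult.
    assert (T : forall d B, Cmod d <= B -> 0 <= Cmod (d - s)%C <= B + Cmod s).
    { intros d B Hd. split; [apply Cmod_ge_0|]. unfold Cminus.
      eapply Rle_trans; [apply Cmod_triangle|]. rewrite Cmod_opp. lra. }
    destruct (T _ _ (H0 w ltac:(lra))). destruct (T _ _ (H1 w ltac:(lra))). destruct (T _ _ (H2 w ltac:(lra))).
    apply Rmult_le_compat; [apply Rmult_le_pos; assumption|assumption| |assumption].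
    apply Rmult_le_compat; assumption. }
  set (B := (B0 + Cmod s) * (B1 + Cmod s) * (B2 + Cmod s)) in *.
  apply NNPP. intro Hn.
  (* Values above [B] occur only in the disc of radius [M]; a convergent subsequence of points with
     unbounded values would contradict continuity. *)
  assert (K : forall n : nat, exists w, Rmax (INR n) B < Cmod (N s w)).
  { intro n. apply NNPP. intro Hc. apply Hn. exists (Rmax (INR n) B). intro w.
    apply Rnot_lt_le. intro. apply Hc. exists w; assumption. }
  apply choice in K. destruct K as [u Hu].
  destruct (bounded_subsequence_C u M) as [f [w [Hf L]]].
  { intro n. apply Rnot_lt_le. intro H. specialize (Far _ H). specialize (Hu n).
    generalize (Rmax_r (INR n) B). lra. }
  assert (L' := norm_cont s w _ L). destruct (L' 1 Rlt_0_1) as [m Hm].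
  destruct (INR_unbounded (Cmod (N s w) + 1)) as [m' Hm'].
  specialize (Hm (m + m')%nat ltac:(lia)). specialize (Hu (f (m + m')%nat)). specialize (Hf (m + m')%nat).
  assert (I : INR m' <= INR (f (m + m')%nat)) by (apply le_INR; lia).
  assert (T := Cmod_triangle (N s (u (f (m + m')%nat)) - N s w)%C (N s w)).
  replace (N s (u (f (m + m')%nat)) - N s w + N s w)%C with (N s (u (f (m + m')%nat))) in T by ring.
  generalize (Rmax_l (INR (f (m + m')%nat)) B). lra.
Qed.

Lemma norm_constant s w w' : N s w = N s w'.
Proof.
  destruct (norm_bounded s) as [B HB]. apply (liouville_off_line (N s) B); [apply norm_holomorphic|exact HB].
Qed.

(** For [s = D p] one factor of the product vanishes over the projection of [p], and constancy
    carries the zero to the base point [0]. Thus [D p] is one of the three values of [D] over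
    [0]. *)
Lemma diff_values p : p <> inf -> N (D p) (RtoC 0) = RtoC 0.
Proof.
  assert (Fin : forall k w, N (D (mkpt lam k (Some w))) (RtoC 0) = RtoC 0).
  { intros k w. rewrite (norm_constant _ _ w). unfold N. destruct k; ring. }
  intro Hp. rewrite (RS_mkpt lam p) in Hp |- *. destruct (proj lam p) as [w|]; [apply Fin|].
  set (k := rs_sheet lam p) in *. clearbody k.
  (* Points over infinity other than [inf] are limits of finite ones, and the product is continuous
     in [s]. *)
  assert (L := diff_cont _ _ Hp (mkpt_lim lam k _ None Hl (fun H => H) cs_lim_INR)).
  assert (CN : forall s, ccont (fun s => N s (RtoC 0)) s).
  { intro s. unfold N. repeat apply ccont_mult; apply ccont_minus; auto using ccont_const, ccont_id. }
  assert (L2 := CN _ _ L). cbv beta in L2.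
  refine (clim_unique _ _ _ L2 _).
  apply (clim_ext_loc (fun _ => RtoC 0)); [|apply clim_const]. exists O. intros n _. symmetry. apply Fin.
Qed.

Lemma phi'_neq_inf z : phi' (Some z) <> inf.
Proof.
  intro E. apply (f_equal phi) in E. rewrite Hphi' in E. unfold inf in E.
  rewrite (is_psi_pole lam l phi Hl Hphi) in E. discriminate.
Qed.

(** The continuous inverse [phi'] parametrises the surface without [inf] by the plane. This supplies
    the connectedness, as segments are available in the plane. Infinity on sheet 0 is distinct from
    [inf], and both maps vanish there. *)
Theorem is_psi_unique p : psi p = phi p.
Proof.
  destruct (classic (p = inf)) as [->|Hp].
  { unfold inf. rewrite (is_psi_pole lam l psi Hl Hpsi), (is_psi_pole lam l phi Hl Hphi). reflexivity. }
  set (E := fun z => D (phi' (Some z))).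
  assert (CE : forall z, ccont E z).
  { intros z v Hv. unfold E. apply diff_cont; [apply phi'_neq_inf|].
    apply (Hphi'c (fun n => Some (v n))). apply cs_lim_Some, Hv. }
  assert (Const := three_values_constant E _ _ _ CE (fun z => diff_values _ (phi'_neq_inf z))).
  assert (DE : forall q, q <> inf -> D q = E (fin (phi q))).
  { intros q Hq. unfold E. rewrite <- (is_psi_finite lam l phi q Hl Hphi Hq), Hphi''. reflexivity. }
  assert (Z : D (mkpt lam S0 None) = RtoC 0).
  { unfold D. rewrite (is_psi_zero lam l psi Hl Hpsi), (is_psi_zero lam l phi Hl Hphi). simpl. ring. }
  assert (Dp : D p = RtoC 0).
  { rewrite (DE p Hp), (Const _ (fin (phi (mkpt lam S0 None)))), <- DE; [exact Z|].
    apply mkpt_None_neq. auto. }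
  rewrite (is_psi_finite lam l psi p Hl Hpsi Hp), (is_psi_finite lam l phi p Hl Hphi Hp).
  f_equal. replace (fin (psi p)) with (D p + fin (phi p))%C by (unfold D; ring). rewrite Dp. ring.
Qed.
End Uniqueness.

(** The explicit map [m] composed with [h] is the comparison map in the uniqueness theorem: its
    inverse is the lift of [G] after the inverse of [m], continuous by compactness of the sphere. *)
Lemma is_psi_iff lam a b c l (m : CS -> CS) : params lam a b c -> l <> S0 ->
  (forall w, mero_at_CS m w) ->
  (exists mi, (forall z, mi (m z) = z) /\ (forall w, m (mi w) = w)) ->
  (forall psi, (forall z, psi (gmap lam a c z) = m z) -> is_psi lam l psi) ->
  forall psi, is_psi lam l psi <-> (forall z, psi (gmap lam a c z) = m z).
Proof.
  intros P Hl Hm [mi [Hmi1 Hmi2]] Hex psi. split; [|apply Hex]. intros Hpsi z.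
  destruct (gmap_homeo _ _ _ _ P) as [h [Hhg [Hgh Hcont]]].
  set (phi := fun p => m (h p)).
  assert (Hphi : is_psi lam l phi).
  { apply Hex. intro w. unfold phi. rewrite Hhg. reflexivity. }
  assert (Cmi : forall u w, cs_lim u w -> cs_lim (fun n => mi (u n)) (mi w)).
  { apply (inverse_continuous CS cs_lim m mi); auto.
    - exact cs_lim_unique.
    - intros. apply cs_lim_subseq; assumption.
    - intros u v x E. apply cs_lim_ext_loc. exists O. auto.
    - intros u w Hu. apply mero_at_CS_cont; auto. }
  rewrite (is_psi_unique lam l psi phi (fun w => gmap lam a c (mi w))).
  - unfold phi. rewrite Hhg. reflexivity.
  - exact (par_lam _ _ _ _ P).
  - exact Hpsi.
  - exact Hphi.
  - intro w. unfold phi. rewrite Hhg. apply Hmi2.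
  - intro p. unfold phi. rewrite Hmi1. apply Hgh.
  - intros u w Hu. apply (gmap_continuous _ _ _ _ P (fun n => mi (u n))). apply Cmi, Hu.
  - exact Hl.
Qed.

Theorem theorem3p3 (lam : R) (Hlam : 1 < lam) :
  (exists! a : R, 0 < a < 1 /\
     a ^ 8 + (16 * lam ^ 2 - 8) * a ^ 6 + 18 * a ^ 4 - 27 = 0) /\
  (forall a : R, 0 < a < 1 ->
     a ^ 8 + (16 * lam ^ 2 - 8) * a ^ 6 + 18 * a ^ 4 - 27 = 0 ->
     exists g : CS -> RS lam,
       conformal_homeo lam g /\
       (forall z, proj lam (g z) = Gmap a z) /\
       (forall psi, is_psi lam S1 psi <-> (forall z, psi (g z) = m1 a z)) /\
       (forall psi, is_psi lam S2 psi <-> (forall z, psi (g z) = m2 a z))).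
Proof.
  split; [exact (equation_unique lam Hlam)|].
  intros a Ha E. destruct (params_exist lam a Hlam Ha E) as [b P].
  destruct (gmap_homeo _ _ _ _ P) as [h [Hhg [Hgh Hcont]]].
  exists (gmap lam a ((1 - a ^ 2) ^ 2 / (1 + a ^ 2))).
  split; [exact (gmap_conformal _ _ _ _ P)|].
  split; [intro z; apply proj_gmap|]. split.
  - apply (is_psi_iff _ _ _ _ S1 (m1 a) P); [discriminate| | |].
    + intro w. apply m1_mero. lra.
    + apply m1_bijective. lra.
    + intro psi. apply (is_psi_m1 _ _ _ _ h P Hgh Hhg Hcont).
  - apply (is_psi_iff _ _ _ _ S2 (m2 a) P); [discriminate| | |].
    + intro w. apply m2_mero. lra.
    + apply m2_bijective. lra.
    + intro psi. apply (is_psi_m2 _ _ _ _ h P Hgh Hhg Hcont).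
Qed.
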